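(* Let $\theta_0\in(0,2\pi)$ and $K=\left\{e^{i\theta}:\theta\in\left[-\frac{\theta_0}{2},\frac{\theta_0}{2}\right]\right\}$. Then $$\alpha_K=\frac{1-\sin\left(\frac{\theta_0}{4}\right)}{2\sin\left(\frac{\theta_0}{4}\right)}.$$
   Context: For a bounded domain $G\subset\mathbb{C}\setminus(-\infty,0]$ and $\alpha>0$, $z^{\alpha}$ is defined with the principal branch of the logarithm, and $(G,z^{\alpha})$ is called a pair of approximation if for every function $f$ holomorphic in $G$ there is a sequence of polynomials $(P_n)_n$ with $\deg(P_n)\le n$ such that $z^{\alpha n}P_n\to f$ locally uniformly on $G$. For a compact set $K\subset\mathbb{C}\setminus(-\infty,0]$ with connected complement, $\alpha_K\in(0,\infty]$ is the number such that, for $0<\alpha<\alpha_K$, there is a simply connected bounded domain $G\subset\mathbb{C}\setminus(-\infty,0]$ containing $K$ for which $(G,z^\alpha)$ is a pair of approximation, and for $\alpha\ge\alpha_K$ there is no such $G$. *)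

(* Defs.v *)
From HB Require Import structures.
From mathcomp Require Import all_boot all_order all_algebra.
From mathcomp Require Import all_classical all_reals all_analysis.
From mathcomp Require Import complex.
Import Order.TTheory GRing.Theory Num.Theory numFieldNormedType.Exports.

Set Implicit Arguments.
Unset Strict Implicit.
Unset Printing Implicit Defensive.

Local Open Scope complex_scope.
Local Open Scope classical_set_scope.
Local Open Scope ring_scope.

(* R[i] as a normed space over itself: the topology is that of the modulus,
   and [derivable f z 1] for f : R[i] -> R[i] is complex differentiability. *)
HB.instance Definition _ (R : rcfType) := NormedModule.copy R[i] R[i]^o.

Section Defs.
Context {R : realType}.
Implicit Types (z w : R[i]) (G K : set R[i]).

(* C \ (-oo, 0] *)
Definition slit_plane : set R[i] := [set z | ~ (complex.Im z = 0 /\ complex.Re z <= 0)].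

Definition cexp z : R[i] :=
  (expR (complex.Re z) * cos (complex.Im z)) +i* (expR (complex.Re z) * sin (complex.Im z)).

(* Principal argument, with values in (-pi, pi] for z != 0. *)
Definition carg z : R :=
  let t := acos (complex.Re z / Normc.normc z) in if 0 <= complex.Im z then t else - t.

Definition clog z : R[i] := ln (Normc.normc z) +i* carg z.

Definition cpow z (a : R) : R[i] := cexp (a%:C * clog z).

Definition domain G := [/\ open G, connected G & G !=set0].

Definition path_connected G := forall z w, G z -> G w ->
  exists gamma : R -> R[i], [/\ {within `[0, 1], continuous gamma},
    gamma @` `[0, 1] `<=` G, gamma 0 = z & gamma 1 = w].

Definition null_homotopic G (gamma : R -> R[i]) :=
  exists H : R * R -> R[i],
    [/\ {within `[0, 1] `*` `[0, 1], continuous H},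
        H @` (`[0, 1] `*` `[0, 1]) `<=` G,
        (forall t, t \in `[0, 1] -> H (0, t) = gamma t),
        (forall t, t \in `[0, 1] -> H (1, t) = gamma 0) &
        (forall s, s \in `[0, 1] -> H (s, 0) = gamma 0 /\ H (s, 1) = gamma 0)].

Definition simply_connected G := path_connected G /\
  forall gamma : R -> R[i], {within `[0, 1], continuous gamma} ->
    gamma @` `[0, 1] `<=` G -> gamma 0 = gamma 1 -> null_homotopic G gamma.

Definition holomorphic_in G (f : R[i] -> R[i]) :=
  forall z, G z -> derivable f z 1.

Definition locally_uniform_cvg G (F : nat -> R[i] -> R[i]) (f : R[i] -> R[i]) :=
  forall z, G z -> exists2 U, nbhs z U & {uniform U `&` G, F @ \oo --> f}.

(* size p = deg p + 1 for p != 0, so the bound on size reads deg (P n) <= n *)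
Definition approximation_pair G (alpha : R) :=
  forall f, holomorphic_in G f ->
    exists2 P : nat -> {poly R[i]}, (forall n, (size (P n) <= n.+1)%N) &
      locally_uniform_cvg G (fun n z => cpow z (alpha * n%:R) * (P n).[z]) f.

Definition approximable K (alpha : R) := exists G,
  [/\ domain G /\ bounded_set G, simply_connected G, G `<=` slit_plane,
      K `<=` G & approximation_pair G alpha].

(* [is_alpha K a]: a is the threshold alpha_K in (0, +oo]; it is meant for K
   compact in the slit plane with connected complement. *)
Definition is_alpha K (a : \bar R) := (0 < a)%E /\
  forall alpha : R, 0 < alpha ->
    ((alpha%:E < a)%E -> approximable K alpha) /\
    ((a <= alpha%:E)%E -> ~ approximable K alpha).

Lemma is_alpha_unique K a b : is_alpha K a -> is_alpha K b -> a = b.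
Proof.
wlog ab : a b / (a <= b)%E.
  move=> h ha hb; have [/h|/ltW/h h'] := leP a b; first exact.
  by apply/esym/h'.
move=> [a0 ha] [b0 hb]; apply/eqP; rewrite eq_le ab /=; apply: contraPT isT.
rewrite -ltNge => altb; case: a a0 ha altb {ab} => [r| |] //= r0 ha altb.
- by have := (ha r r0).2 (lexx _); have := (hb r r0).1 altb.
- by move: altb; rewrite ltNge leey.
Qed.

(* {e^{i theta} : theta in [-theta0/2, theta0/2]} *)
Definition circular_arc (theta0 : R) : set R[i] :=
  [set cexp (0 +i* theta) | theta in `[- (theta0 / 2), theta0 / 2]].

End Defs.

(* Main.v *)
(* Write s = sin (theta0 / 4). The map psi(w) = w (s w + 1) / (w + s) sends
   |w| > 1 onto the complement of the arc K, and the two solutions x, y of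
   psi(w) = z satisfy x + y = (z - 1) / s and x y = - z. Hence the Faber
   polynomials of K are F_k(z) = x^k + y^k - (- s)^k, and a polynomial
   p = sum_k c_k F_k satisfies |c_k| r^k <= max_{|w| = r} |p(psi(w))| for r >= 1.

   The sign of log R + alpha log m(R) near R = 1, where
   m(R) = min_{|w| = R} |psi(w)| = psi(- R), decides everything, and it changes
   at alpha = (1 - s) / (2 s).

   If alpha is at least this value, the approximation of f = 1 bounds P_n on K;
   then |P_n(psi(- R))| <= C R^n, while it should be about m(R)^(- alpha n),
   and R m(R)^alpha < 1 for all R > 1: a contradiction for R close to 1.

   If alpha is smaller, R m(R)^alpha > 1 for some R > 1. Given a polynomial q,
   approximate q z^(- alpha n) by polynomials on {psi(w) : |w| <= R} and
   truncate the Faber expansion at degree n: the relative error is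
   geometrically small near K. This neighbourhood is taken to be the image G
   under exp of a thin rectangle. A function f holomorphic in G is a limit of
   polynomials in log z (Cauchy's formula on rectangles, obtained from
   Goursat's lemma), and log z is a limit of polynomials in z, because
   (1 - s^2) z = (1 + s x) (1 + s y) turns log (1 + s x) + log (1 + s y) into
   a series in the power sums x^k + y^k. *)
Require Import Defs.
From mathcomp Require Import all_boot all_order all_algebra.
From mathcomp Require Import all_classical all_reals all_analysis.
From mathcomp Require Import complex.
From mathcomp Require Import ring lra.
Import Order.TTheory GRing.Theory Num.Theory numFieldNormedType.Exports.
Import Normc.

Set Implicit Arguments.
Unset Strict Implicit.
Unset Printing Implicit Defensive.

Local Open Scope complex_scope.
Local Open Scope classical_set_scope.
Local Open Scope ring_scope.

(** * Complex modulus and complex derivatives *)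

(** The threshold comes from the behaviour at R = 1. There m(1) = 1, and the derivative of log R +
    alpha log m(R) is 1 - 2 s alpha / (1 - s), which vanishes exactly at alpha = (1 - s) / (2 s). At
    that value a negative cubic term decides, which is why the threshold itself lies on the side
    where approximation fails.

    Two contour arguments are carried out without evaluating a contour integral. The integral W(u)
    of the Cauchy kernel over a rectangle is only bounded, its imaginary part from below; this
    suffices to divide by it with a geometric series. The Laurent coefficients of p(psi(w)) are
    extracted by averaging over roots of unity.

    No inverse branch of psi is ever chosen: every argument carries both solutions x, y, and
    expressions symmetric in them are polynomials in z. *)

Section ComplexModulus.
Context {R : realType}.
Implicit Types z w : R[i].

Lemma normc_ge0 z : 0 <= normc z.
Proof. by case: z => a b; rewrite sqrtr_ge0. Qed.

Lemma normcD z w : normc (z + w) <= normc z + normc w.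
Proof. exact: le_normcD. Qed.

Lemma normcB z w : normc (z - w) <= normc z + normc w.
Proof. by rewrite (le_trans (normcD _ _)) ?normcN. Qed.

Lemma normc_distC z w : normc (z - w) = normc (w - z).
Proof. by rewrite -normcN opprB. Qed.

Lemma normcX z n : normc (z ^+ n) = normc z ^+ n.
Proof.
by elim: n => [|n IHn]; [rewrite !expr0 normc1 | rewrite !exprS normcM IHn].
Qed.

Lemma normc_eq0 z : (normc z == 0) = (z == 0).
Proof.
by apply/eqP/eqP => [/eq0_normc //|->]; exact: normc0.
Qed.

Lemma normc_gt0 z : (0 < normc z) = (z != 0).
Proof. by rewrite lt_def normc_eq0 normc_ge0 andbT. Qed.

Lemma normc_real (x : R) : normc x%:C = `|x|.
Proof. by rewrite /= expr0n addr0 sqrtr_sqr. Qed.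

Lemma normc_sqr z : normc z ^+ 2 = complex.Re z ^+ 2 + complex.Im z ^+ 2.
Proof. by case: z => a b; rewrite /= sqr_sqrtr ?addr_ge0 ?sqr_ge0. Qed.

Lemma normr_complex z : `|z| = (normc z)%:C.
Proof. by case: z. Qed.

Lemma normc_sum (I : Type) (r : seq I) (P : pred I) (F : I -> R[i]) :
  normc (\sum_(i <- r | P i) F i) <= \sum_(i <- r | P i) normc (F i).
Proof.
elim/big_ind2: _ => //; first by rewrite normc0.
by move=> x a y b xa yb; rewrite (le_trans (normcD _ _)) ?lerD.
Qed.

Lemma normc_ge_Re z : `|complex.Re z| <= normc z.
Proof.
rewrite -(@ler_pXn2r _ 2) ?nnegrE ?normc_ge0 // normc_sqr real_normK ?num_real //.
by rewrite lerDl sqr_ge0.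
Qed.

Lemma normc_ge_Im z : `|complex.Im z| <= normc z.
Proof.
rewrite -(@ler_pXn2r _ 2) ?nnegrE ?normc_ge0 // normc_sqr real_normK ?num_real //.
by rewrite lerDr sqr_ge0.
Qed.

Lemma normc_le_ReIm z : normc z <= `|complex.Re z| + `|complex.Im z|.
Proof.
rewrite -(@ler_pXn2r _ 2) ?nnegrE ?normc_ge0 ?addr_ge0 // normc_sqr sqrrD.
rewrite !real_normK ?num_real // addrAC lerDl.
by rewrite mulrn_wge0 // mulr_ge0.
Qed.

(** The norm of [R[i]] takes its values in [R[i]], so the radius of a ball is a complex number that
    happens to be real and positive. This equivalence allows every later estimate to use radii in
    [R]. *)
Lemma nbhs_normc z (A : set R[i]) :
  nbhs z A <-> exists2 e : R, 0 < e & forall w, normc (w - z) < e -> A w.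
Proof.
split=> [/nbhs_ballP [e /= e0 sub]|[e e0 sub]].
  have eE : e = (complex.Re e)%:C.
    by rewrite RRe_real // realE ltW.
  exists (complex.Re e); first by rewrite -ltcR -eE.
  move=> w wz; apply: sub; rewrite -ball_normE /= normr_complex eE.
  by rewrite ltcR normc_distC.
apply/nbhs_ballP; exists e%:C; first by rewrite /= ltcR.
move=> w; rewrite -ball_normE /= normr_complex ltcR normc_distC.
exact: sub.
Qed.

Lemma cvg_normc (T : Type) (F : set_system T) {FF : Filter F} (f : T -> R[i]) z :
  (f @ F --> z) <-> forall e, 0 < e -> \forall t \near F, normc (f t - z) < e.
Proof.
split=> [fz e e0|H A /nbhs_normc [e e0 sub]].
  by apply: (fz [set w | normc (w - z) < e]); apply/nbhs_normc; exists e.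
rewrite nbhs_simpl /=.
by apply: filterS (H e e0) => t; exact: sub.
Qed.

Lemma continuous_normc (f : R[i] -> R[i]) z : {for z, continuous f} <->
  forall e, 0 < e -> exists2 d, 0 < d &
    forall w, normc (w - z) < d -> normc (f w - f z) < e.
Proof.
split=> [fz e e0|H].
  by move/(@cvg_normc _ (nbhs z) (nbhs_filter z)) : fz => /(_ e e0) /nbhs_normc.
by apply/(@cvg_normc _ (nbhs z) (nbhs_filter z)) => e /H fz; apply/nbhs_normc.
Qed.

Lemma continuous_normc_real (f : R[i] -> R) z : {for z, continuous f} <->
  forall e, 0 < e -> exists2 d, 0 < d &
    forall w, normc (w - z) < d -> `|f w - f z| < e.
Proof.
have H := @cvgrPdist_lt _ _ _ (nbhs z) (nbhs_filter z) f (f z).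
split=> [/H fz e /fz /nbhs_normc [d d0 zd]|fz].
  by exists d => // w /zd; rewrite distrC.
apply/H => e /fz [d d0 zd]; apply/nbhs_normc; exists d => // w /zd.
by rewrite distrC.
Qed.

Lemma continuous_Re : continuous (@complex.Re R).
Proof.
move=> z; apply/continuous_normc_real => e e0; exists e => // w; apply: le_lt_trans.
by case: z w => [a b] [c d]; exact: normc_ge_Re ((c +i* d) - (a +i* b)).
Qed.

Lemma continuous_Im : continuous (@complex.Im R).
Proof.
move=> z; apply/continuous_normc_real => e e0; exists e => // w; apply: le_lt_trans.
by case: z w => [a b] [c d]; exact: normc_ge_Im ((c +i* d) - (a +i* b)).
Qed.

Lemma cvg_complex (T : Type) (F : set_system T) {FF : Filter F} (f g : T -> R) (a b : R) :
  f @ F --> a -> g @ F --> b -> (fun t => f t +i* g t) @ F --> a +i* b.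
Proof.
move=> fa gb; apply/cvg_normc => e e0.
have e2 : 0 < e / 2 by rewrite divr_gt0.
move/cvgrPdist_lt: fa => /(_ _ e2) fa; move/cvgrPdist_lt: gb => /(_ _ e2) gb.
near=> t; apply: le_lt_trans (normc_le_ReIm _) _ => /=.
rewrite [e]splitr ltrD // distrC; near: t; [exact: fa|exact: gb].
Unshelve. all: by end_near. Qed.

Lemma normc_dist_le z w : `|normc z - normc w| <= normc (z - w).
Proof.
rewrite ler_norml; apply/andP; split.
  rewrite lerBrDr addrC lerBlDl -lerBlDr.
  by rewrite normc_distC lerBlDr; have := normcD (w - z) z; rewrite subrK.
by rewrite lerBlDr; have := normcD (z - w) w; rewrite subrK.
Qed.

Lemma continuous_nc : continuous (@normc R).
Proof.
move=> z; apply/continuous_normc_real => e e0; exists e => // w.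
by apply: le_lt_trans; exact: normc_dist_le.
Qed.

End ComplexModulus.

(** * Rules of calculus for complex differentiability *)

Section ComplexDerivative.
Context {R : realType}.
Implicit Types (z w : R[i]) (f g : R[i] -> R[i]).

(* Caratheodory's form of complex differentiability. *)
Definition cdiff f z := exists2 phi : R[i] -> R[i],
  {for z, continuous phi} & forall w, f w - f z = phi w * (w - z).

Lemma contcD f g z : {for z, continuous f} -> {for z, continuous g} ->
  {for z, continuous (fun w => f w + g w)}.
Proof. exact: (@cvgD _ _ _ (nbhs z) (nbhs_filter z)). Qed.

Lemma contcM f g z : {for z, continuous f} -> {for z, continuous g} ->
  {for z, continuous (fun w => f w * g w)}.
Proof. exact: (@cvgM _ _ (nbhs z) (nbhs_filter z)). Qed.

Lemma contcV f z : f z != 0 -> {for z, continuous f} ->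
  {for z, continuous (fun w => (f w)^-1)}.
Proof. by move=> f0 fc; exact: (@cvgV _ _ (nbhs z) (nbhs_filter z) _ _ f0 fc). Qed.

Lemma contc_comp f g z : {for z, continuous f} -> {for (f z), continuous g} ->
  {for z, continuous (fun w => g (f w))}.
Proof. exact: continuous_comp. Qed.

Lemma contc_cst c z : {for z, continuous (fun=> c : R[i])}.
Proof. exact: cst_continuous. Qed.

Arguments contc_cst : clear implicits.

Lemma contc_id z : {for z, continuous (fun w => w)}.
Proof. by apply/continuous_normc => e e0; exists e. Qed.

Arguments contc_id : clear implicits.

Lemma cdiff_cont f z : cdiff f z -> {for z, continuous f}.
Proof.
move=> [phi phic fE].
suff : {for z, continuous (fun w => phi w * (w - z) + f z)}.
  by rewrite (_ : (fun _ => _) = f)//; apply/funext => w; rewrite -fE subrK.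
have c1 := contcD (contc_id z) (contc_cst (- z) z).
have c2 := contcM phic c1.
have c3 := contcD c2 (contc_cst (f z) z).
exact c3.
Qed.

Lemma derivable_cdiff f z : derivable f z 1 -> cdiff f z.
Proof.
move=> /cvg_ex [l /=].
move=> /(@cvg_normc _ _ _ (dnbhs_filter _)) H.
exists (fun w => if w == z then l else (f w - f z) / (w - z)); last first.
  move=> w; case: eqVneq => [->|wz]; first by rewrite !subrr mulr0.
  by rewrite divfK // subr_eq0.
apply/continuous_normc => e e0; have := H e e0.
move=> /nbhs_normc [d d0 dP]; exists d => // w wz.
rewrite eqxx; case: eqVneq => [_|nwz]; first by rewrite subrr normc0.
have := dP (w - z); rewrite subr0 => /(_ wz).
rewrite subr_eq0 => /(_ nwz) /=.
by rewrite [_ *: 1]mulr1 subrK [_^-1 *: _]mulrC.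
Qed.

Lemma cdiff_cst c z : cdiff (fun=> c) z.
Proof. by exists (fun=> 0) => [|w]; [exact: (contc_cst 0 z)|rewrite mul0r subrr]. Qed.

Lemma cdiff_id z : cdiff (fun w => w) z.
Proof. by exists (fun=> 1) => [|w]; [exact: (contc_cst 1 z)|rewrite mul1r]. Qed.

Lemma cdiffD f g z : cdiff f z -> cdiff g z -> cdiff (fun w => f w + g w) z.
Proof.
move=> [p pc fE] [q qc gE]; exists (fun w => p w + q w); first exact: contcD.
by move=> w; rewrite mulrDl -fE -gE; ring.
Qed.

Lemma cdiffM f g z : cdiff f z -> cdiff g z -> cdiff (fun w => f w * g w) z.
Proof.
move=> [p pc fE] dg; have [q qc gE] := dg.
exists (fun w => p w * g w + f z * q w).
  exact: (contcD (contcM pc (cdiff_cont dg)) (contcM (contc_cst (f z) z) qc)).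
move=> w; rewrite mulrDl mulrAC -fE -[f z * q w * _]mulrA -gE; ring.
Qed.

(** A local factorization extends to a global one: at distance at least d the difference quotient
    itself is taken as factor, which is harmless because continuity is only required at z. *)
Lemma cdiff_near f (phi : R[i] -> R[i]) z (d : R) : 0 < d -> {for z, continuous phi} ->
  (forall w, normc (w - z) < d -> f w - f z = phi w * (w - z)) -> cdiff f z.
Proof.
move=> d0 phic fE.
exists (fun w => if normc (w - z) < d then phi w else (f w - f z) / (w - z)).
  apply/continuous_normc => e; move/continuous_normc: phic => /[apply] -[b b0 bP].
  exists (Num.min b d); first by rewrite lt_min b0.
  by move=> w; rewrite lt_min subrr normc0 d0 => /andP[/bP wb ->].
move=> w; case: ifPn => [/fE //|wd]; rewrite divfK // subr_eq0.
by apply: contraNneq wd => ->; rewrite subrr normc0.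
Qed.

Lemma cdiffV f z : f z != 0 -> cdiff f z -> cdiff (fun w => (f w)^-1) z.
Proof.
move=> f0 df; have [p pc fE] := df.
have [d d0 dP] : exists2 d, 0 < d & forall w, normc (w - z) < d -> f w != 0.
  have /continuous_normc /(_ (normc (f z))) := cdiff_cont df.
  rewrite normc_gt0 => /(_ f0) [d d0 dP]; exists d => // w /dP.
  by apply: contraTneq => ->; rewrite sub0r normcN ltxx.
apply: (@cdiff_near _ (fun w => -1 * p w * (f w)^-1 * (f z)^-1) _ d d0).
  have c1 := contcM (contc_cst (-1) z) pc.
  exact: (contcM (contcM c1 (contcV f0 (cdiff_cont df))) (contc_cst (f z)^-1 z)).
move=> w /dP fw0.
have -> : -1 * p w * (f w)^-1 / f z * (w - z) = - (p w * (w - z)) * (f w)^-1 / f z by ring.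
by rewrite -fE; field; apply/andP.
Qed.

Lemma cdiff_comp f g z : cdiff f z -> cdiff g (f z) ->
  cdiff (fun w => g (f w)) z.
Proof.
move=> df [q qc gE]; have [p pc fE] := df.
exists (fun w => q (f w) * p w).
  exact: (contcM (contc_comp (cdiff_cont df) qc) pc).
by move=> w; rewrite gE fE mulrA.
Qed.

End ComplexDerivative.
Arguments contc_cst : clear implicits.
Arguments contc_cst {R}.
Arguments contc_id : clear implicits.
Arguments contc_id {R}.

(** * Exponential and logarithm *)

Section ComplexExponential.
Context {R : realType}.
Implicit Types (z w : R[i]) (f g : R[i] -> R[i]).

(** Clearing the denominator makes the estimate valid for h = 0 too, so that the expansions of exp,
    cos and sin at 0 can be multiplied together. *)
Lemma is_derive_dist (f : R -> R) (x l : R) : is_derive x 1 f l ->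
  forall e, 0 < e -> exists2 d, 0 < d &
    forall h, `|h| < d -> `|f (h + x) - f x - l * h| <= e * `|h|.
Proof.
move=> [df dfE] e e0.
have /(@cvgrPdist_le _ _ _ _ (dnbhs_filter _)) : h^-1 *: (f (h *: 1 + x) - f x) @[h --> 0^'] --> l.
  by rewrite -dfE; exact: df.
move=> /(_ e e0) /nbhs_ballP [d /= d0 dP]; exists d => // h hd.
have [->|h0] := eqVneq h 0.
  by rewrite add0r subrr mulr0 subrr normr0 mulr0.
have := dP h; rewrite /ball /= sub0r normrN => /(_ hd h0).
rewrite [_ *: 1]mulr1 => H.
have -> : f (h + x) - f x - l * h = - (h * (l - h^-1 * (f (h + x) - f x))).
  by field.
by rewrite normrN normrM mulrC ler_wpM2r.
Qed.

Lemma cexpD z w : cexp (z + w) = cexp z * cexp w.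
Proof.
case: z w => [a b] [c d]; rewrite /cexp /= expRD cosD sinD.
by apply/eqP; rewrite eq_complex /=; apply/andP; split; apply/eqP; ring.
Qed.

Lemma cexp0 : cexp 0 = 1 :> R[i].
Proof. by rewrite /cexp /= expR0 cos0 sin0 mulr1 mulr0. Qed.

Lemma normc_cexp z : normc (cexp z) = expR (complex.Re z).
Proof.
rewrite /cexp /= !exprMn -mulrDr cos2Dsin2 mulr1 sqrtr_sqr ger0_norm // expR_ge0.
Qed.

Lemma cexp_neq0 z : cexp z != 0.
Proof. by rewrite -normc_gt0 normc_cexp expR_gt0. Qed.

Lemma cexpN z : cexp (- z) = (cexp z)^-1.
Proof.
apply: (mulfI (cexp_neq0 z)); rewrite -cexpD subrr cexp0 divff ?cexp_neq0 //.
Qed.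

Lemma cexpB1_dist e : 0 < e -> exists2 d, 0 < d &
  forall h : R[i], normc h < d -> normc (cexp h - 1 - h) <= e * normc h.
Proof.
move=> e0.
(* Call this minimum k and let n = |h|. The errors of the real and imaginary parts come to 4 k n and
   5 k n, together below 10 k n <= e n. The bound k <= 1 makes |exp a - 1| and |sin b| at most 2
   n. *)
have e8 : 0 < Num.min (e / 10) 1 by rewrite lt_min ltr01 divr_gt0.
have [d1 d10 P1] := is_derive_dist (is_derive_expR (0 : R)) e8.
have [d2 d20 P2] := is_derive_dist (is_derive_sin (0 : R)) e8.
have [d3 d30 P3] := is_derive_dist (is_derive_cos (0 : R)) e8.
set k := Num.min (e / 10) 1 in e8 P1 P2 P3.
have k1 : k <= 1 by rewrite ge_min lexx orbT.
have ke : k <= e / 10 by rewrite ge_min lexx.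
clearbody k.
exists (Num.min (Num.min d1 d2) (Num.min d3 k)); first by rewrite !lt_min d10 d20 d30 e8.
case=> a b; rewrite !lt_min => /andP[/andP[h1 h2] /andP[h3 hk]].
have na := normc_ge_Re (a +i* b); have nb := normc_ge_Im (a +i* b).
rewrite [complex.Re _]/= in na; rewrite [complex.Im _]/= in nb.
set n := normc (a +i* b) in na nb h1 h2 h3 hk *.
have := P1 a (le_lt_trans na h1); have := P2 b (le_lt_trans nb h2).
have := P3 b (le_lt_trans nb h3).
rewrite !addr0 expR0 cos0 sin0 oppr0 mul0r !mul1r !subr0 !addr0.
set E := expR a; set s := sin b; set c := cos b => Hc Hs HE.
have n0 : 0 <= n := normc_ge0 _.
have Hc' : `|c - 1| <= k * n by rewrite (le_trans Hc) // ler_wpM2l // ltW.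
have Hs' : `|s - b| <= k * n by rewrite (le_trans Hs) // ler_wpM2l // ltW.
have HE' : `|E - 1 - a| <= k * n by rewrite (le_trans HE) // ler_wpM2l // ltW.
have HE1 : `|E - 1| <= 2 * n.
  rewrite (_ : E - 1 = (E - 1 - a) + a); last by ring.
  rewrite (le_trans (ler_normD _ _)) // (_ : 2 * n = n + n); last by ring.
  by rewrite lerD // (le_trans HE') // ler_piMl.
have Hs1 : `|s| <= 2 * n.
  rewrite (_ : s = (s - b) + b); last by ring.
  rewrite (le_trans (ler_normD _ _)) // (_ : 2 * n = n + n); last by ring.
  by rewrite lerD // (le_trans Hs') // ler_piMl.
have nn : n * n <= k * n by rewrite ler_wpM2r // ltW.
have re : `|E * c - 1 - a| <= 4 * k * n.
  rewrite (_ : E * c - 1 - a = (E - 1 - a) + (c - 1) + (E - 1) * (c - 1)); last by ring.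
  rewrite (le_trans (ler_normD _ _)) // (_ : 4 * k * n = k * n + k * n + 2 * (k * n)); last by ring.
  rewrite lerD ?(le_trans (ler_normD _ _)) ?lerD // normrM.
  rewrite (le_trans (ler_pM _ _ HE1 Hc')) //.
  rewrite (_ : 2 * n * (k * n) = 2 * (k * (n * n))); last by ring.
  by rewrite ler_pM2l // (le_trans _ nn) // ler_piMl // mulr_ge0.
have im : `|E * s - b| <= 5 * k * n.
  rewrite (_ : E * s - b = (s - b) + (E - 1) * s); last by ring.
  rewrite (le_trans (ler_normD _ _)) //.
  apply: (@le_trans _ _ (k * n + 4 * (n * n))).
    rewrite lerD // normrM (le_trans (ler_pM _ _ HE1 Hs1)) //.
    by rewrite le_eqVlt; apply/orP; left; apply/eqP; ring.
  rewrite (_ : 5 * k * n = k * n + 4 * (k * n)); last by ring.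
  by rewrite lerD2l ler_pM2l.
rewrite (le_trans (normc_le_ReIm _)) //=.
apply: (@le_trans _ _ (10 * k * n)).
  have kn : 0 <= k * n by rewrite mulr_ge0 // ltW.
  rewrite subr0 (le_trans (lerD re im)) //.
  by rewrite (_ : 10 * k * n = 4 * k * n + 5 * k * n + k * n) ?lerDl //; ring.
by rewrite ler_wpM2r // mulrC -ler_pdivlMr.
Qed.

Lemma cexp_caratheodory z : exists phi : R[i] -> R[i],
  [/\ {for z, continuous phi}, phi z = cexp z &
      forall w, cexp w - cexp z = phi w * (w - z)].
Proof.
exists (fun w => if w == z then cexp z else (cexp w - cexp z) / (w - z)).
split; last 2 first.
- by rewrite eqxx.
- move=> w; case: eqVneq => [->|wz]; first by rewrite !subrr mulr0.
  by rewrite divfK // subr_eq0.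
apply/continuous_normc => e e0.
have E0 : 0 < normc (cexp z) by rewrite normc_gt0 cexp_neq0.
have [d d0 dP] := cexpB1_dist (divr_gt0 e0 (mulr_gt0 E0 (ltr0n R 2))).
exists d => // w wz; rewrite eqxx; case: eqVneq => [_|nwz].
  by rewrite subrr normc0.
have h0 : w - z != 0 by rewrite subr_eq0.
have -> : (cexp w - cexp z) / (w - z) - cexp z =
    cexp z * ((cexp (w - z) - 1 - (w - z)) / (w - z)).
  have -> : cexp w = cexp (w - z) * cexp z by rewrite -cexpD subrK.
  by field.
rewrite normcM normcM normcV mulrA.
rewrite ltr_pdivrMr ?normc_gt0 // mulrC.
apply: (@le_lt_trans _ _ (e / 2 * normc (w - z))).
  rewrite (le_trans (ler_wpM2r (ltW E0) (dP _ wz))) //.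
  by rewrite le_eqVlt; apply/orP; left; apply/eqP; field; rewrite gt_eqF.
rewrite ltr_pM2r ?normc_gt0 //; lra.
Qed.

Lemma cdiff_cexp z : cdiff cexp z.
Proof. by have [phi [phic _ phiE]] := cexp_caratheodory z; exists phi. Qed.

(** Since |z| >= - Re z, with equality exactly on (-oo, 0], membership becomes one strict inequality
    on a continuous function; the same quantity is the denominator in [carg_atan]. *)
Lemma slit_normc z : slit_plane z <-> 0 < normc z + complex.Re z.
Proof.
have h := normc_sqr z; have n0 := normc_ge0 z.
have := normc_ge_Re z; rewrite ler_norml => /andP[re1 re2].
split=> [sz|pos [im0 re0]].
  rewrite lt_def; apply/andP; split; last by lra.
  apply/eqP => e; apply: sz; split; last by lra.
  have e' : normc z = - complex.Re z by lra.
  rewrite e' in h.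
  have /eqP : complex.Im z ^+ 2 = 0 by lra.
  by rewrite expf_eq0 => /eqP.
have h2 : normc z ^+ 2 = (- complex.Re z) ^+ 2 by rewrite h im0; ring.
have : normc z = - complex.Re z.
  by apply/eqP; rewrite -(@eqrXn2 _ 2) ?oppr_ge0 //; apply/eqP.
lra.
Qed.

Lemma slit_neq0 z : slit_plane z -> z != 0.
Proof. by move=> sz; apply/eqP => z0; apply: sz; rewrite z0. Qed.

Lemma Re_gt0_slit z : 0 < complex.Re z -> slit_plane z.
Proof. by move=> z0 [_]; rewrite leNgt z0. Qed.

Lemma ReIm_bound z : -1 <= complex.Re z / normc z <= 1.
Proof.
have [->|z0] := eqVneq z 0; first by rewrite /= mul0r; lra.
have n0 : 0 < normc z by rewrite normc_gt0.
by rewrite ler_pdivlMr // ler_pdivrMr // mulN1r mul1r -ler_norml normc_ge_Re.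
Qed.

Lemma cos_carg z : cos (carg z) = complex.Re z / normc z.
Proof.
have h : complex.Re z / normc z \in `[-1, 1] by rewrite in_itv /= ReIm_bound.
by rewrite /carg; case: ifP => _; rewrite ?cosN acosK.
Qed.

Lemma sin_carg z : z != 0 -> sin (carg z) = complex.Im z / normc z.
Proof.
move=> z0; have n0 : 0 < normc z by rewrite normc_gt0.
have h : Num.sqrt (1 - (complex.Re z / normc z) ^+ 2) = `|complex.Im z| / normc z.
  rewrite -[RHS]ger0_norm ?divr_ge0 ?normc_ge0 // -sqrtr_sqr; congr Num.sqrt.
  rewrite !exprMn real_normK ?num_real // exprVn.
  have := normc_sqr z => e; rewrite (_ : complex.Im z ^+ 2 = normc z ^+ 2 - complex.Re z ^+ 2); last by rewrite e; ring.
  by field; rewrite gt_eqF.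
rewrite /carg; case: ifPn => [i0|]; first by rewrite sin_acos ?ReIm_bound // h ger0_norm.
rewrite -ltNge => i0.
by rewrite sinN sin_acos ?ReIm_bound // h ltr0_norm // mulNr opprK.
Qed.

Lemma clogK z : z != 0 -> cexp (clog z) = z.
Proof.
move=> z0; have n0 : 0 < normc z by rewrite normc_gt0.
rewrite /cexp /= lnK // cos_carg sin_carg // ![normc z * _]mulrC !divfK ?gt_eqF //.
by case: z {z0 n0}.
Qed.

Lemma cexpK z : - pi < complex.Im z <= pi -> clog (cexp z) = z.
Proof.
move=> /andP[i1 i2].
rewrite /clog /carg normc_cexp expRK /=.
have e0 : 0 < expR (complex.Re z) by exact: expR_gt0.
have -> : expR (complex.Re z) * cos (complex.Im z) / expR (complex.Re z) = cos (complex.Im z).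
  by rewrite mulrAC divff ?mul1r // gt_eqF.
case: z i1 i2 e0 => a b /= i1 i2 e0; congr (_ +i* _).
rewrite pmulr_rge0 //.
have [b0|b0] := leP 0 b.
  by rewrite sin_ge0_pi ?b0 ?i2 // cosK // in_itv /= b0.
have : sin (- b) > 0 by apply: sin_gt0_pi; lra.
rewrite sinN oppr_gt0 => sb; rewrite leNgt sb /= cosKN ?opprK //; lra.
Qed.

Lemma carg_slit z : slit_plane z -> - pi < carg z < pi.
Proof.
move=> /[dup] sz /slit_normc pos.
have zn := slit_neq0 sz.
have n0 : 0 < normc z by rewrite normc_gt0.
have b := ReIm_bound z.
have t : acos (complex.Re z / normc z) < pi.
  apply: acos_ltpi; move: b => /andP[_ ->]; rewrite andbT.
  rewrite ltr_pdivlMr // mulN1r; lra.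
have := acos_ge0 b; rewrite /carg; case: ifP => _; have := pi_gt0 R; lra.
Qed.

Lemma carg_Re_gt0 z : 0 < complex.Re z -> - (pi / 2) < carg z < pi / 2.
Proof.
move=> z0.
have n0 : 0 < normc z.
  by have := normc_ge_Re z; rewrite gtr0_norm //; exact: lt_le_trans.
have b := ReIm_bound z.
have t : acos (complex.Re z / normc z) < pi / 2.
  have p := pi_gt0 R.
  have h1 : acos (complex.Re z / normc z) \in `[0, pi].
    by rewrite in_itv /= acos_ge0 // acos_lepi.
  have h2 : pi / 2 \in `[0, (pi : R)] by rewrite in_itv /=; lra.
  by rewrite -(ltr_cos h1 h2) cos_pihalf acosK ?in_itv //= divr_gt0.
have := acos_ge0 b; rewrite /carg; case: ifP => _; have := pi_gt0 R; lra.
Qed.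

(** Half-angle formula tan(t / 2) = sin t / (1 + cos t). Unlike the definition of [carg], it has no
    case distinction on the sign of Im z, so continuity across the positive real axis can be read
    off. *)
Lemma carg_atan z : slit_plane z ->
  carg z = 2 * atan (complex.Im z / (normc z + complex.Re z)).
Proof.
move=> /[dup] sz /slit_normc pos.
have zn := slit_neq0 sz.
have n0 : 0 < normc z by rewrite normc_gt0.
have /andP[c1 c2] := carg_slit sz.
set a := carg z / 2.
have aE : carg z = a *+ 2 by rewrite /a mulr2n; lra.
have ca : 0 < cos a by apply: cos_gt0_pihalf; rewrite /a; lra.
have := cos_carg z; have := sin_carg zn; rewrite aE cos_mulr2n sin_mulr2n => S C.
have -> : complex.Im z / (normc z + complex.Re z) = tan a.
  have -> : complex.Im z = normc z * ((cos a * sin a) *+ 2) by rewrite S mulrC divfK // gt_eqF.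
  have -> : normc z + complex.Re z = normc z * (cos a ^+ 2 *+ 2).
    rewrite (_ : complex.Re z = normc z * (cos a ^+ 2 *+ 2 - 1)); first by ring.
    by rewrite C mulrC divfK // gt_eqF.
  by rewrite /tan; field; rewrite !gt_eqF.
rewrite tanK; first by rewrite mulr2n; ring.
by rewrite in_itv /=; rewrite /a; lra.
Qed.

End ComplexExponential.

(** * Differentiability of the principal logarithm, and complex powers *)

Section ComplexLogarithm.
Context {R : realType}.
Implicit Types (z w : R[i]) (f g : R[i] -> R[i]).

Lemma continuous_clog z : slit_plane z -> {for z, continuous clog}.
Proof.
move=> sz; have /slit_normc pos := sz.
have FF := nbhs_filter z.
have n0 : 0 < normc z by rewrite normc_gt0 slit_neq0.
have cR : normc w + complex.Re w @[w --> nbhs z] --> normc z + complex.Re z.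
  exact: (@cvgD _ _ _ (nbhs z) FF _ _ _ _ (@continuous_nc R z) (@continuous_Re R z)).
have cV := @cvgV _ _ (nbhs z) FF _ _ (lt0r_neq0 pos) cR.
have cM := @cvgM _ _ (nbhs z) FF _ _ _ _ (@continuous_Im R z) cV.
have cA := @continuous_cvg _ _ _ (nbhs z) FF _ _ _ (@continuous_atan R _) cM.
have cA2 := @cvgM _ _ (nbhs z) FF _ _ _ _ (@cvg_cst _ _ _ _ FF) cA.
have cL := @continuous_cvg _ _ _ (nbhs z) FF _ _ _ (@continuous_ln R _ n0) (@continuous_nc R z).
have := @cvg_complex _ _ (nbhs z) FF _ _ _ _ cL (cA2 2).
rewrite -carg_atan // => H.
apply: (cvg_trans _ H).
apply: near_eq_cvg; near=> w; rewrite /clog /= carg_atan //.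
apply/slit_normc; near: w.
by apply: (cR [set x | 0 < x]); exact: lt_nbhsr.
Unshelve. all: by end_near. Qed.

(** Inverse function argument: with exp w - exp w0 = p(w) (w - w0) at w0 = [clog z], the factor for
    the logarithm is 1 / p([clog w]). It is continuous at z because [clog] is and p(w0) = z is
    nonzero. *)
Lemma cdiff_clog z : slit_plane z -> cdiff clog z.
Proof.
move=> sz; have z0 := slit_neq0 sz.
have cl := continuous_clog sz.
have [p [pc pu pE]] := cexp_caratheodory (clog z).
rewrite clogK // in pu.
have pcl := contc_comp cl pc.
have [d d0 dP] : exists2 d, 0 < d &
    forall w, normc (w - z) < d -> p (clog w) != 0.
  have /continuous_normc /(_ (normc z)) := pcl.
  rewrite normc_gt0 => /(_ z0) [d d0 dP]; exists d => // w /dP.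
  by apply: contraTneq => ->; rewrite pu sub0r normcN ltxx.
apply: (@cdiff_near _ _ (fun w => (p (clog w))^-1) _ (Num.min d (normc z))).
- by rewrite lt_min d0 normc_gt0.
- by apply: contcV => //; rewrite pu.
move=> w; rewrite lt_min => /andP[/dP pw wz].
have w0 : w != 0 by apply: contraTneq wz => ->; rewrite sub0r normcN ltxx.
apply: (mulfI pw); rewrite mulVKf // -pE !clogK //.
Qed.

Lemma normc_cpow z (a : R) : normc (cpow z a) = expR (a * ln (normc z)).
Proof. by rewrite /cpow normc_cexp /= mul0r subr0. Qed.

Lemma cpowN z (a : R) : cpow z (- a) = (cpow z a)^-1.
Proof. by rewrite /cpow -cexpN rmorphN mulNr. Qed.

Lemma cpow_neq0 z (a : R) : cpow z a != 0.
Proof. exact: cexp_neq0. Qed.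

(** Two arguments in (-pi/2, pi/2) have their sum in (-pi, pi), so the principal branch does not
    jump. *)
Lemma clog_real_mulM (c : R) z w : 0 < c -> 0 < complex.Re z -> 0 < complex.Re w ->
  clog (c%:C * (z * w)) = (ln c)%:C + clog z + clog w.
Proof.
move=> c0 z0 w0.
have /andP[z1 z2] := carg_Re_gt0 z0; have /andP[w1 w2] := carg_Re_gt0 w0.
rewrite -[RHS]cexpK /=; last by rewrite add0r; lra.
rewrite !cexpD !clogK ?slit_neq0 //; try exact: Re_gt0_slit.
by rewrite mulrA /cexp /= lnK // cos0 sin0 mulr1 mulr0.
Qed.

End ComplexLogarithm.

(** * Uniform approximation by polynomials *)

Section PolynomialApproximation.
Context {R : realType}.
Implicit Types (z w : R[i]) (f g : R[i] -> R[i]) (X Y : set R[i]) (p : {poly R[i]}).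

Lemma expr_small (r e : R) : 0 <= r < 1 -> 0 < e ->
  exists N, forall n, (N <= n)%N -> r ^+ n <= e.
Proof.
move=> /andP[r0 r1] e0.
have : r ^+ n @[n --> \oo] --> (0 : R) by apply: cvg_expr; rewrite ger0_norm.
move/cvgrPdist_le => /(_ e e0) [N _ H]; exists N => n Nn.
by have := H n Nn; rewrite /= sub0r normrN ger0_norm // exprn_ge0.
Qed.

Definition normc_bounded X := exists M, forall z, X z -> normc z <= M.

Definition poly_approx X f := forall e, 0 < e ->
  exists p, forall z, X z -> normc (f z - p.[z]) <= e.

Lemma horner_bounded X p : normc_bounded X ->
  exists2 M, 0 <= M & forall z, X z -> normc p.[z] <= M.
Proof.
move=> [B XB]; elim/poly_ind: p => [|p c [M M0 pM]].
  by exists 0 => // z _; rewrite horner0 normc0.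
exists (M * `|B| + normc c); first by rewrite addr_ge0 ?mulr_ge0 // normc_ge0.
move=> z Xz; rewrite hornerMXaddC (le_trans (normcD _ _)) // lerD2r normcM.
by rewrite ler_pM ?normc_ge0 ?pM // (le_trans (XB z Xz)) // ler_norm.
Qed.

Lemma poly_approx_bounded X f : normc_bounded X -> poly_approx X f ->
  exists2 M, 0 <= M & forall z, X z -> normc (f z) <= M.
Proof.
move=> bX /(_ 1 ltr01) [p fp]; have [M M0 pM] := horner_bounded p bX.
exists (1 + M); first by rewrite addr_ge0.
move=> z Xz; rewrite -(subrK p.[z] (f z)) (le_trans (normcD _ _)) // lerD //.
  exact: fp.
exact: pM.
Qed.

Lemma poly_approx_eq X f g : (forall z, X z -> f z = g z) ->
  poly_approx X f -> poly_approx X g.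
Proof.
by move=> fg pf e /pf [p fp]; exists p => z Xz; rewrite -fg //; exact: fp.
Qed.

Lemma poly_approx_sub X Y f : Y `<=` X -> poly_approx X f -> poly_approx Y f.
Proof. by move=> YX pf e /pf [p fp]; exists p => z /YX; exact: fp. Qed.

Lemma poly_approx_lim X f :
  (forall e, 0 < e -> exists2 g, poly_approx X g &
     forall z, X z -> normc (f z - g z) <= e) -> poly_approx X f.
Proof.
move=> H e e0; have e2 : 0 < e / 2 by rewrite divr_gt0.
have [g /(_ _ e2) [p gp] fg] := H _ e2; exists p => z Xz.
rewrite (_ : f z - p.[z] = (f z - g z) + (g z - p.[z])); last by ring.
by rewrite (le_trans (normcD _ _)) // [e]splitr lerD ?fg ?gp.
Qed.

Lemma poly_approx_horner X p : poly_approx X (horner p).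
Proof. by move=> e e0; exists p => z _; rewrite subrr normc0 ltW. Qed.

Lemma poly_approx_cst X (c : R[i]) : poly_approx X (fun=> c).
Proof.
by move=> e e0; exists c%:P => z _; rewrite hornerC subrr normc0 ltW.
Qed.

Lemma poly_approxD X f g : poly_approx X f -> poly_approx X g ->
  poly_approx X (fun z => f z + g z).
Proof.
move=> pf pg e e0; have e2 : 0 < e / 2 by rewrite divr_gt0.
have [p fp] := pf _ e2; have [q gq] := pg _ e2; exists (p + q) => z Xz.
rewrite hornerD (_ : _ - _ = (f z - p.[z]) + (g z - q.[z])); last by ring.
by rewrite (le_trans (normcD _ _)) // [e]splitr lerD ?fp ?gq.
Qed.

Lemma poly_approxM X f g : normc_bounded X -> poly_approx X f ->
  poly_approx X g -> poly_approx X (fun z => f z * g z).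
Proof.
move=> bX pf pg e e0.
have [M M0 fM] := poly_approx_bounded bX pf.
have eM : 0 < e / 2 / (M + 1) by rewrite !divr_gt0 // ltr_wpDl.
have [q gq] := pg _ eM; have [M' M'0 qM] := horner_bounded q bX.
have eM' : 0 < e / 2 / (M' + 1) by rewrite !divr_gt0 // ltr_wpDl.
have [p fp] := pf _ eM'; exists (p * q) => z Xz.
rewrite hornerM (_ : _ - _ = f z * (g z - q.[z]) + (f z - p.[z]) * q.[z]); last by ring.
rewrite (le_trans (normcD _ _)) // [e]splitr !normcM lerD //.
  apply: (@le_trans _ _ ((M + 1) * (e / 2 / (M + 1)))).
    by apply: ler_pM; rewrite ?normc_ge0 ?gq // (le_trans (fM z Xz)) // lerDl.
  by rewrite mulrC divfK // gt_eqF // ltr_wpDl.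
apply: (@le_trans _ _ (e / 2 / (M' + 1) * (M' + 1))).
  by apply: ler_pM; rewrite ?normc_ge0 ?fp // (le_trans (qM z Xz)) // lerDl.
by rewrite divfK // gt_eqF // ltr_wpDl.
Qed.

Lemma poly_approx_hornerc X p g : normc_bounded X -> poly_approx X g ->
  poly_approx X (fun z => p.[g z]).
Proof.
move=> bX pg; elim/poly_ind: p => [|p c IHp].
  apply: (@poly_approx_eq _ (fun=> 0)) (@poly_approx_cst _ _) => z _.
  by rewrite horner0.
apply: (@poly_approx_eq _ (fun z => p.[g z] * g z + c)) => [z _|].
  by rewrite hornerMXaddC.
by apply: poly_approxD; [exact: poly_approxM|exact: poly_approx_cst].
Qed.

Lemma poly_approx_comp X Y f g : normc_bounded X -> poly_approx X g ->
  (forall z, X z -> Y (g z)) -> poly_approx Y f ->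
  poly_approx X (fun z => f (g z)).
Proof.
move=> bX pg gY pf; apply: poly_approx_lim => e /pf [p fp].
exists (fun z => p.[g z]); first exact: poly_approx_hornerc.
by move=> z /gY; exact: fp.
Qed.

Lemma poly_approx_geometric (r : R) : 0 <= r < 1 ->
  poly_approx [set x | normc x <= r] (fun x => (1 - x)^-1).
Proof.
move=> r01 e e0; have /andP[r0 r1] := r01.
have r1' : 0 < 1 - r by rewrite subr_gt0.
have [N /(_ N (leqnn N)) rN] := expr_small r01 (mulr_gt0 e0 r1').
exists (\poly_(i < N) 1) => x /= xr.
have x1 : 1 - r <= normc (1 - x).
  have := normcD (1 - x) x; rewrite subrK (_ : normc 1 = 1) ?normc1 //; lra.
have nx : 1 - x != 0 by rewrite -normc_gt0 (lt_le_trans r1').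
have -> : (1 - x)^-1 - (\poly_(i < N) 1).[x] = x ^+ N / (1 - x).
  rewrite horner_poly; apply: (mulfI nx); rewrite mulrBr divff // mulrCA divff // mulr1.
  have := subrX1 x N => e1.
  rewrite (eq_bigr (fun i : 'I_N => x ^+ i)); last by move=> i _; rewrite mul1r.
  by rewrite -[1 - x]opprB mulNr -e1; ring.
rewrite normcM normcV normcX ler_pdivrMr ?(lt_le_trans r1') //.
rewrite (le_trans (lerXn2r _ _ _ xr)) ?nnegrE ?normc_ge0 //.
by rewrite (le_trans rN) // ler_pM2l.
Qed.

(** 1 / g = 1 / (1 - (1 - g)) is a geometric series in 1 - g, which takes its values in the disc of
    radius r < 1. *)
Lemma poly_approxV X g (r : R) : normc_bounded X -> 0 <= r < 1 ->
  (forall z, X z -> normc (1 - g z) <= r) -> poly_approx X g ->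
  poly_approx X (fun z => (g z)^-1).
Proof.
move=> bX r01 gr pg.
apply: (@poly_approx_eq _ (fun z => (1 - (1 + -1 * g z))^-1)) => [z _|].
  by congr (_ ^-1); ring.
apply: (@poly_approx_comp _ [set x | normc x <= r] (fun x => (1 - x)^-1)) => //.
- apply: poly_approxD; first exact: poly_approx_cst.
  by apply: poly_approxM => //; exact: poly_approx_cst.
- by move=> z /gr /=; rewrite mulN1r.
- exact: poly_approx_geometric.
Qed.

End PolynomialApproximation.

(** * Cauchy theory on rectangles *)

Section ComplexIntegral.
Context {R : realType}.
Local Notation mu := (@lebesgue_measure R).
Implicit Types (a b c m : R) (f g : R -> R[i]).

Definition contin a b f := forall t, a <= t <= b -> {for t, continuous f}.

Definition Cint a b f : R[i] :=
  (\int[mu]_(t in `[a, b]) complex.Re (f t)) +i*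
  (\int[mu]_(t in `[a, b]) complex.Im (f t)).

Lemma continuous_itv_integrable a b (h : R -> R) :
  (forall t, a <= t <= b -> {for t, continuous h}) ->
  mu.-integrable `[a, b] (EFin \o h).
Proof.
move=> hc; apply: continuous_compact_integrable; first exact: segment_compact.
apply: continuous_in_subspaceT => t; rewrite inE /= in_itv /=; exact: hc.
Qed.

Lemma contin_Re a b f : contin a b f ->
  mu.-integrable `[a, b] (EFin \o (fun t => complex.Re (f t))).
Proof.
move=> fc; apply: continuous_itv_integrable => t /fc ft.
by apply: (@continuous_comp _ _ _ f (@complex.Re R)) => //; exact: continuous_Re.
Qed.

Lemma contin_Im a b f : contin a b f ->
  mu.-integrable `[a, b] (EFin \o (fun t => complex.Im (f t))).
Proof.
move=> fc; apply: continuous_itv_integrable => t /fc ft.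
by apply: (@continuous_comp _ _ _ f (@complex.Im R)) => //; exact: continuous_Im.
Qed.

Lemma continD a b f g : contin a b f -> contin a b g ->
  contin a b (fun t => f t + g t).
Proof.
move=> fc gc t tab.
exact: (@cvgD _ _ _ (nbhs t) _ _ _ _ _ (fc t tab) (gc t tab)).
Qed.

Lemma contin_cst a b (z : R[i]) : contin a b (fun=> z).
Proof. by move=> t _; exact: cst_continuous. Qed.

Lemma continM a b f g : contin a b f -> contin a b g ->
  contin a b (fun t => f t * g t).
Proof.
move=> fc gc t tab.
exact: (@cvgM _ _ (nbhs t) _ _ _ _ _ (fc t tab) (gc t tab)).
Qed.

Lemma continV a b f : (forall t, a <= t <= b -> f t != 0) -> contin a b f ->
  contin a b (fun t => (f t)^-1).
Proof.
move=> f0 fc t tab.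
exact: (@cvgV _ _ (nbhs t) _ _ _ (f0 t tab) (fc t tab)).
Qed.

Lemma contin_sub a b a' b' f : a <= a' -> b' <= b -> contin a b f ->
  contin a' b' f.
Proof. by move=> aa bb fc t tab; apply: fc; lra. Qed.

Lemma eq_Cint a b f g : (forall t, a <= t <= b -> f t = g t) ->
  Cint a b f = Cint a b g.
Proof.
by move=> fg; congr (_ +i* _); apply: eq_Rintegral => t;
  rewrite inE /= in_itv /= => /fg ->.
Qed.

Lemma CintD a b f g : contin a b f -> contin a b g ->
  Cint a b (fun t => f t + g t) = Cint a b f + Cint a b g.
Proof.
move=> fc gc; rewrite /Cint; apply/eqP; rewrite eq_complex /=; apply/andP; split; apply/eqP.
  rewrite -RintegralD //; [|exact: contin_Re|exact: contin_Re].
  by apply: eq_Rintegral => t _; case: (f t) (g t) => [? ?] [? ?].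
rewrite -RintegralD //; [|exact: contin_Im|exact: contin_Im].
by apply: eq_Rintegral => t _; case: (f t) (g t) => [? ?] [? ?].
Qed.

Lemma Cint_cst a b (z : R[i]) : a <= b -> Cint a b (fun=> z) = (b - a)%:C * z.
Proof.
move=> ab; rewrite /Cint !Rintegral_cst //= lebesgue_measure_itv /= lte_fin.
have -> : fine (if (a < b)%R then b%:E - a%:E else 0)%E = b - a.
  case: ltP => //= ba; have -> : a = b by apply/eqP; rewrite eq_le ab.
  by rewrite subrr.
by case: z => x y; apply/eqP; rewrite eq_complex /=; apply/andP; split; apply/eqP; ring.
Qed.

Lemma CintZ a b (z : R[i]) f : contin a b f ->
  Cint a b (fun t => z * f t) = z * Cint a b f.
Proof.
move=> fc; have ir := contin_Re fc; have ii := contin_Im fc.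
have zi (x : R) : mu.-integrable `[a, b] (EFin \o (fun t => x * complex.Re (f t))).
  by apply/(integrableZl _ _ ir).
have zr (x : R) : mu.-integrable `[a, b] (EFin \o (fun t => x * complex.Im (f t))).
  by apply/(integrableZl _ _ ii).
rewrite /Cint; case: z => x y; apply/eqP; rewrite eq_complex /=; apply/andP; split; apply/eqP.
  rewrite -!RintegralZl // -RintegralB //.
  by apply: eq_Rintegral => t _; case: (f t).
rewrite -!RintegralZl // -RintegralD //.
by apply: eq_Rintegral => t _; case: (f t).
Qed.

Lemma Cint_split a m b f : a <= m <= b -> contin a b f ->
  Cint a b f = Cint a m f + Cint m b f.
Proof.
move=> /andP[am mb] fc; have ir := contin_Re fc; have ii := contin_Im fc.
have mr : mu.-integrable `[m, b] (EFin \o (fun t => complex.Re (f t))).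
  by apply: contin_Re; apply: contin_sub fc.
have mi : mu.-integrable `[m, b] (EFin \o (fun t => complex.Im (f t))).
  by apply: contin_Im; apply: contin_sub fc.
rewrite /Cint; apply/eqP; rewrite eq_complex /=; apply/andP; split; apply/eqP.
  rewrite -(Rintegral_itv_obnd_cbnd (r := m)).
    by rewrite -(@Rintegral_itvB _ _ _ _ m ir) ?bnd_simp //; ring.
  by apply: integrableS mr => //; exact: subset_itv_oc_cc.
rewrite -(Rintegral_itv_obnd_cbnd (r := m)).
  by rewrite -(@Rintegral_itvB _ _ _ _ m ii) ?bnd_simp //; ring.
by apply: integrableS mi => //; exact: subset_itv_oc_cc.
Qed.

Lemma Rintegral_itv_cst a b (x : R) : a <= b ->
  \int[mu]_(t in `[a, b]) x = (b - a) * x.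
Proof. by move=> ab; have := Cint_cst x%:C ab; rewrite /Cint => /(congr1 (@complex.Re R)) /= ->; ring. Qed.

Lemma Rintegral_itv_ge a b (h : R -> R) (B : R) : a <= b ->
  mu.-integrable `[a, b] (EFin \o h) ->
  (forall t, a <= t <= b -> B <= h t) ->
  (b - a) * B <= \int[mu]_(t in `[a, b]) h t.
Proof.
move=> ab ih hB; rewrite -Rintegral_itv_cst //; apply: le_Rintegral => //.
by apply: continuous_itv_integrable => t _; exact: cst_continuous.
Qed.

Lemma Rintegral_itv_le a b (h : R -> R) (B : R) : a <= b ->
  mu.-integrable `[a, b] (EFin \o h) ->
  (forall t, a <= t <= b -> h t <= B) ->
  \int[mu]_(t in `[a, b]) h t <= (b - a) * B.
Proof.
move=> ab ih hB; rewrite -Rintegral_itv_cst //; apply: le_Rintegral => //.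
by apply: continuous_itv_integrable => t _; exact: cst_continuous.
Qed.

Lemma Cint_Im_ge a b f (B : R) : a <= b -> contin a b f ->
  (forall t, a <= t <= b -> B <= complex.Im (f t)) ->
  (b - a) * B <= complex.Im (Cint a b f).
Proof. by move=> ab fc fB; apply: Rintegral_itv_ge => //; exact: contin_Im. Qed.

(* The factor 2 comes from estimating real and imaginary parts separately. *)
Lemma normc_Cint a b f (B : R) : a <= b -> contin a b f ->
  (forall t, a <= t <= b -> normc (f t) <= B) ->
  normc (Cint a b f) <= 2 * B * (b - a).
Proof.
move=> ab fc fB; rewrite (le_trans (normc_le_ReIm _)) //.
have -> : 2 * B * (b - a) = (b - a) * B + (b - a) * B by ring.
rewrite lerD // ler_norml -mulrN.
  apply/andP; split.
    apply: Rintegral_itv_ge => //; first exact: contin_Re.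
    move=> t /fB; have := normc_ge_Re (f t); rewrite ler_norml => /andP[]; lra.
  apply: Rintegral_itv_le => //; first exact: contin_Re.
  by move=> t /fB; have := normc_ge_Re (f t); rewrite ler_norml => /andP[]; lra.
apply/andP; split.
  apply: Rintegral_itv_ge => //; first exact: contin_Im.
  by move=> t /fB; have := normc_ge_Im (f t); rewrite ler_norml => /andP[]; lra.
apply: Rintegral_itv_le => //; first exact: contin_Im.
by move=> t /fB; have := normc_ge_Im (f t); rewrite ler_norml => /andP[]; lra.
Qed.

End ComplexIntegral.

(** * Bisection of rectangles *)

Section Bisection.
Context {R : realType}.
Implicit Types (a b c d x y w h : R).

(** The hypothesis says that the intervals [x n, x n + w / 2^n] are nested; the supremum of the left
    ends lies in all of them. *)
Lemma nested_limit (x : nat -> R) w : 0 <= w ->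
  (forall n, x n <= x n.+1 /\ x n.+1 + w / 2 ^+ n.+1 <= x n + w / 2 ^+ n) ->
  exists l, forall n, x n <= l <= x n + w / 2 ^+ n.
Proof.
move=> w0 H.
have wn n : 0 <= w / 2 ^+ n by rewrite divr_ge0 // exprn_ge0.
have inc n k : x n <= x (n + k)%N.
  elim: k => [|k IHk]; first by rewrite addn0.
  by rewrite addnS (le_trans IHk) //; case: (H (n + k)%N).
have dec n k : x (n + k)%N + w / 2 ^+ (n + k) <= x n + w / 2 ^+ n.
  elim: k => [|k IHk]; first by rewrite addn0.
  by rewrite addnS (le_trans _ IHk) //; case: (H (n + k)%N).
have le n m : x n <= x m + w / 2 ^+ m.
  have [nm|/ltnW mn] := leqP n m.
    by rewrite -(subnKC nm) (le_trans (inc n (m - n)%N)) // lerDl.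
  by rewrite (le_trans _ (dec m (n - m)%N)) // subnKC // lerDl.
exists (sup (range x)) => n; apply/andP; split.
  apply: ub_le_sup; last by exists n.
  by exists (x 0%N + w / 2 ^+ 0) => _ [m _ <-].
by apply: ge_sup; [exists (x 0%N), 0%N|move=> _ [m _ <-]].
Qed.

Lemma pow2_small w e : 0 <= w -> 0 < e -> exists N, forall n, (N <= n)%N -> w / 2 ^+ n < e.
Proof.
move=> w0 e0.
have h01 : 0 <= (2^-1 : R) < 1 by lra.
have [N HN] := expr_small h01 (divr_gt0 e0 (ltr_wpDr w0 ltr01)).
exists N => n /HN; rewrite exprVn.
rewrite ler_pdivlMr ?ltr_wpDr // => H.
have : 0 < (2 ^- n : R) by rewrite invr_gt0 exprn_gt0.
move=> p; rewrite mulrC; apply: lt_le_trans H; rewrite ltr_pM2l //; lra.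
Qed.

(** Compactness of the rectangle as an induction principle. If P failed on the whole, it would fail
    on some quarter, on a quarter of that, and so on; the failing rectangles shrink to a point, near
    which the second hypothesis makes P true. *)
Lemma rectangle_bisection (P : R -> R -> R -> R -> Prop) a b c d :
  a <= b -> c <= d ->
  (forall x w y h, a <= x -> x + w <= b -> c <= y -> y + h <= d -> 0 <= w -> 0 <= h ->
     (forall i j : bool, P (x + i%:R * (w / 2)) (x + i%:R * (w / 2) + w / 2)
                    (y + j%:R * (h / 2)) (y + j%:R * (h / 2) + h / 2)) ->
     P x (x + w) y (y + h)) ->
  (forall x y, a <= x <= b -> c <= y <= d -> exists2 e, 0 < e &
     forall x' w y' h, a <= x' -> x' + w <= b -> c <= y' -> y' + h <= d ->
       0 <= w < e -> 0 <= h < e ->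
       x' <= x <= x' + w -> y' <= y <= y' + h -> P x' (x' + w) y' (y' + h)) ->
  P a b c d.
Proof.
move=> ab cd step loc; apply: contrapT => nP.
pose W := b - a; pose H := d - c.
have W0 : 0 <= W by rewrite subr_ge0.
have H0 : 0 <= H by rewrite subr_ge0.
have Wn n : 0 <= W / 2 ^+ n by rewrite divr_ge0 // exprn_ge0.
have Hn n : 0 <= H / 2 ^+ n by rewrite divr_ge0 // exprn_ge0.
(* A failing rectangle is recorded by its level n and its lower left corner; its sides are W / 2^n
   and H / 2^n by construction. *)
pose bad (q : nat * (R * R)) :=
  [/\ a <= q.2.1, q.2.1 + W / 2 ^+ q.1 <= b, c <= q.2.2, q.2.2 + H / 2 ^+ q.1 <= d &
    ~ P q.2.1 (q.2.1 + W / 2 ^+ q.1) q.2.2 (q.2.2 + H / 2 ^+ q.1)].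
have half (z : R) n : z / 2 ^+ n / 2 = z / 2 ^+ n.+1.
  by rewrite exprS invfM mulrA mulrAC.
have next (q : {q | bad q}) : {q' : {q | bad q} |
    [/\ (sval q').1 = (sval q).1.+1,
       (sval q).2.1 <= (sval q').2.1 /\
        (sval q').2.1 + W / 2 ^+ (sval q').1 <= (sval q).2.1 + W / 2 ^+ (sval q).1 &
       (sval q).2.2 <= (sval q').2.2 /\
        (sval q').2.2 + H / 2 ^+ (sval q').1 <= (sval q).2.2 + H / 2 ^+ (sval q).1]}.
  apply/cid; case: q => -[n [x y]] [/= q1 q2 q3 q4 q5].
  have [i [j nPij]] : exists i j : bool, ~ P (x + i%:R * (W / 2 ^+ n.+1))
      (x + i%:R * (W / 2 ^+ n.+1) + W / 2 ^+ n.+1)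
      (y + j%:R * (H / 2 ^+ n.+1)) (y + j%:R * (H / 2 ^+ n.+1) + H / 2 ^+ n.+1).
    apply: contrapT => nex; apply: q5; apply: step => // i j; rewrite !half.
    by apply: contrapT => ?; apply: nex; exists i, j.
  have bW : x <= x + i%:R * (W / 2 ^+ n.+1) /\
      x + i%:R * (W / 2 ^+ n.+1) + W / 2 ^+ n.+1 <= x + W / 2 ^+ n.
    by rewrite -half; have := Wn n; clear; case: i => /= ?; split; lra.
  have bH : y <= y + j%:R * (H / 2 ^+ n.+1) /\
      y + j%:R * (H / 2 ^+ n.+1) + H / 2 ^+ n.+1 <= y + H / 2 ^+ n.
    by rewrite -half; have := Hn n; clear; case: j => /= ?; split; lra.
  have bq : bad (n.+1, (x + i%:R * (W / 2 ^+ n.+1), y + j%:R * (H / 2 ^+ n.+1))).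
    case: bW bH => [w1 w2] [h1 h2]; split => //=; clear -q1 q2 q3 q4 w1 w2 h1 h2; lra.
  by exists (exist _ _ bq).
have b0 : bad (0%N, (a, c)).
  have eW : a + W = b by rewrite /W; ring.
  have eH : c + H = d by rewrite /H; ring.
  by rewrite /bad [_.1]/= [_.2]/= expr0 !divr1 eW eH; split; rewrite ?lexx.
have [f [f0 fS]] := dependent_choice next (exist _ _ b0).
have fn n : (sval (f n)).1 = n.
  by elim: n => [|n IHn]; [rewrite f0|case: (fS n) => -> _ _; rewrite IHn].
have [X HX] : exists l, forall n, (sval (f n)).2.1 <= l <= (sval (f n)).2.1 + W / 2 ^+ n.
  apply: nested_limit => // n; case: (fS n) => _; rewrite !fn.
  by move=> [].
have [Y HY] : exists l, forall n, (sval (f n)).2.2 <= l <= (sval (f n)).2.2 + H / 2 ^+ n.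
  apply: nested_limit => // n; case: (fS n) => _; rewrite !fn.
  by move=> _ [].
have Xab : a <= X <= b.
  by have := HX 0%N; rewrite f0 /= expr0 divr1 /W; lra.
have Ycd : c <= Y <= d.
  by have := HY 0%N; rewrite f0 /= expr0 divr1 /H; lra.
have [e e0 eP] := loc X Y Xab Ycd.
have [N1 HN1] := pow2_small W0 e0; have [N2 HN2] := pow2_small H0 e0.
pose n := maxn N1 N2.
have := svalP (f n); rewrite /bad fn => -[q1 q2 q3 q4]; apply; apply: eP => //.
- by rewrite Wn HN1 // leq_maxl.
- by rewrite Hn HN2 // leq_maxr.
Qed.

End Bisection.

Local Arguments normc : simpl never.

(** * Contour integrals over rectangles and Goursat's lemma *)

Section Goursat.
Context {R : realType}.
Implicit Types (a b c d x y h e : R) (f g : R[i] -> R[i]) (z u v w : R[i]).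

(** The contour integral along the boundary, counterclockwise; the factor i comes from dz = i dy on
    the vertical sides. *)
Definition rect_int a b c d g : R[i] :=
  Cint a b (fun x => g (x +i* c)) - Cint a b (fun x => g (x +i* d)) +
  'i * (Cint c d (fun y => g (b +i* y)) - Cint c d (fun y => g (a +i* y))).

Arguments rect_int : simpl never.

Definition hcont a b y g := forall x, a <= x <= b -> {for x +i* y, continuous g}.
Definition vcont c d x g := forall y, c <= y <= d -> {for x +i* y, continuous g}.

(** Continuity is required on the four sides only, since the Cauchy kernel is singular inside. *)
Definition bcont a b c d g :=
  [/\ hcont a b c g, hcont a b d g, vcont c d a g & vcont c d b g].

Lemma hcont_contin a b y g : hcont a b y g -> contin a b (fun x => g (x +i* y)).
Proof.
move=> hc x xab.
apply: (@continuous_comp _ _ _ (fun x => x +i* y) g); last exact: hc.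
by apply: (@cvg_complex R _ (nbhs x) _ id (fun=> y) x y) => //; exact: cvg_cst.
Qed.

Lemma vcont_contin c d x g : vcont c d x g -> contin c d (fun y => g (x +i* y)).
Proof.
move=> hc y yab.
apply: (@continuous_comp _ _ _ (fun y => x +i* y) g); last exact: hc.
by apply: (@cvg_complex R _ (nbhs y) _ (fun=> x) id x y) => //; exact: cvg_cst.
Qed.

Lemma rect_int_hsplit a m b c d g : a <= m <= b ->
  hcont a b c g -> hcont a b d g ->
  rect_int a b c d g = rect_int a m c d g + rect_int m b c d g.
Proof.
move=> amb h1 h2; rewrite /rect_int.
rewrite (Cint_split amb (hcont_contin h1)) (Cint_split amb (hcont_contin h2)).
ring.
Qed.

Lemma rect_int_vsplit a b c m d g : c <= m <= d ->
  vcont c d a g -> vcont c d b g ->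
  rect_int a b c d g = rect_int a b c m g + rect_int a b m d g.
Proof.
move=> amb h1 h2; rewrite /rect_int.
rewrite (Cint_split amb (vcont_contin h1)) (Cint_split amb (vcont_contin h2)).
ring.
Qed.

Lemma bcontD a b c d f g : bcont a b c d f -> bcont a b c d g ->
  bcont a b c d (fun z => f z + g z).
Proof.
move=> [f1 f2 f3 f4] [g1 g2 g3 g4]; split => x xab.
- exact (contcD (f1 x xab) (g1 x xab)).
- exact (contcD (f2 x xab) (g2 x xab)).
- exact (contcD (f3 x xab) (g3 x xab)).
- exact (contcD (f4 x xab) (g4 x xab)).
Qed.

Lemma bcontM a b c d f g : bcont a b c d f -> bcont a b c d g ->
  bcont a b c d (fun z => f z * g z).
Proof.
move=> [f1 f2 f3 f4] [g1 g2 g3 g4]; split => x xab.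
- exact (contcM (f1 x xab) (g1 x xab)).
- exact (contcM (f2 x xab) (g2 x xab)).
- exact (contcM (f3 x xab) (g3 x xab)).
- exact (contcM (f4 x xab) (g4 x xab)).
Qed.

Lemma bcont_cst a b c d z : bcont a b c d (fun=> z).
Proof. by split => x xab; exact (contc_cst z _). Qed.

Lemma rect_intD a b c d f g : bcont a b c d f -> bcont a b c d g ->
  rect_int a b c d (fun z => f z + g z) = rect_int a b c d f + rect_int a b c d g.
Proof.
move=> [f1 f2 f3 f4] [g1 g2 g3 g4]; rewrite /rect_int.
rewrite (CintD (hcont_contin f1) (hcont_contin g1)).
rewrite (CintD (hcont_contin f2) (hcont_contin g2)).
rewrite (CintD (vcont_contin f3) (vcont_contin g3)).
rewrite (CintD (vcont_contin f4) (vcont_contin g4)).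
ring.
Qed.

Lemma rect_intZ a b c d z f : bcont a b c d f ->
  rect_int a b c d (fun w => z * f w) = z * rect_int a b c d f.
Proof.
move=> [f1 f2 f3 f4]; rewrite /rect_int.
rewrite (CintZ z (hcont_contin f1)) (CintZ z (hcont_contin f2)).
rewrite (CintZ z (vcont_contin f3)) (CintZ z (vcont_contin f4)).
ring.
Qed.

(** On opposite sides the integrands differ by a constant: bottom minus top gives - i w (b - a) (d -
    c), right minus left gives w (b - a) (d - c), and the factor i makes them cancel. *)
Lemma rect_int_affine a b c d z w : a <= b -> c <= d ->
  rect_int a b c d (fun v => z + w * v) = 0.
Proof.
move=> ab cd.
have i0 y : contin a b (fun x => (fun v => z + w * v) (x +i* y)).
  apply: (@hcont_contin a b y (fun v => z + w * v)) => x _.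
  exact (contcD (contc_cst z _) (contcM (contc_cst w _) (contc_id _))).
have i1 x : contin c d (fun y => (fun v => z + w * v) (x +i* y)).
  apply: (@vcont_contin c d x (fun v => z + w * v)) => y _.
  exact (contcD (contc_cst z _) (contcM (contc_cst w _) (contc_id _))).
have e1 : Cint a b (fun x => z + w * (x +i* c)) =
   Cint a b (fun x => z + w * (x +i* d)) + (b - a)%:C * (w * (0 +i* (c - d))).
  rewrite -Cint_cst // -CintD //; last exact: contin_cst.
  apply: eq_Cint => x _; rewrite -addrA -mulrDr; congr (_ + _ * _).
  by apply/eqP; rewrite eq_complex /= addr0 eqxx addrC subrK eqxx.
have e2 : Cint c d (fun x => z + w * (b +i* x)) =
   Cint c d (fun x => z + w * (a +i* x)) + (d - c)%:C * (w * ((b - a) +i* 0)).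
  rewrite -Cint_cst // -CintD //; last exact: contin_cst.
  apply: eq_Cint => x _; rewrite -addrA -mulrDr; congr (_ + _ * _).
  by apply/eqP; rewrite eq_complex /= addr0 eqxx addrC subrK eqxx.
rewrite /rect_int e1 e2.
have -> : 0 +i* (c - d) = - 'i * (d - c)%:C :> R[i].
  by apply/eqP; rewrite eq_complex /=; apply/andP; split; apply/eqP; ring.
rewrite -[(b - a) +i* 0]/((b - a)%:C); ring.
Qed.

Lemma normc_rect_int a b c d g (B : R) : a <= b -> c <= d -> bcont a b c d g ->
  (forall x, a <= x <= b -> normc (g (x +i* c)) <= B /\ normc (g (x +i* d)) <= B) ->
  (forall y, c <= y <= d -> normc (g (a +i* y)) <= B /\ normc (g (b +i* y)) <= B) ->
  normc (rect_int a b c d g) <= 4 * B * ((b - a) + (d - c)).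
Proof.
move=> ab cd [g1 g2 g3 g4] hB vB.
have b1 := normc_Cint ab (hcont_contin g1) (fun t tab => (hB t tab).1).
have b2 := normc_Cint ab (hcont_contin g2) (fun t tab => (hB t tab).2).
have b3 := normc_Cint cd (vcont_contin g3) (fun t tab => (vB t tab).1).
have b4 := normc_Cint cd (vcont_contin g4) (fun t tab => (vB t tab).2).
have ni : normc ('i : R[i]) = 1 by rewrite /normc /= expr0n expr1n add0r sqrtr1.
rewrite (le_trans (normcD _ _)) // normcM ni mul1r.
have := normcB (Cint a b (fun x => g (x +i* c))) (Cint a b (fun x => g (x +i* d))).
have := normcB (Cint c d (fun x => g (b +i* x))) (Cint c d (fun x => g (a +i* x))).
rewrite /= in b1 b2 b3 b4 *; lra.
Qed.

(** Bisection applied to the bound e (W + H)^2 for sides W and H. A quarter has a quarter of this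
    bound, so it passes from quarters to the whole. Near a point, g is affine up to an error that is
    small relative to the distance, and the affine part integrates to 0. *)
Lemma goursat a b c d g : a <= b -> c <= d ->
  (forall x y, a <= x <= b -> c <= y <= d -> cdiff g (x +i* y)) ->
  rect_int a b c d g = 0.
Proof.
move=> ab cd dg.
have gc x y : a <= x <= b -> c <= y <= d -> {for x +i* y, continuous g}.
  by move=> xab ycd; apply: cdiff_cont; exact: dg.
have key e : 0 < e -> normc (rect_int a b c d g) <= e * ((b - a) + (d - c)) ^+ 2.
  move=> e0.
  apply: (@rectangle_bisection R (fun a b c d =>
     normc (rect_int a b c d g) <= e * ((b - a) + (d - c)) ^+ 2)) => //.
    move=> x W y H ax xb cy yd W0 H0 quarter.
    have hc t p q : c <= t <= d -> a <= p -> q <= b -> hcont p q t g.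
      by move=> tcd ap qb s spq; apply: gc => //; lra.
    have vc t p q : a <= t <= b -> c <= p -> q <= d -> vcont p q t g.
      by move=> tab cp qd s spq; apply: gc => //; lra.
    rewrite (@rect_int_hsplit x (x + W / 2)); [|clear -W0; lra|apply: hc; clear -ax xb cy yd W0 H0; lra|apply: hc; clear -ax xb cy yd W0 H0; lra].
    rewrite (@rect_int_vsplit _ _ y (y + H / 2)); [|clear -H0; lra|apply: vc; clear -ax xb cy yd W0 H0; lra|apply: vc; clear -ax xb cy yd W0 H0; lra].
    rewrite (@rect_int_vsplit (x + W / 2) _ y (y + H / 2)); [|clear -H0; lra|apply: vc; clear -ax xb cy yd W0 H0; lra|apply: vc; clear -ax xb cy yd W0 H0; lra].
    have := quarter false false; have := quarter false true.
    have := quarter true false; have := quarter true true.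
    rewrite /= !mul0r !mul1r !addr0.
    have -> : x + W / 2 + W / 2 = x + W by lra.
    have -> : y + H / 2 + H / 2 = y + H by lra.
    set r1 := rect_int _ _ _ _ _; set r2 := rect_int _ _ _ _ _.
    set r3 := rect_int _ _ _ _ _; set r4 := rect_int _ _ _ _ _ => q1 q2 q3 q4.
    have := normcD (r4 + r3) (r2 + r1); have := normcD r4 r3; have := normcD r2 r1.
    pose Q := e * (W + H) ^+ 2 / 4.
    have eqQ (r s : R) : r <= s -> s = Q -> r <= Q by move=> + <-.
    have {}q1 : normc r1 <= Q by apply: (eqQ _ _ q1); rewrite /Q; field.
    have {}q2 : normc r2 <= Q by apply: (eqQ _ _ q2); rewrite /Q; field.
    have {}q3 : normc r3 <= Q by apply: (eqQ _ _ q3); rewrite /Q; field.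
    have {}q4 : normc r4 <= Q by apply: (eqQ _ _ q4); rewrite /Q; field.
    have -> : e * (x + W - x + (y + H - y)) ^+ 2 = e * (W + H) ^+ 2 by ring.
    have -> : e * (W + H) ^+ 2 = 4 * Q by rewrite /Q; field.
    move: q1 q2 q3 q4; generalize (normc r1) (normc r2) (normc r3) (normc r4).
    generalize (normc (r4 + r3)) (normc (r2 + r1)) Q (normc (r4 + r3 + (r2 + r1))).
    by clear; move=> *; lra.
  move=> x y xab ycd.
  have [phi phic gE] := dg x y xab ycd.
  (* The 4 cancels the constant of [normc_rect_int]. Below, sides shorter than D / 2 keep |v - z| <=
     W + H < D. *)
  have e8 : 0 < e / 4 by rewrite divr_gt0.
  move/continuous_normc : phic => /(_ _ e8) [D D0 DP].
  have D2 : 0 < D / 2 by rewrite divr_gt0.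
  exists (D / 2) => // x' W y' H ax xb cy yd /andP[W0 WD] /andP[H0 HD] xx yy.
  set z := x +i* y in phi gE DP *.
  have gE' v : g v = (phi v - phi z) * (v - z) + (g z - phi z * z + phi z * v).
    by rewrite -[g v](subrK (g z)) gE; ring.
  have rest : bcont x' (x' + W) y' (y' + H) (fun v => g z - phi z * z + phi z * v).
    split => t tt; exact (contcD (contc_cst _ _) (contcM (contc_cst (phi z) _) (contc_id _))).
  have lo (p q : R) : 0 <= q -> p <= p <= p + q by move=> q0; rewrite lexx lerDl.
  have hi (p q : R) : 0 <= q -> p <= p + q <= p + q by move=> q0; rewrite lexx lerDl q0.
  have gb : bcont x' (x' + W) y' (y' + H) g.
    have sx t : x' <= t <= x' + W -> a <= t <= b by clear -ax xb; lra.
    have sy t : y' <= t <= y' + H -> c <= t <= d by clear -cy yd; lra.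
    have [xl xr] := (sx _ (lo x' W W0), sx _ (hi x' W W0)).
    have [yl yr] := (sy _ (lo y' H H0), sy _ (hi y' H H0)).
    by split => t tt; apply: gc => //; [exact: sx|exact: sx|exact: sy|exact: sy].
  have pb : bcont x' (x' + W) y' (y' + H) (fun v => (phi v - phi z) * (v - z)).
    have := bcontD gb (bcontM (bcont_cst _ _ _ _ (-1)) rest).
    rewrite (_ : (fun _ => _) = (fun v => (phi v - phi z) * (v - z))) //.
    by apply/funext => v; rewrite [in LHS]gE'; ring.
  have -> : rect_int x' (x' + W) y' (y' + H) g =
      rect_int x' (x' + W) y' (y' + H) (fun v => (phi v - phi z) * (v - z)).
    rewrite [in LHS](_ : g = (fun v => (phi v - phi z) * (v - z) + (g z - phi z * z + phi z * v))).
      by rewrite rect_intD // rect_int_affine ?addr0 ?lerDl.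
    by apply/funext.
  have bd s t : x' <= s <= x' + W -> y' <= t <= y' + H ->
      normc ((phi (s +i* t) - phi z) * (s +i* t - z)) <= e / 4 * (W + H).
    move=> sW tH.
    have n : normc (s +i* t - z) <= W + H.
      rewrite (le_trans (normc_le_ReIm _)) // lerD //= ler_norml; clear -sW tH xx yy; lra.
    rewrite normcM ler_pM ?normc_ge0 // ltW // DP //.
    by rewrite (le_lt_trans n) //; clear -WD HD; lra.
  have := normc_rect_int _ _ pb _ _; move=> /(_ (e / 4 * (W + H))) Hb.
  apply: (le_trans (Hb _ _ _ _)); [by rewrite lerDl|by rewrite lerDl| | |].
  - by move=> s sW; split; apply: bd => //; [exact: lo|exact: hi].
  - by move=> s sW; split; apply: bd => //; [exact: lo|exact: hi].
  by rewrite le_eqVlt; apply/orP; left; apply/eqP; field.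
apply/eqP; rewrite -normc_eq0 eq_le normc_ge0 andbT.
apply/ler_addgt0Pl => e e0; rewrite addr0.
set L := (b - a) + (d - c) in key.
have L0 : 0 <= L by rewrite /L; lra.
(* The + 1 covers the degenerate rectangle, where L = 0. *)
apply: (le_trans (key (e / (L ^+ 2 + 1)) _)).
  by rewrite divr_gt0 // ltr_wpDl // sqr_ge0.
rewrite mulrAC ler_pdivrMr ?ltr_wpDl ?sqr_ge0 // ler_pM2l // lerDl //.
Qed.

End Goursat.

(** * Polynomial approximation of Cauchy integrals along one edge *)

Section EdgeApproximation.
Context {R : realType}.
Implicit Types (a b c d x y h e t : R) (f g : R[i] -> R[i]) (z u v w : R[i]) (X : set R[i]).

Lemma contin_bounded a b (phi : R -> R[i]) : a <= b -> contin a b phi ->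
  exists2 B, 0 <= B & forall t, a <= t <= b -> normc (phi t) <= B.
Proof.
move=> ab pc.
have wc : {within `[a, b], continuous (fun t => normc (phi t))}.
  apply: continuous_in_subspaceT => t; rewrite inE /= in_itv /= => tab.
  by apply: (@continuous_comp _ _ _ phi (@normc R)); [exact: pc|exact: continuous_nc].
have [t _ tP] := EVT_max ab wc.
by exists (normc (phi t)) => [|s sab]; [exact: normc_ge0|apply: tP; rewrite in_itv].
Qed.

(** Seen from the centre z, every u in X is closer than every point e(t) of the edge by the factor r
    < 1. Hence 1 / (e(t) - u) is a uniformly convergent geometric series in (u - z) / (e(t) - z),
    and its integrated partial sums are polynomials in u. *)
Lemma edge_approx (t0 t1 : R) (e phi : R -> R[i]) X z (r m : R) : t0 <= t1 ->
  contin t0 t1 e -> contin t0 t1 phi -> 0 <= r < 1 -> 0 < m ->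
  (forall t u, t0 <= t <= t1 -> X u ->
     normc (u - z) <= r * normc (e t - z) /\ m <= normc (e t - z)) ->
  poly_approx X (fun u => Cint t0 t1 (fun t => phi t * (e t - u)^-1)).
Proof.
move=> t01 ec pc r01 m0 far eps eps0.
have /andP[r0 r1] := r01.
have r1' : 0 < 1 - r by rewrite subr_gt0.
have [X0|/set0P [u0 Xu0]] := eqVneq X set0.
  by exists 0 => u; rewrite X0.
have [B B0 pB] := contin_bounded t01 pc.
have ez t : t0 <= t <= t1 -> e t - z != 0.
  by move=> /far /(_ Xu0) [_ mt]; rewrite -normc_gt0 (lt_le_trans m0).
have cst s : contin t0 t1 (fun=> s) := @contin_cst R t0 t1 s.
have ezc : contin t0 t1 (fun t => e t - z) := continD ec (cst (- z)).
have ezV := continV ez ezc.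
have ezVk k : contin t0 t1 (fun t => (e t - z)^-1 ^+ k).
  elim: k => [|k IHk]; first exact (cst 1).
  rewrite (_ : (fun _ => _) = (fun t => (e t - z)^-1 * (e t - z)^-1 ^+ k)).
    exact (continM ezV IHk).
  by apply/funext => t; rewrite exprS.
pose cf k := Cint t0 t1 (fun t => phi t * (e t - z)^-1 ^+ k.+1).
pose S K u t := \sum_(k < K) (u - z) ^+ k * (phi t * (e t - z)^-1 ^+ k.+1).
have termc K : contin t0 t1 (fun t => phi t * (e t - z)^-1 ^+ K.+1).
  exact (continM pc (ezVk K.+1)).
have Sc K u : contin t0 t1 (S K u).
  elim: K => [|K IHK]; first by rewrite /S; under eq_fun do rewrite big_ord0; exact (cst 0).
  rewrite (_ : S K.+1 u = (fun t => S K u t + (u - z) ^+ K * (phi t * (e t - z)^-1 ^+ K.+1))).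
    exact (continD IHK (continM (cst _) (termc K))).
  by apply/funext => t; rewrite /S big_ord_recr.
have SE K u : Cint t0 t1 (S K u) = (\sum_(k < K) cf k *: ('X - z%:P) ^+ k).[u].
  elim: K => [|K IHK].
    rewrite big_ord0 horner0 (@eq_Cint _ _ _ _ (fun=> 0)) ?Cint_cst ?mulr0 //.
    by move=> t _; rewrite /S big_ord0.
  rewrite big_ord_recr hornerD -IHK hornerZ horner_exp hornerXsubC.
  rewrite (@eq_Cint _ _ _ _ (fun t => S K u t + (u - z) ^+ K * (phi t * (e t - z)^-1 ^+ K.+1))).
    rewrite (CintD (Sc K u) (continM (cst _) (termc K))).
    by rewrite (CintZ _ (termc K)) [_ * cf K]mulrC.
  by move=> t _; rewrite /S big_ord_recr.
(* The remainder after K terms is at most (A - 1) r^K: B bounds phi, (1 - r) m bounds |e(t) - u|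
   from below, and 2 comes from [normc_Cint]. The + 1 makes A positive even if t0 = t1. *)
pose A := 2 * (B / ((1 - r) * m)) * (t1 - t0) + 1.
have A0 : 0 < A.
  by rewrite ltr_wpDl // !mulr_ge0 ?invr_ge0 ?mulr_ge0 ?subr_ge0 // ltW.
have [K /(_ K (leqnn K)) rK] := expr_small r01 (divr_gt0 eps0 A0).
exists (\sum_(k < K) cf k *: ('X - z%:P) ^+ k) => u Xu; rewrite -SE.
have eu t : t0 <= t <= t1 -> (1 - r) * m <= normc (e t - u).
  move=> /far /(_ Xu) [f1 f2].
  have := normcD (e t - u) (u - z); rewrite addrA subrK => H.
  have : (1 - r) * m <= (1 - r) * normc (e t - z) by rewrite ler_wpM2l // ltW.
  lra.
have eu0 t : t0 <= t <= t1 -> e t - u != 0.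
  by move=> /eu H; rewrite -normc_gt0 (lt_le_trans _ H) // mulr_gt0.
have euc : contin t0 t1 (fun t => phi t * (e t - u)^-1).
  exact (continM pc (continV eu0 (continD ec (cst (- u))))).
have -> : Cint t0 t1 (fun t => phi t * (e t - u)^-1) - Cint t0 t1 (S K u) =
   Cint t0 t1 (fun t => phi t * (e t - u)^-1 + -1 * S K u t).
  rewrite (CintD euc (continM (cst (-1)) (Sc K u))).
  by rewrite (CintZ (-1) (Sc K u)) mulN1r.
have diffE t : t0 <= t <= t1 -> phi t * (e t - u)^-1 + -1 * S K u t =
    phi t * (((u - z) / (e t - z)) ^+ K / (e t - u)).
  move=> tt; have n1 := ez t tt; have n2 := eu0 t tt.
  set x := (u - z) / (e t - z).
  have -> : S K u t = phi t * (e t - z)^-1 * \sum_(k < K) x ^+ k.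
    rewrite /S big_distrr /=; apply: eq_bigr => k _.
    by rewrite /x exprMn exprS; ring.
  have x1 : x - 1 != 0.
    rewrite /x (_ : _ - 1 = - (e t - u) / (e t - z)); last by field.
    by rewrite mulf_neq0 ?oppr_eq0 ?invr_eq0.
  have -> : \sum_(k < K) x ^+ k = (x ^+ K - 1) / (x - 1).
    by apply: (mulfI x1); rewrite -subrX1 mulrC divfK.
  have -> : x - 1 = - (e t - u) / (e t - z) by rewrite /x; field.
  by field; rewrite n1 n2.
have dc : contin t0 t1 (fun t => phi t * (e t - u)^-1 + -1 * S K u t).
  exact (continD euc (continM (cst (-1)) (Sc K u))).
apply: (le_trans (normc_Cint t01 dc (B := B * (r ^+ K / ((1 - r) * m))) _)).
  move=> t tt; rewrite diffE // normcM ler_pM ?normc_ge0 ?pB //.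
  rewrite normcM normcX normcM !normcV ler_pM ?normc_ge0 ?exprn_ge0 ?invr_ge0 ?mulr_ge0 ?invr_ge0 ?normc_ge0 //.
    rewrite lerXn2r ?nnegrE ?mulr_ge0 ?invr_ge0 ?normc_ge0 //.
    by rewrite ler_pdivrMr ?normc_gt0 ?ez //; case: (far t u tt Xu).
  rewrite lef_pV2 ?posrE ?eu ?mulr_gt0 //.
  by rewrite normc_gt0 eu0.
have -> : 2 * (B * (r ^+ K / ((1 - r) * m))) * (t1 - t0) = (A - 1) * r ^+ K.
  by rewrite /A; field; rewrite !gt_eqF.
apply: (@le_trans _ _ (A * r ^+ K)).
  by rewrite ler_wpM2r ?exprn_ge0 // lerBlDr lerDl.
by rewrite mulrC -ler_pdivlMr.
Qed.

(* Points of the half-plane [Re (w u) <= beta - d] are closer to a far away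
   centre than the points of [beta <= Re (w v)]. *)
Lemma far_center w (B beta d : R) : normc w = 1 -> 0 < d -> beta <= B ->
  exists z r m, [/\ 0 <= r < 1, 0 < m & forall u v, normc u <= B ->
     complex.Re (w * u) <= beta - d -> beta <= complex.Re (w * v) ->
     normc (u - z) <= r * normc (v - z) /\ m <= normc (v - z)].
Proof.
move=> w1 d0 bB.
have w0 : w != 0 by rewrite -normc_eq0 w1 oner_neq0.
(* The centre is z = - T / w, so that |v - z| = |w v + T|. This T puts the half-plane of v at
   distance at least q + d. For u it gives |u - z|^2 <= q^2 + B^2 = q^2 + q d <= (q + d / 2)^2,
   which is the reason for q d = B^2. *)
pose q := B ^+ 2 / d; pose T := q + d - beta.
have q0 : 0 <= q by rewrite divr_ge0 ?sqr_ge0 // ltW.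
have qd : q * d = B ^+ 2 by rewrite /q divfK // gt_eqF.
have qd0 : 0 < q + d by rewrite ltr_wpDl.
exists (- T%:C / w), ((q + d / 2) / (q + d)), (q + d); split => //.
  rewrite divr_ge0 ?ltW ?ltr_pdivrMr //; lra.
move=> u v uB uw vw.
have nE (s : R[i]) : normc (s - - T%:C / w) = normc (w * s + T%:C).
  rewrite -[LHS]mul1r -w1 -normcM; congr normc; by field.
rewrite !nE.
have vT : q + d <= normc (w * v + T%:C).
  apply: (le_trans _ (normc_ge_Re _)); apply: (le_trans _ (ler_norm _)).
  have -> : complex.Re (w * v + T%:C) = complex.Re (w * v) + T by case: (w * v).
  rewrite /T; lra.
split => //.
apply: (@le_trans _ _ (q + d / 2)); last first.
  rewrite mulrAC ler_pdivlMr // ler_pM2l //; lra.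
have nu : normc (w * u) <= B by rewrite normcM w1 mul1r.
have := normc_ge_Im (w * u); have := normc_ge_Re (w * u).
have := normc_sqr (w * u + T%:C).
move: nu uw; case: (w * u) => p s /= nu uw e1 e2 e3.
have B0 : 0 <= B by rewrite (le_trans _ nu) ?normc_ge0.
have qB : 2 * B <= q + d.
  have : 0 <= (B - d) ^+ 2 by exact: sqr_ge0.
  have -> : (B - d) ^+ 2 = d * (q + d - 2 * B) by rewrite mulrBr mulrDr [d * q]mulrC qd; ring.
  rewrite pmulr_rge0 //; lra.
have s2 : s ^+ 2 <= q * d.
  by rewrite qd -(real_normK (num_real s)) lerXn2r ?nnegrE // (le_trans e3).
have p2 : (p + T) ^+ 2 <= q ^+ 2.
  have pB : - B <= p by have := le_trans e2 nu; rewrite ler_norml => /andP[].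
  rewrite lerXn2r ?nnegrE //; rewrite /T; lra.
rewrite -(@ler_pXn2r _ 2) ?nnegrE ?normc_ge0 ?addr_ge0 //; last by rewrite divr_ge0 // ltW.
rewrite e1 addr0.
apply: (le_trans (lerD p2 s2)).
have -> : (q + d / 2) ^+ 2 = q ^+ 2 + q * d + (d / 2) ^+ 2 by field.
by rewrite lerDl sqr_ge0.
Qed.

End EdgeApproximation.

(** * Cauchy's formula, up to the value of the kernel integral *)

Section Runge.
Context {R : realType}.
Implicit Types (a b c d x y h e t : R) (f g : R[i] -> R[i]) (z u v w : R[i]) (X : set R[i]).

(** Cutting off the left, right, lower and upper strips leaves the square of half side h around the
    exceptional point; Goursat's lemma makes each strip contribute 0. *)
Lemma rect_int_shrink a b c d x y h g :
  0 < h -> a <= x - h -> x + h <= b -> c <= y - h -> y + h <= d ->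
  (forall s t, a <= s <= b -> c <= t <= d -> (s != x) || (t != y) -> cdiff g (s +i* t)) ->
  rect_int a b c d g = rect_int (x - h) (x + h) (y - h) (y + h) g.
Proof.
move=> h0 ax xb cy yd dg.
have hc p q t : a <= p -> q <= b -> c <= t <= d -> t != y -> hcont p q t g.
  by move=> ap qb tt ty s sq; apply: cdiff_cont; apply: dg => //; [lra|rewrite ty orbT].
have vc p q t : c <= p -> q <= d -> a <= t <= b -> t != x -> vcont p q t g.
  by move=> ap qb tt ty s sq; apply: cdiff_cont; apply: dg => //; [lra|rewrite ty].
have zero p q r s : a <= p -> p <= q -> q <= b -> c <= r -> r <= s -> s <= d ->
    (q < x \/ x < p) \/ (s < y \/ y < r) -> rect_int p q r s g = 0.
  move=> ap pq qb cr rs sd far; apply: goursat => // s' t' ss tt; apply: dg; [lra|lra|].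
  apply/orP; case: far => far; [left|right]; apply/eqP; lra.
have nx1 : x - h != x by apply/eqP; lra.
have nx2 : x + h != x by apply/eqP; lra.
have ny1 : c != y by apply/eqP; lra.
have ny2 : d != y by apply/eqP; lra.
have ny3 : y - h != y by apply/eqP; lra.
have ny4 : y + h != y by apply/eqP; lra.
rewrite (@rect_int_hsplit _ a (x - h)); [|clear -h0 ax xb; lra|apply: hc => //; clear -h0 ax xb cy yd; lra|apply: hc => //; clear -h0 ax xb cy yd; lra].
rewrite zero ?add0r; [|(clear -h0 ax xb cy yd; lra)..].
rewrite (@rect_int_hsplit _ _ (x + h)); [|clear -h0 ax xb; lra|apply: hc => //; clear -h0 ax xb cy yd; lra|apply: hc => //; clear -h0 ax xb cy yd; lra].
rewrite [X in _ + X]zero ?addr0; [|(clear -h0 ax xb cy yd; lra)..].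
rewrite (@rect_int_vsplit _ _ _ c (y - h)); [|clear -h0 cy yd; lra|apply: vc => //; clear -h0 ax xb cy yd; lra|apply: vc => //; clear -h0 ax xb cy yd; lra].
rewrite zero ?add0r; [|(clear -h0 ax xb cy yd; lra)..].
rewrite (@rect_int_vsplit _ _ _ _ (y + h)); [|clear -h0 cy yd; lra|apply: vc => //; clear -h0 ax xb cy yd; lra|apply: vc => //; clear -h0 ax xb cy yd; lra].
by rewrite [X in _ + X]zero ?addr0; [|(clear -h0 ax xb cy yd; lra)..].
Qed.

Lemma sub_complex_eq0 (s t x y : R) : ((s +i* t) - (x +i* y) == 0) = (s == x) && (t == y).
Proof. by rewrite subr_eq0 eq_complex. Qed.

Lemma cauchy_kernel_cdiff z u : z != u -> cdiff (fun v => (v - u)^-1) z.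
Proof.
move=> zu; apply: (@cdiffV _ (fun v => v - u)); first by rewrite subr_eq0.
exact (cdiffD (cdiff_id z) (cdiff_cst (- u) z)).
Qed.

(** The quotient (f v - f u) / (v - u) is bounded near u, so its integral over a square shrinking to
    u tends to 0; by [rect_int_shrink] that integral does not depend on the square. *)
Lemma rect_int_cauchy a b c d x y f : a < x < b -> c < y < d ->
  (forall s t, a <= s <= b -> c <= t <= d -> cdiff f (s +i* t)) ->
  rect_int a b c d (fun v => f v * (v - (x +i* y))^-1) =
  f (x +i* y) * rect_int a b c d (fun v => (v - (x +i* y))^-1).
Proof.
move=> axb cyd df; set u := x +i* y.
have ku s t : (s != x) || (t != y) -> cdiff (fun v => (v - u)^-1) (s +i* t).
  move=> ne; apply: cauchy_kernel_cdiff; rewrite -subr_eq0 sub_complex_eq0.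
  by rewrite negb_and.
pose g v := (f v - f u) * (v - u)^-1.
have dg s t : a <= s <= b -> c <= t <= d -> (s != x) || (t != y) -> cdiff g (s +i* t).
  move=> sab tcd ne.
  exact (cdiffM (cdiffD (df s t sab tcd) (cdiff_cst (- f u) _)) (ku s t ne)).
have bc g' : (forall s t, a <= s <= b -> c <= t <= d -> (s != x) || (t != y) ->
    cdiff g' (s +i* t)) -> bcont a b c d g'.
  move=> dg'; split => s sab; apply: cdiff_cont; apply: dg' => //; try lra;
    apply/orP; ((left; apply/eqP; lra) || (right; apply/eqP; lra)).
have bk : bcont a b c d (fun v => (v - u)^-1) by apply: bc => s t _ _; exact: ku.
have g0 : rect_int a b c d g = 0.
  have ab : a <= x <= b by lra.
  have cd : c <= y <= d by lra.
  have [phi phic fE] := df x y ab cd.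
  move/continuous_normc : (phic) => /(_ 1 ltr01) [D D0 DP].
  pose B := normc (phi u) + 1.
  have B0 : 0 < B by rewrite ltr_wpDl ?normc_ge0.
  have gB v : 0 < normc (v - u) < D -> normc (g v) <= B.
    move=> /andP[v0 vD]; have vu : v - u != 0 by rewrite -normc_gt0.
    rewrite /g fE mulfK //.
    rewrite (_ : phi v = (phi v - phi u) + phi u); last by rewrite subrK.
    by rewrite (le_trans (normcD _ _)) // addrC lerD2l ltW // DP.
  apply/eqP; rewrite -normc_eq0 eq_le normc_ge0 andbT.
  apply/ler_addgt0Pl => e e0; rewrite addr0.
  (* D / 4 puts the square inside the disc where g is bounded by B, e / (16 B) makes the resulting
     bound 16 B h at most e, and the other terms keep the square inside the rectangle. *)
  pose h := Num.min (Num.min (D / 4) (e / (16 * B)))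
     (Num.min (Num.min (x - a) (b - x)) (Num.min (y - c) (d - y))).
  have h0 : 0 < h.
    rewrite !lt_min !subr_gt0 !divr_gt0 ?mulr_gt0 //=.
    by case/andP: axb => -> ->; case/andP: cyd => -> ->.
  have [hD he [h1 h2] [h3 h4]] : [/\ h <= D / 4, h <= e / (16 * B),
      h <= x - a /\ h <= b - x & h <= y - c /\ h <= d - y].
    have : h <= h by [].
    rewrite {2}/h !le_min => /andP[/andP[-> ->] /andP[/andP[-> ->] /andP[-> ->]]].
    by [].
  clearbody h.
  have e1 : a <= x - h by clear -h0 h1 h2 h3 h4; lra.
  have e2 : x + h <= b by clear -h0 h1 h2 h3 h4; lra.
  have e3 : c <= y - h by clear -h0 h1 h2 h3 h4; lra.
  have e4 : y + h <= d by clear -h0 h1 h2 h3 h4; lra.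
  rewrite (rect_int_shrink h0 e1 e2 e3 e4 dg).
  have xx : x - h <= x + h by clear -h0 h1 h2 h3 h4; lra.
  have yy : y - h <= y + h by clear -h0 h1 h2 h3 h4; lra.
  have nx1 : x - h != x by apply/eqP; clear -h0; lra.
  have nx2 : x + h != x by apply/eqP; clear -h0; lra.
  have ny3 : y - h != y by apply/eqP; clear -h0; lra.
  have ny4 : y + h != y by apply/eqP; clear -h0; lra.
  have yl : y - h <= y - h <= y + h by rewrite lexx.
  have yr : y - h <= y + h <= y + h by rewrite lexx andbT.
  have xl : x - h <= x - h <= x + h by rewrite lexx.
  have xr : x - h <= x + h <= x + h by rewrite lexx andbT.
  have sx t : x - h <= t <= x + h -> a <= t <= b by clear -e1 e2; lra.
  have sy t : y - h <= t <= y + h -> c <= t <= d by clear -e3 e4; lra.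
  have bb : bcont (x - h) (x + h) (y - h) (y + h) g.
    by split => s ss; apply: cdiff_cont; apply: dg;
      rewrite ?nx1 ?nx2 ?ny3 ?ny4 ?orbT ?sx ?sy.
  have sq s t : x - h <= s <= x + h -> y - h <= t <= y + h -> (s != x) || (t != y) ->
      normc (g (s +i* t)) <= B.
    move=> ss tt ne; apply: gB; apply/andP; split.
      by rewrite normc_gt0 sub_complex_eq0 negb_and.
    apply: (le_lt_trans (normc_le_ReIm _)) => /=.
    have : `|s - x| <= h by rewrite ler_norml; clear -ss; lra.
    have : `|t - y| <= h by rewrite ler_norml; clear -tt; lra.
    by clear -hD D0; lra.
  have := normc_rect_int xx yy bb (B := B).
  move=> /(_ _ _)/le_trans; apply.
  - by move=> s ss; split; apply: sq => //; rewrite ?ny3 ?ny4 orbT.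
  - by move=> s ss; split; apply: sq => //; rewrite ?nx1 ?nx2.
  have -> : 4 * B * (x + h - (x - h) + (y + h - (y - h))) = h * (16 * B) by ring.
  by rewrite -ler_pdivlMr // mulr_gt0.
have -> : (fun v => f v * (v - u)^-1) = (fun v => g v + f u * (v - u)^-1).
  by apply/funext => v; rewrite /g -mulrDl subrK.
rewrite (rect_intD (bc _ dg) (bcontM (bcont_cst _ _ _ _ (f u)) bk)) g0 add0r.
by rewrite (rect_intZ _ bk).
Qed.

End Runge.

(** * Runge's theorem for a rectangle inside a larger one *)

Section RungeRectangle.
Context {R : realType}.
Implicit Types (a b c d x y h e t : R) (f g : R[i] -> R[i]) (z u v w : R[i]) (X : set R[i]).

Definition rectangle a b c d : set R[i] :=
  [set z | a <= complex.Re z <= b /\ c <= complex.Im z <= d].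

Lemma rectangle_bounded a b c d z : rectangle a b c d z ->
  normc z <= `|a| + `|b| + (`|c| + `|d|).
Proof.
move=> [zab zcd]; apply: (le_trans (normc_le_ReIm _)).
have := ler_norm b; have := ler_norm d; have := normr_ge0 b; have := normr_ge0 d.
have := ler_norm (- a); have := ler_norm (- c); rewrite !normrN.
have := normr_ge0 a; have := normr_ge0 c.
by move=> *; apply: lerD; rewrite ler_norml; apply/andP; split; lra.
Qed.

Lemma normc_i : normc ('i : R[i]) = 1.
Proof. by rewrite /normc /= expr0n expr1n add0r sqrtr1. Qed.

Lemma normc_Ni : normc (- 'i : R[i]) = 1.
Proof. by rewrite normcN normc_i. Qed.

(** A strip of width h separates each edge from the inner rectangle, so [far_center] provides an
    expansion centre. The directions w = i, -i, -1, 1 make Re (w v) constant on the lower, upper,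
    left and right edge. *)
Lemma rect_int_kernel_approx a b c d (h : R) f : a <= b -> c <= d -> 0 < h ->
  bcont a b c d f ->
  poly_approx (rectangle (a + h) (b - h) (c + h) (d - h))
    (fun u => rect_int a b c d (fun v => f v * (v - u)^-1)).
Proof.
move=> ab cd h0 [f1 f2 f3 f4]; set X := rectangle _ _ _ _.
pose B := `|a| + `|b| + (`|c| + `|d|) + h + h + h + h.
have hN : `|h| = h by rewrite gtr0_norm.
have XB u : X u -> normc u <= B.
  move=> /rectangle_bounded /le_trans; apply; rewrite /B.
  have := ler_normD a h; have := ler_normB b h; have := ler_normD c h.
  have := ler_normB d h; rewrite hN; lra.
have bX : normc_bounded X by exists B.
have [nb nd na nc'] : [/\ b <= B, d <= B, - a <= B & - c <= B].
  have := ler_norm b; have := ler_norm d; have := normr_ge0 b; have := normr_ge0 d.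
  have := ler_norm (- a); have := ler_norm (- c); rewrite !normrN.
  have := normr_ge0 a; have := normr_ge0 c.
  by rewrite /B => *; split; lra.
have hco y : contin a b (fun s => s +i* y).
  by apply: (@hcont_contin R a b y id) => s _; exact (contc_id _).
have vco x : contin c d (fun s => x +i* s).
  by apply: (@vcont_contin R c d x id) => s _; exact (contc_id _).
have p1 : poly_approx X (fun u => Cint a b (fun x => f (x +i* c) * ((x +i* c) - u)^-1)).
  have [z [r [m [r01 m0 far]]]] := far_center normc_i h0 nc'.
  apply: (edge_approx ab (hco c) (hcont_contin f1) r01 m0) => t u tab Xu.
  apply: far; first exact: XB.
    by case: u Xu => p q [/= _ ?]; lra.
  by rewrite /=; lra.
have p2 : poly_approx X (fun u => Cint a b (fun x => f (x +i* d) * ((x +i* d) - u)^-1)).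
  have [z [r [m [r01 m0 far]]]] := far_center normc_Ni h0 nd.
  apply: (edge_approx ab (hco d) (hcont_contin f2) r01 m0) => t u tab Xu.
  apply: far; first exact: XB.
    by case: u Xu => p q [/= _ ?]; lra.
  by rewrite /=; lra.
have p3 : poly_approx X (fun u => Cint c d (fun y => f (a +i* y) * ((a +i* y) - u)^-1)).
  have nN : normc (-1 : R[i]) = 1 by rewrite normcN normc1.
  have [z [r [m [r01 m0 far]]]] := far_center nN h0 na.
  apply: (edge_approx cd (vco a) (vcont_contin f3) r01 m0) => t u tab Xu.
  apply: far; first exact: XB.
    by case: u Xu => p q [/= ? _]; lra.
  by rewrite /=; lra.
have p4 : poly_approx X (fun u => Cint c d (fun y => f (b +i* y) * ((b +i* y) - u)^-1)).
  have [z [r [m [r01 m0 far]]]] := far_center (@normc1 R) h0 nb.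
  apply: (edge_approx cd (vco b) (vcont_contin f4) r01 m0) => t u tab Xu.
  apply: far; first exact: XB.
    by case: u Xu => p q [/= ? _]; lra.
  by rewrite /=; lra.
have opp g : poly_approx X g -> poly_approx X (fun u => - g u).
  move=> pg; apply: (@poly_approx_eq _ _ (fun u => -1 * g u)) => [u _|].
    by rewrite mulN1r.
  exact (poly_approxM bX (poly_approx_cst X (-1)) pg).
have p34 := poly_approxM bX (poly_approx_cst X 'i) (poly_approxD p4 (opp _ p3)).
exact (poly_approxD (poly_approxD p1 (opp _ p2)) p34).
Qed.

Lemma Im_inv z : complex.Im z^-1 = - complex.Im z / normc z ^+ 2.
Proof. by rewrite normc_sqr; case: z => p q /=; rewrite mulNr. Qed.

Lemma Re_inv z : complex.Re z^-1 = complex.Re z / normc z ^+ 2.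
Proof. by rewrite normc_sqr; case: z. Qed.

Lemma Cint_Re_ge a b (phi : R -> R[i]) (B : R) : a <= b -> contin a b phi ->
  (forall t, a <= t <= b -> B <= complex.Re (phi t)) ->
  (b - a) * B <= complex.Re (Cint a b phi).
Proof. by move=> ab fc fB; apply: Rintegral_itv_ge => //; exact: contin_Re. Qed.

(* The value is in fact 2 i pi, but a lower bound is all that is needed. *)
Lemma rect_int_kernel_Im a b c d (h : R) : a < b -> c < d -> 0 < h ->
  exists2 m, 0 < m & forall u, rectangle (a + h) (b - h) (c + h) (d - h) u ->
    bcont a b c d (fun v => (v - u)^-1) /\
    m <= complex.Im (rect_int a b c d (fun v => (v - u)^-1)).
Proof.
move=> ab cd h0; pose D := (b - a) + (d - c).
have D0 : 0 < D by rewrite /D; lra.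
exists ((b - a) * (h / D ^+ 2)).
  by rewrite mulr_gt0 ?subr_gt0 // divr_gt0 // exprn_gt0.
move=> u [ux uy].
have ku s t : a <= s <= b -> c <= t <= d ->
    [\/ s = a, s = b, t = c | t = d] -> s +i* t != u.
  move=> sab tcd bd; rewrite -subr_eq0; case: u ux uy => p q /= ux uy.
  rewrite sub_complex_eq0; apply/negP => /andP[/eqP sp /eqP tq].
  by case: bd => bd; lra.
have kc s t : a <= s <= b -> c <= t <= d ->
    [\/ s = a, s = b, t = c | t = d] -> {for s +i* t, continuous (fun v => (v - u)^-1)}.
  by move=> sab tcd bd; apply: cdiff_cont; apply: cauchy_kernel_cdiff; exact: ku.
have far s t : a <= s <= b -> c <= t <= d ->
    [\/ s = a, s = b, t = c | t = d] -> 0 < normc ((s +i* t) - u) <= D.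
  move=> sab tcd bd; rewrite normc_gt0 subr_eq0 ku //=.
  apply: (le_trans (normc_le_ReIm _)); case: u ux uy {ku kc} => p q /= ux uy.
  by rewrite /D; apply: lerD; rewrite ler_norml; apply/andP; split; lra.
have aa : a <= a <= b by lra.
have bb' : a <= b <= b by lra.
have cc : c <= c <= d by lra.
have dd : c <= d <= d by lra.
have bk : bcont a b c d (fun v => (v - u)^-1).
  split => s ss; apply: kc => //;
   by [constructor 1|constructor 2|constructor 3|constructor 4].
split=> //; have [k1 k2 k3 k4] := bk.
have quot (p n : R) : h <= p -> 0 < n <= D -> h / D ^+ 2 <= p / n ^+ 2.
  move=> hp /andP[n0 nD]; apply: ler_pM => //; first exact: ltW.
    by rewrite invr_ge0 sqr_ge0.
  by rewrite lef_pV2 ?posrE ?exprn_gt0 // lerXn2r ?nnegrE // ltW.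
have quot0 (p n : R) : h <= p -> 0 <= p / n ^+ 2.
  by move=> hp; rewrite divr_ge0 ?sqr_ge0 //; lra.
(* All four edges contribute a nonnegative imaginary part; the lower one alone already gives the
   bound. *)
have I1 : (b - a) * (h / D ^+ 2) <= complex.Im (Cint a b (fun x => ((x +i* c) - u)^-1)).
  apply: (Cint_Im_ge (ltW ab) (hcont_contin k1)) => t tab; rewrite Im_inv.
  apply: quot; last by apply: far => //; constructor 3.
  by case: u ux uy {ku kc far bk k1 k2 k3 k4} => p q /= ux uy; lra.
have I2 : complex.Im (Cint a b (fun x => ((x +i* d) - u)^-1)) <= 0.
  have k2' := continM (@contin_cst R a b (-1)) (hcont_contin k2).
  have /(_ 0) := Cint_Im_ge (ltW ab) k2'.
  rewrite mulr0 (CintZ (-1) (hcont_contin k2)) mulN1r.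
  case: (Cint _ _ _) => p q /= H; rewrite -oppr_ge0; apply: H => t tab.
  rewrite mulN1r; have := Im_inv ((t +i* d) - u); case: (_ ^-1) => p' q' /= ->.
  rewrite mulNr opprK; apply: quot0.
  by case: u ux uy {ku kc far bk k1 k2 k3 k4 k2' I1} => p1 q1 /= ux uy; lra.
have I3 : 0 <= complex.Re (Cint c d (fun y => ((b +i* y) - u)^-1)).
  rewrite -(mulr0 (d - c)).
  apply: (Cint_Re_ge (ltW cd) (vcont_contin k4)) => t tab; rewrite Re_inv.
  apply: quot0.
  by case: u ux uy {ku kc far bk k1 k2 k3 k4 I1 I2} => p q /= ux uy; lra.
have I4 : complex.Re (Cint c d (fun y => ((a +i* y) - u)^-1)) <= 0.
  have k2' := continM (@contin_cst R c d (-1)) (vcont_contin k3).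
  have /(_ 0) := Cint_Re_ge (ltW cd) k2'.
  rewrite mulr0 (CintZ (-1) (vcont_contin k3)) mulN1r.
  case: (Cint _ _ _) => p q /= H; rewrite -oppr_ge0; apply: H => t tab.
  rewrite mulN1r; have := Re_inv ((a +i* t) - u); case: (_ ^-1) => p' q' /= ->.
  rewrite -mulNr; apply: quot0.
  by case: u ux uy {ku kc far bk k1 k2 k3 k4 k2' I1 I2 I3} => p1 q1 /= ux uy; lra.
have E (p q r s : R[i]) : complex.Im (p - q + 'i * (r - s)) =
    complex.Im p - complex.Im q + (complex.Re r - complex.Re s).
  by case: p q r s => [? ?] [? ?] [? ?] [? ?] /=; ring.
have EI : complex.Im (rect_int a b c d (fun v => (v - u)^-1)) = _ := E _ _ _ _.
rewrite (le_trans I1) // EI -addrA lerDl; clear -I2 I3 I4; lra.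
Qed.

(** Let W be the integral of the Cauchy kernel. Both f W and W are limits of polynomials by
    [rect_int_kernel_approx]. As Im W is bounded below and |W| above, W / (i T) stays in a disc of
    radius below 1 around 1 for large T; so 1 / W is a limit of polynomials too, and so is f. *)
Theorem runge_rectangle a b c d (h : R) f : 0 < h -> a + h < b - h -> c + h < d - h ->
  (forall z, rectangle a b c d z -> cdiff f z) ->
  poly_approx (rectangle (a + h) (b - h) (c + h) (d - h)) f.
Proof.
move=> h0 ab' cd' df; set X := rectangle _ _ _ _.
have ab : a < b by lra.
have cd : c < d by lra.
have df' s t : a <= s <= b -> c <= t <= d -> cdiff f (s +i* t).
  by move=> sab tcd; apply: df; split.
have bf : bcont a b c d f by split => s ss; apply: cdiff_cont; apply: df'; lra.
have bX : normc_bounded X by eexists => z; exact: rectangle_bounded.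
pose W u := rect_int a b c d (fun v => (v - u)^-1).
have pFW : poly_approx X (fun u => f u * W u).
  apply: poly_approx_eq (rect_int_kernel_approx (ltW ab) (ltW cd) h0 bf).
  move=> [p q] [/= pab qcd]; apply: rect_int_cauchy => //; lra.
have pW : poly_approx X W.
  apply: poly_approx_eq (rect_int_kernel_approx (ltW ab) (ltW cd) h0 (bcont_cst a b c d 1)).
  by move=> u _; rewrite /W; congr rect_int; apply/funext => v; rewrite mul1r.
have [m m0 mW] := rect_int_kernel_Im ab cd h0.
have [M0 M00 MW] := poly_approx_bounded bX pW.
pose M := M0 + m; have Mm : m <= M by rewrite /M lerDr.
have M0M : M0 <= M by rewrite /M lerDl ltW.
have M0' : 0 < M by exact: lt_le_trans Mm.
clearbody M.
(* |i T - W|^2 = T^2 - 2 T Im W + |W|^2 <= T^2 - 2 T m + M^2, and T m = M^2 turns this into T^2 - T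
   m <= (T - m / 2)^2. *)
pose T := M ^+ 2 / m.
have Tm : T * m = M ^+ 2 by rewrite /T divfK // gt_eqF.
have TM : M <= T by rewrite /T ler_pdivlMr // expr2 ler_pM2l.
have T0 : 0 < T by exact: lt_le_trans TM.
clearbody T.
pose k : R[i] := (T%:C * 'i)^-1.
have Ti0 : T%:C * 'i != 0 :> R[i].
  by rewrite -normc_eq0 normcM normc_real normc_i mulr1 gt_eqF // gtr0_norm.
have r01 : 0 <= 1 - m / (2 * T) < 1.
  have : 0 < m / (2 * T) by rewrite divr_gt0 // mulr_gt0.
  have : m / (2 * T) <= 1 by rewrite ler_pdivrMr ?mulr_gt0 //; lra.
  lra.
have pV : poly_approx X (fun u => (k * W u)^-1).
  apply: (poly_approxV bX r01) (poly_approxM bX (poly_approx_cst X k) pW) => u Xu.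
  have mu : m <= complex.Im (W u) by case: (mW u Xu).
  have Mu := MW u Xu.
  have -> : 1 - k * W u = k * (T%:C * 'i - W u) by rewrite mulrBr /k mulVf.
  rewrite normcM /k normcV normcM normc_real normc_i mulr1 (gtr0_norm T0).
  rewrite mulrC ler_pdivrMr // (_ : (1 - m / (2 * T)) * T = T - m / 2); last first.
    by field; rewrite gt_eqF.
  rewrite -(@ler_pXn2r _ 2) ?nnegrE ?normc_ge0 //; last by lra.
  rewrite normc_sqr.
  have := normc_sqr (W u).
  have : normc (W u) ^+ 2 <= M ^+ 2.
    by rewrite lerXn2r ?nnegrE ?normc_ge0 ?(ltW M0') // (le_trans Mu).
  case: (W u) mu => p q /= mu le1 e1.
  have Tq : T * m <= T * q by rewrite ler_pM2l.
  have : 0 <= m ^+ 2 by exact: sqr_ge0.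
  have -> : (T * 0 - 0 * 1 - p) ^+ 2 + (T * 1 + 0 * 0 - q) ^+ 2 = T ^+ 2 - 2 * (T * q) + (p ^+ 2 + q ^+ 2) by ring.
  have -> : (T - m / 2) ^+ 2 = T ^+ 2 - T * m + m ^+ 2 / 4 by field.
  lra.
have := poly_approxM bX (poly_approxM bX (poly_approx_cst X k) pFW) pV.
apply: poly_approx_eq => u Xu.
have mu : m <= complex.Im (W u) by case: (mW u Xu).
have Wu : W u != 0 by apply: contraTneq mu => ->; rewrite /= -ltNge.
have k0 : k != 0 by rewrite /k invr_eq0.
by clearbody k; field; rewrite Wu k0.
Qed.

End RungeRectangle.

(** * Faber polynomials of the arc *)

Section FaberPolynomials.
Context {R : realType} (s : R) (s01 : 0 < s < 1).
Implicit Types (z x y w u v : R[i]) (p : {poly R[i]}).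

Let s0 : 0 < s. Proof. by case/andP: s01. Qed.
Let s1 : s < 1. Proof. by case/andP: s01. Qed.
Let sC0 : s%:C != 0 :> R[i].
Proof. by rewrite -normc_eq0 normc_real normr_eq0 gt_eqF. Qed.

(* [x] and [y] are the two solutions of [z = w (s w + 1) / (w + s)]. *)
Definition fiber z x y := x + y = (z - 1) / s%:C /\ x * y = - z.

(** For r >= 1 this is the arc together with all psi(w), 1 < |w| <= r, that is, the filled level
    curve. Bounding both solutions avoids singling out the exterior one. *)
Definition tube (r : R) : set R[i] :=
  [set z | exists x y, [/\ fiber z x y, normc x <= r & normc y <= r]].

(** Newton's recurrence p_(k+2) = (x + y) p_(k+1) - x y p_k for the power sums of x and y; the pair
    carries two consecutive terms so that the recursion is structural. *)
Fixpoint power_sum_poly k : {poly R[i]} * {poly R[i]} :=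
  if k is k'.+1 then
    let: (q0, q1) := power_sum_poly k' in
    (q1, (s%:C)^-1 *: (('X - 1%:P) * q1) + 'X * q0)
  else (2%:P, (s%:C)^-1 *: ('X - 1%:P)).

Definition power_sum k := (power_sum_poly k).1.

Lemma power_sumSS k : power_sum k.+2 =
  (s%:C)^-1 *: (('X - 1%:P) * power_sum k.+1) + 'X * power_sum k.
Proof. by rewrite /power_sum /=; case: (power_sum_poly k). Qed.

Lemma power_sum0 : power_sum 0 = 2%:P. Proof. by []. Qed.

Lemma power_sum1 : power_sum 1 = (s%:C)^-1 *: ('X - 1%:P). Proof. by []. Qed.

Lemma horner_power_sum k z x y : fiber z x y ->
  (power_sum k).[z] = x ^+ k + y ^+ k.
Proof.
move=> [xy1 xy2].
elim/ltn_ind: k => -[_|[_|k IHk]].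
- by rewrite power_sum0 hornerC !expr0.
- by rewrite power_sum1 hornerZ hornerXsubC !expr1 xy1 mulrC.
rewrite power_sumSS hornerD hornerZ !hornerM hornerXsubC hornerX !IHk //.
rewrite mulrA [_^-1 * _]mulrC -xy1 -[z]opprK -xy2 !exprS; ring.
Qed.

Lemma size_power_sum k : (size (power_sum k) <= k.+1)%N.
Proof.
elim/ltn_ind: k => -[_|[_|k IHk]].
- by rewrite power_sum0 size_polyC; case: eqP.
- by rewrite power_sum1 (leq_trans (size_scale_leq _ _)) // size_XsubC.
rewrite power_sumSS (leq_trans (size_polyD _ _)) // geq_max; apply/andP; split.
  rewrite (leq_trans (size_scale_leq _ _)) // (leq_trans (size_polyMleq _ _)) //.
  by rewrite size_XsubC; exact: IHk.
rewrite (leq_trans (size_polyMleq _ _)) // size_polyX /=.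
by rewrite ltnS (leq_trans (IHk k _)) // ltnW.
Qed.

Lemma coef_power_sum k : (power_sum k.+1)`_k.+1 = (s%:C) ^- k.+1.
Proof.
elim: k => [|k IHk].
  by rewrite power_sum1 coefZ coefB coefX coefC /= subr0 mulr1.
rewrite power_sumSS coefD coefZ mulrBl coefB coefXM /= mul1r coefXM /= IHk.
rewrite !nth_default ?size_power_sum // ?(leq_trans (size_power_sum _)) //.
by rewrite subr0 addr0 -invfM -exprS.
Qed.

(** As w tends to infinity, the second solution tends to - s; subtracting its limit makes
    F_k(psi(w)) - w^k vanish at infinity. *)
Definition faber k := power_sum k - ((- s%:C) ^+ k)%:P.

Lemma horner_faber k z x y : fiber z x y ->
  (faber k).[z] = x ^+ k + y ^+ k - (- s%:C) ^+ k.
Proof. by move=> h; rewrite hornerD hornerN hornerC (horner_power_sum k h). Qed.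

Lemma size_faber k : (size (faber k) <= k.+1)%N.
Proof.
rewrite (leq_trans (size_polyD _ _)) // geq_max size_power_sum size_polyN.
by rewrite (leq_trans (size_polyC_leq1 _)).
Qed.

Lemma coef_faber k : (faber k)`_k != 0.
Proof.
case: k => [|k].
  rewrite /faber power_sum0 coefB !coefC /= expr0.
  by rewrite (_ : 2 - 1 = 1) ?oner_neq0 //; ring.
by rewrite /faber coefB coef_power_sum coefC /= subr0 invr_eq0 expf_neq0.
Qed.

Lemma faber_expansion m p : (size p <= m.+1)%N ->
  exists c : nat -> R[i], p = \sum_(k < m.+1) c k *: faber k.
Proof.
elim: m p => [|m IHm] p sp.
  exists (fun=> p`_0); rewrite big_ord1 [LHS](size1_polyC sp).
  by rewrite /faber power_sum0 expr0 -polyCB -mul_polyC -polyCM; congr (_ %:P); ring.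
pose a := p`_m.+1 / (faber m.+1)`_m.+1.
have [|c pE] := IHm (p - a *: faber m.+1).
  apply/leq_sizeP => j; rewrite leq_eqVlt => /predU1P[<-|mj].
    by rewrite coefB coefZ /a divfK ?coef_faber // subrr.
  by rewrite coefB coefZ !nth_default ?mulr0 ?subrr // (leq_trans _ mj) // size_faber.
exists (fun k => if k == m.+1 then a else c k).
rewrite big_ord_recr /= eqxx -[LHS](subrK (a *: faber m.+1)) pE; congr (_ + _).
by apply: eq_bigr => k _; rewrite ltn_eqF.
Qed.

Lemma tube_bounded r : normc_bounded (tube r).
Proof.
exists (r * r) => z [x [y [[_ xy] xr yr]]].
by rewrite -[z]opprK -xy normcN normcM ler_pM ?normc_ge0.
Qed.

Lemma tubeS r r' : r <= r' -> tube r `<=` tube r'.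
Proof.
by move=> rr z [x [y [h xr yr]]]; exists x, y; split => //; exact: le_trans rr.
Qed.

Lemma clog1D_approx (r : R) : 0 < r < 1 ->
  poly_approx [set v | normc v <= r] (fun v => clog (1 + v)).
Proof.
move=> /andP[r0 r1]; pose h := (1 - r) / 2.
have h0 : 0 < h by rewrite /h; lra.
have q1 : - (r + h) + h < r + h - h by lra.
have df v : rectangle (- (r + h)) (r + h) (- (r + h)) (r + h) v ->
    cdiff (fun v => clog (1 + v)) v.
  move=> [v1 _]; apply: (@cdiff_comp R (fun v => 1 + v) clog).
    exact (cdiffD (cdiff_cst 1 v) (cdiff_id v)).
  apply: cdiff_clog; apply: Re_gt0_slit; move: v1; case: v => p q /=.
  by rewrite /h; lra.
apply: poly_approx_sub (runge_rectangle h0 q1 q1 df).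
move=> v /= vr; have := normc_ge_Re v; have := normc_ge_Im v.
by rewrite !ler_norml => /andP[? ?] /andP[? ?]; split; lra.
Qed.

Lemma fiber_mul z x y : fiber z x y ->
  z = ((1 - s ^+ 2)^-1)%:C * ((1 + s%:C * x) * (1 + s%:C * y)).
Proof.
move=> [xy1 xy2].
have -> : (1 + s%:C * x) * (1 + s%:C * y) = 1 + s%:C * (x + y) + s%:C ^+ 2 * (x * y) by ring.
rewrite xy1 xy2 mulrCA divff // mulr1.
have n0 : (1 - s ^+ 2)%:C != 0 :> R[i].
  by rewrite -normc_eq0 normc_real normr_eq0 gt_eqF // subr_gt0 expr_lt1 // ltW.
rewrite fmorphV.
have -> : 1 + (z - 1) + s%:C ^+ 2 * - z = (1 - s ^+ 2)%:C * z.
  by rewrite rmorphB rmorphXn rmorph1; ring.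
by rewrite mulKf.
Qed.

Lemma Re_1Ds_gt0 (r : R) x : s * r < 1 -> normc x <= r -> 0 < complex.Re (1 + s%:C * x).
Proof.
move=> sr xr; have : s * normc x < 1 by rewrite (le_lt_trans _ sr) // ler_pM2l.
have := normc_ge_Re x; rewrite ler_norml => /andP[+ _].
case: x xr => p q /= _ h1 h2; rewrite mul0r subr0.
have : s * (- normc (p +i* q)) <= s * p by rewrite ler_pM2l.
lra.
Qed.

Lemma clog_fiber (r : R) z x y : s * r < 1 -> fiber z x y ->
  normc x <= r -> normc y <= r ->
  clog z = (ln (1 - s ^+ 2)^-1)%:C + clog (1 + s%:C * x) + clog (1 + s%:C * y).
Proof.
move=> sr h xr yr; rewrite [in LHS](fiber_mul h) clog_real_mulM //.
- by rewrite invr_gt0 subr_gt0 expr_lt1 // ltW.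
- exact: (Re_1Ds_gt0 sr xr).
- exact: (Re_1Ds_gt0 sr yr).
Qed.

Lemma clog_approx (r : R) : 0 < r -> s * r < 1 -> poly_approx (tube r) clog.
Proof.
move=> r0 sr e e0.
have e2 : 0 < e / 2 by rewrite divr_gt0.
have sr01 : 0 < s * r < 1 by rewrite mulr_gt0.
have [T TP] := clog1D_approx sr01 e2.
(* T(s x) alone is not a polynomial in z, but T(s x) + T(s y) is a combination of power sums and
   therefore is. *)
exists ((ln (1 - s ^+ 2)^-1)%:C%:P + \sum_(k < size T) (T`_k * s%:C ^+ k) *: power_sum k).
move=> z [x [y [h xr yr]]].
rewrite (clog_fiber sr h xr yr) hornerD hornerC horner_sum.
have -> : \sum_(k < size T) ((T`_k * s%:C ^+ k) *: power_sum k).[z] =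
    T.[s%:C * x] + T.[s%:C * y].
  rewrite !horner_coef -big_split /=; apply: eq_bigr => k _.
  by rewrite hornerZ (horner_power_sum _ h) !exprMn; ring.
set A := (ln _)%:C; set B := clog _; set B' := clog _.
set C := T.[_]; set C' := T.[_].
rewrite (_ : _ - _ = (B - C) + (B' - C')); last by ring.
have sx w : normc w <= r -> normc (s%:C * w) <= s * r.
  by move=> wr; rewrite normcM normc_real gtr0_norm // ler_pM2l.
by rewrite (le_trans (normcD _ _)) // [e]splitr lerD // TP //=; exact: sx.
Qed.

End FaberPolynomials.

Lemma entire_approx {R : realType} (X : set R[i]) (f g : R[i] -> R[i]) :
  normc_bounded X -> poly_approx X f -> (forall z, cdiff g z) ->
  poly_approx X (fun z => g (f z)).
Proof.
move=> bX pf dg; have [M M0 fM] := poly_approx_bounded bX pf.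
pose B := M + 1.
have B0 : 0 < B by rewrite ltr_wpDl.
have q1 : - B - 1 + 1 < B + 1 - 1 by lra.
have pg := runge_rectangle ltr01 q1 q1 (fun z _ => dg z).
apply: (poly_approx_comp bX pf _ pg).
move=> z /fM fz; have := normc_ge_Re (f z); have := normc_ge_Im (f z).
by rewrite !ler_norml => /andP[? ?] /andP[? ?]; split; rewrite /B; lra.
Qed.

Lemma cpow_approx {R : realType} (X : set R[i]) (b : R) : normc_bounded X ->
  poly_approx X clog -> poly_approx X (fun z => cpow z b).
Proof.
move=> bX pl.
apply: (entire_approx (g := fun u => cexp (b%:C * u)) bX pl) => z.
apply: cdiff_comp; last exact: cdiff_cexp.
exact (cdiffM (cdiff_cst _ z) (cdiff_id z)).
Qed.

(** Discrete orthogonality, used in place of integration over a circle. The inverse powers serve the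
    negative exponents of a Laurent expansion. *)
Lemma unity_root_sums {R : realType} (N : nat) : (0 < N)%N ->
  exists om : R[i], normc om = 1 /\
    forall i, (0 < i < N)%N ->
      \sum_(j < N) (om ^+ j) ^+ i = 0 /\ \sum_(j < N) (om ^+ j) ^- i = 0.
Proof.
move=> N0; pose th : R := 2 * pi / N%:R.
pose om : R[i] := cexp (0 +i* th).
have omX k : om ^+ k = cexp (0 +i* (k%:R * th)).
  elim: k => [|k IHk]; first by rewrite expr0 mul0r cexp0.
  rewrite exprS IHk -cexpD; congr cexp; apply/eqP.
  by rewrite eq_complex /= addr0 eqxx -nat1r mulrDl mul1r eqxx.
have N0' : (N%:R : R) != 0 by rewrite pnatr_eq0 -lt0n.
have omN : om ^+ N = 1.
  rewrite omX /th mulrC divfK // /cexp /= expR0 !mul1r (_ : 2 * pi = pi *+ 2).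
    by rewrite cos2pi sin2pi.
  exact: mulr_natl.
have omi i : (0 < i < N)%N -> om ^+ i != 1.
  move=> /andP[i0 iN]; apply/eqP => /(congr1 (@complex.Re R)).
  rewrite omX /cexp /= expR0 mul1r => c1.
  pose a : R := pi * (i%:R / N%:R).
  have aE : i%:R * th = a *+ 2 by rewrite mulr2n /a /th; ring.
  have sa : 0 < sin a.
    apply: sin_gt0_pi; rewrite /a mulr_gt0 ?pi_gt0 ?divr_gt0 ?ltr0n //=.
    rewrite -[ltRHS]mulr1 ltr_pM2l ?pi_gt0 // ltr_pdivrMr ?ltr0n // mul1r.
    by rewrite ltr_nat.
  move: c1; rewrite aE cos_mulr2n => c1.
  have := sin2cos2 a; have : 0 < sin a ^+ 2 by rewrite exprn_gt0.
  move: c1; rewrite mulr2n; lra.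
have geo (x : R[i]) : x != 1 -> x ^+ N = 1 -> \sum_(j < N) x ^+ j = 0.
  move=> x1 xN; have := subrX1 x N; rewrite xN subrr => /esym/eqP.
  by rewrite mulf_eq0 subr_eq0 (negbTE x1) => /eqP.
exists om; split; first by rewrite normc_cexp expR0.
move=> i iN; split.
  rewrite -[RHS](geo (om ^+ i)) ?omi //; last by rewrite exprAC omN expr1n.
  by apply: eq_bigr => j _; rewrite exprAC.
rewrite -[RHS](geo (om ^- i)).
- by apply: eq_bigr => j _; rewrite exprVn exprAC.
- by rewrite invr_eq1 omi.
- by rewrite exprVn exprAC omN expr1n invr1.
Qed.

(** * Cauchy estimates for Faber coefficients *)

Section FaberCoefficients.
Context {R : realType} (s : R) (s01 : 0 < s < 1).
Implicit Types (z x y w u v : R[i]) (p : {poly R[i]}).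

Let s0 : 0 < s. Proof. by case/andP: s01. Qed.
Let s1 : s < 1. Proof. by case/andP: s01. Qed.

(* Maps the exterior of the unit disc onto the complement of the arc. *)
Definition arc_map w := w * (s%:C * w + 1) / (w + s%:C).
(** The other point of the fiber over psi(w): the product of the two solutions is - psi(w). *)
Definition arc_conj w := - (s%:C * w + 1) / (w + s%:C).

Lemma normc_s : normc s%:C = s.
Proof. by rewrite normc_real gtr0_norm. Qed.

Lemma arc_den_neq0 w : 1 <= normc w -> w + s%:C != 0.
Proof.
move=> w1; apply/eqP => /eqP; rewrite addr_eq0 => /eqP ws.
by move: w1; rewrite ws normcN normc_s leNgt s1.
Qed.

Lemma arc_map_fiber w : 1 <= normc w -> fiber s (arc_map w) w (arc_conj w).
Proof.
move=> w1; have n0 := arc_den_neq0 w1.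
have sC0 : s%:C != 0 :> R[i] by rewrite -normc_eq0 normc_s gt_eqF.
by split; rewrite /arc_map /arc_conj; field; rewrite ?n0 ?sC0.
Qed.

Lemma arc_conj_le1 w : 1 <= normc w -> normc (arc_conj w) <= 1.
Proof.
move=> w1; have n0 := arc_den_neq0 w1.
rewrite /arc_conj normcM normcV normcN ler_pdivrMr ?normc_gt0 // mul1r.
rewrite -(@ler_pXn2r _ 2) ?nnegrE ?normc_ge0 // !normc_sqr.
have : 1 <= normc w ^+ 2 by rewrite expr_ge1 // normc_ge0.
rewrite normc_sqr; case: w {w1 n0} => p q /= pq.
rewrite -subr_ge0.
have -> : (p + s) ^+ 2 + (q + 0) ^+ 2 - ((s * p - 0 * q + 1) ^+ 2 + (s * q + 0 * p + 0) ^+ 2) =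
   (1 - s ^+ 2) * (p ^+ 2 + q ^+ 2 - 1) by ring.
by rewrite mulr_ge0 // subr_ge0 // expr_le1 // ltW.
Qed.

(** In v = 1 / w the values p(psi(1 / v)) are the principal part, the sum of the c_l v^(-l), plus
    Q(v), where Q is regular on |v| <= 1 / r and Q(0) = 0. Multiplying by v^k and averaging over a
    circle isolates c_k. Roots of unity replace the circle, once Q is replaced by a nearby
    polynomial q. *)
Lemma faber_coef_bound (r M : R) m (c : nat -> R[i]) : 1 <= r ->
  (forall w, normc w = r ->
     normc (\sum_(l < m.+1) c l *: faber s l).[arc_map w] <= M) ->
  forall k, (k <= m)%N -> normc (c k) * r ^+ k <= M.
Proof.
move=> r1 pM k km.
have r0 : 0 < r by exact: lt_le_trans r1.
pose rho := r^-1; have rho0 : 0 < rho by rewrite invr_gt0.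
have rho1 : rho <= 1 by rewrite invf_le1.
pose D : set R[i] := [set v | normc v <= rho].
have bD : normc_bounded D by exists rho.
(* This is [arc_conj] at 1 / v, rewritten so that it extends to v = 0 with value - s. *)
pose tau v := - (s%:C + v) * (1 + s%:C * v)^-1.
pose beta l v := tau v ^+ l - (- s%:C) ^+ l.
pose Q v := \sum_(l < m.+1) c l * beta l v.
have pV : poly_approx D (fun v => (1 + s%:C * v)^-1).
  apply: (@poly_approxV R D (fun v => 1 + s%:C * v) s bD).
  - by rewrite ltW.
  - move=> v vr; rewrite opprD addrA subrr add0r normcN normcM normc_s.
    by rewrite ler_piMr ?(ltW s0) // (le_trans vr).
  apply: (@poly_approx_eq _ _ (horner (1 + s%:C%:P * 'X))) (poly_approx_horner _ _) => v _.
  by rewrite hornerD !hornerE.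
have pid : poly_approx D (fun v => - (s%:C + v)).
  apply: (@poly_approx_eq _ _ (horner (- (s%:C%:P + 'X)))) (poly_approx_horner _ _) => v _.
  by rewrite !hornerE.
have ptau : poly_approx D tau := poly_approxM bD pid pV.
have ptauX l : poly_approx D (fun v => tau v ^+ l).
  elim: l => [|l IHl].
    by apply: poly_approx_eq (poly_approx_cst D 1) => v _; rewrite expr0.
  by apply: poly_approx_eq (poly_approxM bD ptau IHl) => v _; rewrite exprS.
have pQ : poly_approx D Q.
  rewrite /Q; elim: (m.+1) => [|n IHn].
    by apply: poly_approx_eq (poly_approx_cst D 0) => v _; rewrite big_ord0.
  have pb := poly_approxD (ptauX n) (poly_approx_cst D (- (- s%:C) ^+ n)).
  have := poly_approxD IHn (poly_approxM bD (poly_approx_cst D (c n)) pb).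
  by apply: poly_approx_eq => v _; rewrite big_ord_recr.
have Q0 : Q 0 = 0.
  rewrite /Q big1 // => l _; rewrite /beta /tau mulr0 !addr0 invr1 mulr1 subrr.
  by rewrite mulr0.
apply/ler_addgt0Pl => e e0.
(* Two errors of size e' occur, from Q - q and from q(0), and both are multiplied by r^k at the
   end. *)
pose e' := e / (2 * r ^+ k).
have rk0 : 0 < r ^+ k by rewrite exprn_gt0.
have e'0 : 0 < e' by rewrite divr_gt0 // mulr_gt0.
have [q qP] := pQ _ e'0.
(* N exceeds every exponent i + k and |l - k| that occurs, so no nonzero exponent is a multiple of
   N. *)
pose N := (size q + k + m).+1.
have [om [om1 omS]] := @unity_root_sums R N isT.
pose V j : R[i] := rho%:C * om ^+ j.
have nV j : normc (V j) = rho.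
  by rewrite normcM normc_real normcX om1 expr1n mulr1 gtr0_norm.
have V0 j : V j != 0 by rewrite -normc_eq0 nV gt_eqF.
have nVV j : normc (V j)^-1 = r by rewrite normcV nV invrK.
have VD j : D (V j) by rewrite /D /= nV.
have sumV i : (0 < i < N)%N -> \sum_(j < N) V j ^+ i = 0.
  move=> /omS [S _]; under eq_bigr do rewrite exprMn.
  by rewrite -mulr_sumr S mulr0.
have sumVV i : (0 < i < N)%N -> \sum_(j < N) V j ^- i = 0.
  move=> /omS [_ S]; under eq_bigr do rewrite exprMn invfM.
  by rewrite -mulr_sumr S mulr0.
have sum1 : \sum_(j < N) (1 : R[i]) = N%:R by rewrite sumr_const card_ord.
pose P : {poly R[i]} := \sum_(l < m.+1) c l *: faber s l.
have PE j : P.[arc_map (V j)^-1] = \sum_(l < m.+1) c l * V j ^- l + Q (V j).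
  have f := @arc_map_fiber (V j)^-1; rewrite nVV in f; have {}f := f r1.
  rewrite horner_sum /Q -big_split /=; apply: eq_bigr => l _.
  rewrite hornerZ (horner_faber _ f) -mulrDr /beta; congr (_ * _).
  have -> : arc_conj (V j)^-1 = tau (V j).
    have d0 : (V j)^-1 + s%:C != 0 by apply: arc_den_neq0; rewrite nVV.
    have d1 : 1 + s%:C * V j != 0.
      have -> : 1 + s%:C * V j = V j * ((V j)^-1 + s%:C).
        by rewrite mulrDr divff ?V0 // [V j * s%:C]mulrC.
      by rewrite mulf_neq0 ?V0.
    rewrite /arc_conj /tau; field.
    by rewrite V0 d1.
  by rewrite exprVn addrA.
have main1 : \sum_(j < N) (\sum_(l < m.+1) c l * V j ^- l) * V j ^+ k = N%:R * c k.
  under eq_bigr do rewrite mulr_suml; rewrite exchange_big /=.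
  rewrite (bigD1 (Ordinal (leq_ltn_trans km (ltnSn m)))) //= [X in _ + X]big1 ?addr0.
    under eq_bigr do rewrite divfK ?expf_neq0 ?V0 //.
    by rewrite sumr_const card_ord mulr_natl.
  move=> l lk; under eq_bigr do rewrite -mulrA; rewrite -mulr_sumr.
  have {}lk : nat_of_ord l != k by move: lk; rewrite -val_eqE.
  have [ltlk|ltkl|/eqP] := ltngtP l k; last by rewrite (negbTE lk).
    under eq_bigr => j _ do rewrite mulrC -expfB //.
    rewrite sumV ?mulr0 // subn_gt0 ltlk /= (leq_ltn_trans (leq_subr _ _)) //.
    by rewrite ltnS -addnA addnC -addnA leq_addr.
  under eq_bigr => j _ do rewrite -[V j ^+ k]invrK -invfM -expfB //.
  rewrite sumVV ?mulr0 // subn_gt0 ltkl /= (leq_ltn_trans (leq_subr _ _)) //.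
  by rewrite ltnS (leq_trans _ (leq_addl _ _)) // -ltnS.
(* Only the constant term of q can survive, and only for k = 0; it is small because q(0) is close to
   Q(0) = 0. *)
have main2 : normc (\sum_(j < N) q.[V j] * V j ^+ k) <= N%:R * e'.
  have -> : \sum_(j < N) q.[V j] * V j ^+ k = N%:R * (q`_0 *+ (k == 0%N)).
    under eq_bigr do rewrite horner_coef mulr_suml; rewrite exchange_big /=.
    under eq_bigr => i _ do under eq_bigr do rewrite -mulrA -exprD.
    under eq_bigr do rewrite -mulr_sumr.
    have [k0|k0] := eqVneq k 0%N; last first.
      rewrite mulr0 big1 // => i _; rewrite sumV ?mulr0 // addn_gt0 (lt0n k) k0 orbT /=.
      by rewrite ltnS (leq_trans _ (leq_addr _ _)) // leq_add2r ltnW.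
    rewrite k0; under eq_bigr do rewrite addn0.
    case: (posnP (size q)) => [q0|q0].
      rewrite nth_default ?q0 // mulr0 big1 // => i _.
      by case: i.
    rewrite (bigD1 (Ordinal q0)) //= [X in _ + X]big1 ?addr0.
      by under eq_bigr do rewrite expr0; rewrite sum1 mulrC.
    move=> i i0; rewrite sumV ?mulr0 // lt0n.
    by rewrite (_ : (nat_of_ord i != 0%N)) // ltnS -addnA (leq_trans (ltnW (ltn_ord i))) ?leq_addr.
  have := qP 0; rewrite /D /= normc0 ltW // Q0 sub0r normcN horner_coef0 => /(_ isT) q0e.
  rewrite normcM -(rmorph_nat (real_complex R)) normc_real normr_nat ler_wpM2l //.
  by case: eqP; rewrite ?mulr1n // mulr0n normc0 ltW.
have main3 : normc (\sum_(j < N) (Q (V j) - q.[V j]) * V j ^+ k) <= N%:R * e'.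
  rewrite (le_trans (normc_sum _ _ _)) //.
  rewrite (le_trans (ler_sum _ (G := fun=> e') _)) ?sumr_const ?card_ord ?mulr_natl //.
  move=> j _; rewrite normcM normcX nV -[leRHS]mulr1.
  apply: ler_pM; [exact: normc_ge0|by rewrite exprn_ge0 // ltW|exact: qP|].
  by rewrite exprn_ile1 // ltW.
have main4 : normc (\sum_(j < N) P.[arc_map (V j)^-1] * V j ^+ k) <= N%:R * (M * rho ^+ k).
  rewrite (le_trans (normc_sum _ _ _)) //.
  rewrite (le_trans (ler_sum _ (G := fun=> M * rho ^+ k) _)) ?sumr_const ?card_ord ?mulr_natl //.
  by move=> j _; rewrite normcM normcX nV ler_wpM2r ?exprn_ge0 ?(ltW rho0) // pM.
have E : N%:R * c k = \sum_(j < N) P.[arc_map (V j)^-1] * V j ^+ k -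
   (\sum_(j < N) (Q (V j) - q.[V j]) * V j ^+ k + \sum_(j < N) q.[V j] * V j ^+ k).
  rewrite -main1 -big_split /= -sumrB; apply: eq_bigr => j _.
  by rewrite PE; ring.
have NR0 : 0 < N%:R :> R by rewrite ltr0n.
have : N%:R * normc (c k) <= N%:R * (M * rho ^+ k + e' + e').
  have -> : N%:R * normc (c k) = normc (N%:R * c k).
    by rewrite normcM -(rmorph_nat (real_complex R)) normc_real normr_nat.
  rewrite E (le_trans (normcB _ _)) //.
  rewrite (le_trans (lerD main4 (le_trans (normcD _ _) (lerD main3 main2)))) //.
  by rewrite le_eqVlt; apply/orP; left; apply/eqP; ring.
rewrite ler_pM2l // -(ler_pM2r rk0) => /le_trans; apply.
rewrite le_eqVlt; apply/orP; left; apply/eqP.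
rewrite /e' /rho exprVn; field.
by rewrite gt_eqF.
Qed.

End FaberCoefficients.

Lemma is_derive_ln_affine {R : realType} (p q x : R) : 0 < p + q * x ->
  is_derive x 1 (fun t => ln (p + q * t)) (q / (p + q * x)).
Proof.
move=> pos; have d1 : is_derive x 1 (fun t => p + q * t) q.
  have h : is_derive x 1 (cst p + q \*: id : R -> R) (0 + q *: 1).
    by apply: is_deriveD.
  have e : 0 + q *: 1 = q by rewrite add0r; exact: mulr1.
  by rewrite e in h.
have d2 := is_derive1_ln pos.
rewrite mulrC.
exact: (@is_derive1_comp _ _ (fun t => p + q * t) _ _ _ d2 d1).
Qed.

(** * The threshold *)

Section ThresholdInequalities.
Context {R : realType} (s : R) (s01 : 0 < s < 1).

(* The modulus of [arc_map (- x)], the minimum of |arc_map| on the circle of radius x. *)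
Definition arc_min (x : R) := x * (1 - s * x) / (x - s).

Lemma arc_min_gt0 x : 1 <= x -> s * x < 1 -> 0 < arc_min x.
Proof.
move=> x1 sx; have /andP[s0 s1] := s01; rewrite /arc_min divr_gt0 ?mulr_gt0 //; lra.
Qed.

Lemma ln_arc_min x : 1 <= x -> s * x < 1 ->
  ln (arc_min x) = ln x + ln (1 - s * x) - ln (x - s).
Proof.
move=> x1 sx; have /andP[s0 s1] := s01.
rewrite /arc_min lnM ?posrE ?invr_gt0 ?mulr_gt0 //; try lra.
rewrite lnM ?posrE ?lnV ?posrE //; lra.
Qed.

(** With k the inverse of the threshold, H(t) = k ln t + ln ([arc_min t]) vanishes at 1, and its
    derivative is - (t - 1)^2 times a positive factor; hence H < 0 beyond 1. In particular ln
    ([arc_min x]) < 0, so a larger alpha only lowers the sum. *)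
Lemma threshold_below (alpha x : R) : (1 - s) / (2 * s) <= alpha -> 1 < x -> s * x < 1 ->
  ln x + alpha * ln (arc_min x) < 0.
Proof.
move=> al x1 sx; have /andP[s0 s1] := s01.
pose k := 2 * s / (1 - s).
have k0 : 0 < k by rewrite divr_gt0 ?mulr_gt0 //; lra.
pose H t := (1 + k) * ln (0 + 1 * t) + ln (1 + (- s) * t) - ln (- s + 1 * t).
pose dH t := (1 + k) * (1 / (0 + 1 * t)) + (- s) / (1 + (- s) * t) - 1 / (- s + 1 * t).
have HE t : H t = (1 + k) * ln t + ln (1 - s * t) - ln (t - s).
  by rewrite /H add0r !mul1r mulNr [- s + t]addrC.
have H1 : H 1 = 0 by rewrite HE ln1 !mulr1 mulr0 add0r subrr.
have pos t : 1 <= t <= x -> [/\ 0 < 0 + 1 * t, 0 < 1 + (- s) * t & 0 < - s + 1 * t].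
  move=> /andP[t1 tx]; have : s * t <= s * x by rewrite ler_pM2l //; lra.
  by split; lra.
have dHP t : 1 <= t <= x -> is_derive t 1 H (dH t).
  move=> /pos [p1 p2 p3].
  have d1 := is_derive_ln_affine p1; have d2 := is_derive_ln_affine p2.
  have d3 := is_derive_ln_affine p3.
  exact: (is_deriveB (is_deriveD (is_deriveZ (1 + k) d1) d2) d3).
have Hc : {within `[1, x], continuous H}.
  apply: derivable_within_continuous => t; rewrite in_itv /= => /dHP [].
  by [].
have dHP' t : t \in `]1, x[ -> is_derive t 1 H (dH t).
  by rewrite in_itv /= => tx; apply: dHP; lra.
have [t tx HD] := @MVT R H dH 1 x x1 dHP' Hc.
have {}tx : 1 < t < x by move: tx; rewrite in_itv.
have st : s * t < 1 by rewrite (le_lt_trans _ sx) // ler_pM2l //; clear -tx; lra.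
have dHneg : dH t < 0.
  have -> : dH t = - (s * (1 + s) * (t - 1) ^+ 2 / (t * (t - s) * (1 - s * t) * (1 - s))).
    rewrite /dH /k; field.
    by rewrite !gt_eqF //=; clear -tx st s0 s1; lra.
  have [tp t1] : 0 < t /\ 0 < t - 1 by clear -tx; lra.
  rewrite oppr_lt0 divr_gt0 ?mulr_gt0 ?exprn_gt0 //; clear -tx st s0 s1; lra.
have Hx : H x < 0.
  have : H x - H 1 < 0 by rewrite HD nmulr_rlt0 // subr_gt0.
  by rewrite H1 subr0.
have lx : 0 < ln x by rewrite ln_gt0.
have lm : ln (arc_min x) < - k * ln x.
  by rewrite ln_arc_min ?ltW //; move: Hx; rewrite HE; lra.
have kV : (1 - s) / (2 * s) = k^-1.
  by rewrite /k; field; rewrite !gt_eqF //; lra.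
have ak : k^-1 <= alpha by rewrite -kV.
have lm0 : ln (arc_min x) < 0 by rewrite (lt_trans lm) // mulNr oppr_lt0 mulr_gt0.
have : alpha * ln (arc_min x) <= k^-1 * ln (arc_min x) by rewrite ler_nM2r.
have : k^-1 * ln (arc_min x) < k^-1 * (- k * ln x) by rewrite ltr_pM2l ?invr_gt0.
have -> : k^-1 * (- k * ln x) = - ln x by field; rewrite gt_eqF.
lra.
Qed.

Lemma threshold_above (alpha : R) : 0 < alpha -> alpha < (1 - s) / (2 * s) ->
  exists x, [/\ 1 < x, s * x < 1 & 0 < ln x + alpha * ln (arc_min x)].
Proof.
move=> a0 al; have /andP[s0 s1] := s01.
have as1 : 2 * (alpha * s) < 1 - s.
  by move: al; rewrite ltr_pdivlMr ?mulr_gt0 //; lra.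
have as0 : 0 < alpha * s by rewrite mulr_gt0.
have sa : 0 < s * (1 + alpha) by rewrite mulr_gt0 //; lra.
(* By ln y >= 1 - 1 / y the sum is at least a positive multiple of 1 - s x - alpha s (x + 1), which
   vanishes at x = X; X > 1 is the assumption on alpha. The point x is taken halfway between 1 and
   X. *)
pose X := (1 - alpha * s) / (s * (1 + alpha)).
have X1 : 1 < X by rewrite ltr_pdivlMr //; lra.
have sX : s * X <= 1.
  have -> : s * X = (1 - alpha * s) / (1 + alpha).
    by rewrite /X; field; rewrite !gt_eqF //; lra.
  by rewrite ler_pdivrMr; lra.
have XE : X * (s * (1 + alpha)) = 1 - alpha * s by rewrite divfK // gt_eqF.
pose x := (1 + X) / 2.
have x1 : 1 < x by rewrite /x; lra.
have xX : x < X by rewrite /x; lra.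
have sx : s * x < 1 by rewrite (lt_le_trans _ sX) // ltr_pM2l.
exists x; split => //.
have key : alpha * s * (x + 1) < 1 - s * x.
  have : x * (s * (1 + alpha)) < X * (s * (1 + alpha)) by rewrite ltr_pM2r.
  rewrite XE; lra.
have ln_ge (y : R) : 0 < y -> 1 - y^-1 <= ln y.
  move=> y0; have yV : 0 < y^-1 by rewrite invr_gt0.
  have e1 : 1 + (y^-1 - 1) = y^-1 by rewrite addrC subrK.
  have := @le_ln1Dx R (y^-1 - 1); rewrite e1 lnV ?posrE // => H.
  have : - ln y <= y^-1 - 1 by apply: H; lra.
  lra.
have m0 := arc_min_gt0 (ltW x1) sx.
have l1 := ln_ge x _; have l2 := ln_ge _ m0.
have x0 : 0 < x by lra.
have : alpha * (1 - (arc_min x)^-1) <= alpha * ln (arc_min x) by rewrite ler_pM2l.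
have : 0 < (1 - x^-1) + alpha * (1 - (arc_min x)^-1).
  have -> : (1 - x^-1) + alpha * (1 - (arc_min x)^-1) =
     (x - 1) / (x * (1 - s * x)) * (1 - s * x - alpha * s * (x + 1)).
    by rewrite /arc_min; field; rewrite !gt_eqF //; clear -x0 x1 sx s0 s1; lra.
  by rewrite !mulr_gt0 ?invr_gt0 ?mulr_gt0 //; lra.
have := l1 x0; lra.
Qed.

End ThresholdInequalities.

Lemma uniform_cvg_normc {R : realType} (A : set R[i]) (F : nat -> R[i] -> R[i]) (f : R[i] -> R[i]) :
  {uniform A, F @ \oo --> f} <->
  forall e : R, 0 < e -> exists N, forall n z, (N <= n)%N -> A z -> normc (F n z - f z) < e.
Proof.
split=> [H e e0|H P].
  have : nbhs (f : {uniform` A -> R[i]}) [set h | forall z, A z -> normc (h z - f z) < e].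
    apply/uniform_nbhs; exists [set xy | normc (xy.1 - xy.2) < e]; split; last first.
      by move=> h H' z Az; rewrite normc_distC; exact: H'.
    rewrite -entourage_ballE; exists e%:C; first by rewrite /= ltcR.
    by move=> [x y]; rewrite /= -ball_normE /= normr_complex ltcR.
  move=> /H [N _ NP]; exists N => n z Nn Az; exact: (NP n Nn z Az).
move=> /uniform_nbhs [E [entE EP]].
move: entE; rewrite -entourage_ballE => -[e /= e0 eE].
have eR : e = (complex.Re e)%:C by rewrite RRe_real // realE ltW.
have e0' : 0 < complex.Re e by rewrite -ltcR -eR.
have [N NP] := H _ e0'; exists N => // n Nn; apply: EP => z Az; apply: eE.
by rewrite /= -ball_normE /= normr_complex eR ltcR normc_distC; exact: NP.
Qed.

(** * The image of the unit circle, and failure of approximation from the threshold on *)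

Section ArcMap.
Context {R : realType} (theta0 : R) (htheta0 : 0 < theta0 < 2 * pi).
Implicit Types (z w : R[i]).

Local Notation s := (sin (theta0 / 4)).

Lemma sin_theta0 : 0 < s < 1.
Proof.
have [t1 t2] := andP htheta0; have p0 := pi_gt0 R.
apply/andP; split; first by apply: sin_gt0_pi; lra.
have c0 : 0 < cos (theta0 / 4) by apply: cos_gt0_pihalf; lra.
rewrite ltNge; apply/negP => s1.
have := cos2Dsin2 (theta0 / 4).
have : 0 < cos (theta0 / 4) ^+ 2 by rewrite exprn_gt0.
have : 1 <= s ^+ 2 by rewrite expr_ge1 //; lra.
lra.
Qed.

(** Let a = s w + 1. On the unit circle w + s is w times the conjugate of a, so psi(w) is a over its
    conjugate, which is exp (2 i arg a). As a lies in the disc of radius s = sin (theta0 / 4) around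
    1, |arg a| <= theta0 / 4. *)
Lemma arc_map_circle w : normc w = 1 -> circular_arc theta0 (arc_map s w).
Proof.
move=> w1; have [t1 t2] := andP htheta0; have p0 := pi_gt0 R.
have /andP[s0 s1] := sin_theta0.
have w1' : 1 <= normc w by rewrite w1.
have d0 := arc_den_neq0 sin_theta0 w1'.
set a := s%:C * w + 1.
have a0 : 0 < complex.Re a.
  have : `|complex.Re w| <= 1 by rewrite -w1 normc_ge_Re.
  rewrite /a; case: w {w1 w1' d0 a} => p q /=; rewrite ler_norml => /andP[p1 p2].
  have : s * -1 <= s * p by rewrite ler_pM2l.
  lra.
have na : a != 0 by apply: contraTneq a0 => ->; rewrite ltxx.
have n0 : 0 < normc a by rewrite normc_gt0.
pose phi := carg a.
have /andP[ph1 ph2] := carg_Re_gt0 a0; rewrite -/phi in ph1 ph2.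
have aE : a = (normc a)%:C * cexp (0 +i* phi).
  rewrite -[LHS]clogK // [clog a](_ : _ = (ln (normc a))%:C + (0 +i* phi)).
    rewrite cexpD; congr (_ * _); rewrite /cexp /= lnK // cos0 sin0 mulr1 mulr0.
    by [].
  by apply/eqP; rewrite eq_complex /= addr0 add0r !eqxx.
have sphi : `|sin phi| <= s.
  rewrite /phi sin_carg // normrM normfV (gtr0_norm n0) ler_pdivrMr //.
  rewrite -(@ler_pXn2r _ 2) ?nnegrE ?mulr_ge0 ?(ltW s0) ?normc_ge0 //.
  rewrite real_normK ?num_real // exprMn normc_sqr.
  have := normc_sqr w; rewrite w1 expr1n.
  rewrite /a; case: w {w1 w1' d0 a a0 na n0 phi ph1 ph2 aE} => p q /= pq.
  rewrite -subr_ge0.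
  have q2 : q ^+ 2 = 1 - p ^+ 2 by rewrite pq; ring.
  have -> : s ^+ 2 * ((s * p - 0 * q + 1) ^+ 2 + (s * q + 0 * p + 0) ^+ 2) -
      (s * q + 0 * p + 0) ^+ 2 =
      s ^+ 2 * ((s * p + 1) ^+ 2 + s ^+ 2 * q ^+ 2 - q ^+ 2) by ring.
  rewrite q2 (_ : _ - _ = (p + s) ^+ 2); last by ring.
  by rewrite mulr_ge0 ?sqr_ge0.
have phb : - (theta0 / 4) <= phi <= theta0 / 4.
  move: sphi; rewrite ler_norml => /andP[sp1 sp2].
  have i1 : phi \in `[- (pi / 2), pi / 2] by rewrite in_itv /=; lra.
  have i2 : theta0 / 4 \in `[- (pi / 2), pi / 2] by rewrite in_itv /=; lra.
  have i3 : - (theta0 / 4) \in `[- (pi / 2), pi / 2] by rewrite in_itv /=; lra.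
  rewrite !leNgt; apply/andP; split; apply/negP => h.
    by move: sp1; rewrite -sinN leNgt ltr_sin // h.
  by move: sp2; rewrite leNgt ltr_sin // h.
exists (phi *+ 2).
  by rewrite /= in_itv /= (mulr2n phi); lra.
pose E := cexp (0 +i* phi); pose rho : R[i] := (normc a)%:C.
have E0 : E != 0 by exact: cexp_neq0.
have rho0 : rho != 0 by rewrite -normc_eq0 normc_real normr_eq0 gt_eqF.
have w0 : w != 0 by rewrite -normc_eq0 w1 oner_neq0.
have EE : cexp (0 +i* (phi *+ 2)) = E * E.
  by rewrite -cexpD; congr cexp; apply/eqP; rewrite eq_complex /= addr0 (mulr2n phi) !eqxx.
have wE : w + s%:C = w * (rho * E^-1).
  have -> : E^-1 = cexp (0 +i* - phi).
    rewrite -cexpN; congr cexp; apply/eqP.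
    by rewrite eq_complex /= oppr0 !eqxx.
  have := normc_sqr w; rewrite w1 expr1n => pq.
  have [re im] : complex.Re a = normc a * cos phi /\ complex.Im a = normc a * sin phi.
    by rewrite [in LHS]aE [in X in _ /\ X = _]aE /cexp /= expR0 !mul1r !mul0r subr0 addr0.
  have -> : rho * cexp (0 +i* - phi) = complex.Re a +i* (- complex.Im a).
    rewrite re im /rho /cexp /= expR0 cosN sinN; apply/eqP.
    by rewrite eq_complex /=; apply/andP; split; apply/eqP; ring.
  rewrite /a; case: (w) pq => p q /= pq; apply/eqP; rewrite eq_complex /=.
  have q2 : q ^+ 2 = 1 - p ^+ 2 by rewrite pq; ring.
  apply/andP; split; apply/eqP; last by ring.
  have -> : p * (s * p - 0 * q + 1) - q * - (s * q + 0 * p + 0) = s * p ^+ 2 + p + s * q ^+ 2 by ring.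
  by rewrite q2; ring.
rewrite EE /arc_map wE -/a [in RHS]aE -/E -/rho; field.
by rewrite w0 rho0 E0.
Qed.

Lemma continuous_arc : continuous (fun t : R => cexp (0 +i* t)).
Proof.
move=> t; apply: (@continuous_comp _ _ _ (fun t => 0 +i* t) (@cexp R)).
  by apply: (@cvg_complex R _ (nbhs t) _ (fun=> 0) id 0 t) => //; exact: cvg_cst.
exact: (cdiff_cont (cdiff_cexp _)).
Qed.

Lemma compact_arc : compact (circular_arc theta0).
Proof.
apply: continuous_compact; last exact: segment_compact.
by apply: continuous_subspaceT; exact: continuous_arc.
Qed.

Lemma locally_uniform_arc (G : set R[i]) (F : nat -> R[i] -> R[i]) f (e : R) :
  0 < e -> circular_arc theta0 `<=` G -> locally_uniform_cvg G F f ->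
  exists N, forall n z, (N <= n)%N -> circular_arc theta0 z -> normc (F n z - f z) < e.
Proof.
move=> e0 KG cv.
have /compact_near_coveringP := compact_arc.
move=> /(_ nat \oo (fun n z => G z -> normc (F n z - f z) < e) _).
case.
  move=> z Kz; have [U Uz /uniform_cvg_normc /(_ e e0) [N NP]] := cv z (KG z Kz).
  exists (U, [set n | (N <= n)%N]) => //=; first by split => //; exists N.
  by move=> [z' n] /= [Uz' Nn] Gz'; exact: NP.
move=> N _ NP; exists N => n z Nn Kz.
by apply: (NP n Nn z Kz); exact: KG.
Qed.

(** As x decreases to 1, psi(- x) tends to psi(- 1) = 1, a point of the arc; so the open set G
    contains psi(- x) for some x > 1. Convergence to f = 1 is used only on the arc and at this
    point. *)
Lemma not_approximable (alpha : R) : (1 - s) / (2 * s) <= alpha ->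
  ~ approximable (circular_arc theta0) alpha.
Proof.
move=> al [G [[[oG _ _] _] _ _ KG ap]].
have ssin := sin_theta0; have /andP[s0 s1] := ssin.
have [|P sP PP] := ap (fun=> 1).
  by move=> z _; exact: derivable_cst.
have K1 : circular_arc theta0 1.
  have := @arc_map_circle 1 (@normc1 R); rewrite /arc_map mul1r mulr1 [1 + _]addrC.
  rewrite divff // -normc_eq0 (_ : s%:C + 1 = (s + 1)%:C); last by rewrite rmorphD rmorph1.
  by rewrite normc_real normr_eq0 gt_eqF //; lra.
have G1 := KG _ K1.
have [d d0 dG] : exists2 d : R, 0 < d & forall w, normc (w - 1) < d -> G w.
  by apply/nbhs_normc; rewrite openE in oG; exact: oG.
(* The second bound gives s x < 1. The first and the third give |m - 1| = s eta (x + 1) / (x - s) <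
   d, so that m lies in G. *)
pose eta := Num.min (Num.min 1 ((1 - s) / (2 * s))) (d * (1 - s) / (4 * s)).
have eta0 : 0 < eta.
  by rewrite !lt_min ltr01 !divr_gt0 ?mulr_gt0 ?subr_gt0.
have [eta1 etas etad] : [/\ eta <= 1, eta <= (1 - s) / (2 * s) & eta <= d * (1 - s) / (4 * s)].
  by have : eta <= eta by []; rewrite {2}/eta !le_min => /andP[/andP[-> ->] ->].
clearbody eta.
pose x := 1 + eta.
have x1 : 1 < x by rewrite /x ltrDl.
have x0 : 0 < x := lt_trans ltr01 x1.
have x10 : 0 < x - 1 by rewrite subr_gt0.
have se : s * eta <= (1 - s) / 2.
  move: etas; rewrite !ler_pdivlMr ?mulr_gt0 //; lra.
have sx : s * x < 1 by rewrite /x; lra.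
have xs : 0 < x - s by lra.
pose m := arc_min s x.
have m0 : 0 < m by apply: arc_min_gt0 => //; exact: ltW.
have m1 : 1 - m = s * (eta * (x + 1)) / (x - s).
  by rewrite /m /arc_min /x; field; rewrite gt_eqF.
have md : `|m - 1| < d.
  rewrite distrC m1 ger0_norm; last first.
    by rewrite ltW // divr_gt0 // !mulr_gt0 // addr_gt0.
  rewrite ltr_pdivrMr //.
  have : 4 * (s * eta) <= d * (1 - s).
    by move: etad; rewrite ler_pdivlMr ?mulr_gt0 //; lra.
  have : s * eta * x <= s * eta * 2 by rewrite ler_pM2l ?mulr_gt0 // /x; lra.
  have : 0 < s * eta by rewrite mulr_gt0.
  have : d * (1 - s) < d * (x - s) by rewrite ltr_pM2l //; lra.
  lra.
have wE : arc_map s (- x%:C) = m%:C.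
  rewrite /arc_map /m /arc_min.
  have n1 : (x - s)%:C != 0 :> R[i] by rewrite -normc_eq0 normc_real normr_eq0 gt_eqF.
  rewrite rmorphM fmorphV rmorphM !rmorphB rmorph1 rmorphM.
  rewrite rmorphB in n1.
  field; rewrite n1 /= addrC -opprB oppr_eq0 //.
have nx : normc (- x%:C) = x by rewrite normcN normc_real gtr0_norm.
have nx1 : 1 <= normc (- x%:C) by rewrite nx ltW.
have fb := arc_map_fiber ssin nx1; rewrite wE in fb.
have Gm : G m%:C.
  apply: dG; have -> : m%:C - 1 = (m - 1)%:C by rewrite rmorphB rmorph1.
  by rewrite normc_real.
(* Tolerance 1 / 2 gives |P_n| <= 3 / 2 on the arc, where the weight has modulus 1, and a weighted
   value of modulus above 1 / 2 at m. The estimate below makes the latter at most 1 / 4. *)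
have half0 : 0 < 1 / 2 :> R by rewrite divr_gt0.
have [N1 N1P] := locally_uniform_arc half0 KG PP.
have [U Um /uniform_cvg_normc /(_ _ half0) [N2 N2P]] := PP _ Gm.
pose q := x * expR (alpha * ln m).
have q01 : 0 <= q < 1.
  apply/andP; split; first by rewrite mulr_ge0 ?expR_ge0 // ltW.
  have xE : x = expR (ln x) by rewrite lnK // posrE.
  rewrite /q {1}xE.
  by rewrite -expRD -expR0 ltr_expR; exact: threshold_below.
(* 9 / 2 is the coefficient bound 3 / 2 times the factor 3 from the three terms of F_k; x / (x - 1)
   comes from summing x^k up to n. *)
pose C := 9 / 2 * (x / (x - 1)).
have C0 : 0 < C by rewrite mulr_gt0 ?divr_gt0.
have c4 : 0 < 1 / 4 / C by rewrite !divr_gt0.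
have [N3 N3P] := expr_small q01 c4.
pose n := maxn (maxn N1 N2) N3.
have nN1 : (N1 <= n)%N by rewrite /n !leq_max leqnn.
have nN2 : (N2 <= n)%N by rewrite /n !leq_max leqnn orbT.
have nN3 : (N3 <= n)%N by rewrite /n !leq_max leqnn !orbT.
clearbody n.
have PK z : circular_arc theta0 z -> normc (P n).[z] <= 3 / 2.
  move=> Kz; have := N1P n z nN1 Kz.
  have nz : normc z = 1 by case: Kz => t _ <-; rewrite normc_cexp expR0.
  have nc1 : normc (cpow z (alpha * n%:R)) = 1 by rewrite normc_cpow nz ln1 mulr0 expR0.
  have -> : normc (P n).[z] = normc (cpow z (alpha * n%:R) * (P n).[z]).
    by rewrite normcM nc1 mul1r.
  have := normcD (cpow z (alpha * n%:R) * (P n).[z] - 1) 1; rewrite subrK normc1; cbv beta; clear; lra.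
have [c PE] := faber_expansion ssin (sP n).
have cb k : (k <= n)%N -> normc (c k) <= 3 / 2.
  move=> kn; have := @faber_coef_bound R s ssin 1 (3 / 2) n c (lexx 1).
  rewrite -PE => /(_ _ k kn); rewrite expr1n mulr1; apply => w w1.
  by apply: PK; exact: arc_map_circle.
have Pm : normc (P n).[m%:C] <= 3 / 2 * (3 * (x ^+ n.+1 / (x - 1))).
  rewrite PE horner_sum (le_trans (normc_sum _ _ _)) //.
  apply: (@le_trans _ _ (\sum_(k < n.+1) (3 / 2 * (3 * x ^+ k)))).
    apply: ler_sum => k _; rewrite hornerZ normcM (horner_faber _ fb).
    have kn : (k <= n)%N by rewrite -ltnS.
    have fk : normc ((- x%:C) ^+ k + arc_conj s (- x%:C) ^+ k - (- s%:C) ^+ k) <= 3 * x ^+ k.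
      have xk : 1 <= x ^+ k by rewrite exprn_ege1 // ltW.
      rewrite (le_trans (normcB _ _)) // !normcX normcN normc_real (gtr0_norm s0).
      have sk : s ^+ k <= 1 by rewrite exprn_ile1 // ltW.
      have := normcD ((- x%:C) ^+ k) (arc_conj s (- x%:C) ^+ k).
      rewrite !normcX nx => h1.
      have h2 : normc (arc_conj s (- x%:C)) ^+ k <= 1.
        by rewrite exprn_ile1 ?normc_ge0 // (arc_conj_le1 ssin).
      rewrite (le_trans (lerD h1 (lexx _))) // (le_trans (lerD (lerD (lexx _) h2) sk)) //.
      by clear -xk; lra.
    exact: (ler_pM (normc_ge0 _) (normc_ge0 _) (cb k kn) fk).
  rewrite -mulr_sumr -mulr_sumr !ler_pM2l ?divr_gt0 //.
  rewrite ler_pdivlMr //.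
  by rewrite mulrC -subrX1 lerBlDr lerDl.
have := N2P n m%:C nN2 (conj (nbhs_singleton Um) Gm).
have nm : normc m%:C = m by rewrite normc_real gtr0_norm.
have := normcB (cpow m%:C (alpha * n%:R) * (P n).[m%:C]) (cpow m%:C (alpha * n%:R) * (P n).[m%:C] - 1).
rewrite opprB addrCA subrr addr0 normc1 normcM normc_cpow nm.
have qE : expR (alpha * n%:R * ln m) * x ^+ n = q ^+ n.
  rewrite /q exprMn mulrC; congr (_ * _); rewrite -expRM_natl; congr expR.
  by rewrite -mulr_natl; ring.
have : expR (alpha * n%:R * ln m) * normc (P n).[m%:C] <= C * q ^+ n.
  rewrite (le_trans (ler_wpM2l (expR_ge0 _) Pm)) // -qE /C exprS.
  rewrite le_eqVlt; apply/orP; left; apply/eqP; field.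
  by rewrite gt_eqF.
have : C * q ^+ n <= 1 / 4.
  by rewrite mulrC -ler_pdivlMr //; exact: N3P.
clear; lra.
Qed.

End ArcMap.

(** * Weighted approximation of one polynomial, with the degree bound *)

Section WeightedApproximation.
Context {R : realType} (s : R) (s01 : 0 < s < 1).
Implicit Types (z w : R[i]).

(** After squaring and clearing denominators the difference is 2 s (r^2 - 1) (1 - s^2) (Re w + r),
    which vanishes at w = - r. *)
Lemma arc_min_le (r : R) w : 1 <= r -> s * r < 1 -> normc w = r ->
  arc_min s r <= normc (arc_map s w).
Proof.
move=> r1 sr wr; have /andP[s0 s1] := s01.
have w1 : 1 <= normc w by rewrite wr.
have n0 := arc_den_neq0 s01 w1.
have rs : 0 < r - s by lra.
rewrite /arc_map /arc_min !normcM normcV wr ler_pdivrMr //.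
rewrite mulrAC ler_pdivlMr ?normc_gt0 //.
rewrite -!mulrA ler_pM2l; last by lra.
rewrite -(@ler_pXn2r _ 2) ?nnegrE ?mulr_ge0 ?normc_ge0 //; try lra.
rewrite !exprMn !normc_sqr.
have rw : r ^+ 2 = complex.Re w ^+ 2 + complex.Im w ^+ 2 by rewrite -normc_sqr wr.
have := normc_ge_Re w; rewrite wr ler_norml => /andP[cr _].
case: w {wr w1 n0} rw cr => c q /= rw cr.
rewrite -subr_ge0.
have q2 : q ^+ 2 = r ^+ 2 - c ^+ 2 by rewrite rw; ring.
have -> : ((s * c - 0 * q + 1) ^+ 2 + (s * q + 0 * c + 0) ^+ 2) * (r - s) ^+ 2 -
    (1 - s * r) ^+ 2 * ((c + s) ^+ 2 + (q + 0) ^+ 2) =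
    ((s * c + 1) ^+ 2 + s ^+ 2 * q ^+ 2) * (r - s) ^+ 2 -
    (1 - s * r) ^+ 2 * ((c + s) ^+ 2 + q ^+ 2) by ring.
rewrite q2.
have -> : ((s * c + 1) ^+ 2 + s ^+ 2 * (r ^+ 2 - c ^+ 2)) * (r - s) ^+ 2 -
    (1 - s * r) ^+ 2 * ((c + s) ^+ 2 + (r ^+ 2 - c ^+ 2)) =
    2 * s * (r ^+ 2 - 1) * (1 - s ^+ 2) * (c + r) by ring.
have r2 : 1 <= r ^+ 2 by rewrite expr_ge1 //; lra.
have s2 : s ^+ 2 <= 1 by rewrite expr_le1 //; lra.
rewrite !mulr_ge0 //; lra.
Qed.

Lemma geometric_tail (rho : R) a b : 0 <= rho < 1 ->
  \sum_(a <= k < b) rho ^+ k <= rho ^+ a / (1 - rho).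
Proof.
move=> /andP[r0 r1].
have r1' : 0 < 1 - rho by rewrite subr_gt0.
rewrite ler_pdivlMr //.
have [ba|ab] := leqP b a; first by rewrite big_geq // mul0r exprn_ge0.
have -> : (\sum_(a <= k < b) rho ^+ k) * (1 - rho) = rho ^+ a - rho ^+ b.
  rewrite mulr_suml -[rho ^+ a - _]opprB -telescope_sumr ?(ltnW ab) // -sumrN.
  by apply: eq_bigr => k _; rewrite exprS; ring.
by rewrite lerBlDr lerDl exprn_ge0.
Qed.

Lemma normc_faber (r : R) k z : 1 <= r -> tube s r z -> normc (faber s k).[z] <= 3 * r ^+ k.
Proof.
move=> r1 [x [y [h xr yr]]]; have /andP[s0 s1] := s01.
have rk : 1 <= r ^+ k by rewrite exprn_ege1.
rewrite (horner_faber _ h) (le_trans (normcB _ _)) // !normcX normcN normc_real (gtr0_norm s0).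
have sk : s ^+ k <= 1 by rewrite exprn_ile1 // ltW.
have xk : normc x ^+ k <= r ^+ k by rewrite lerXn2r ?nnegrE ?normc_ge0 //; lra.
have yk : normc y ^+ k <= r ^+ k by rewrite lerXn2r ?nnegrE ?normc_ge0 //; lra.
have := normcD (x ^+ k) (y ^+ k); rewrite !normcX; lra.
Qed.

(** On the tube of r' the weight is at most r'^(2 alpha n), because |z| = |x| |y|. The coefficients
    are at most a constant times m^(- alpha n) r^(- k), and |F_k| <= 3 r'^k. The tail k > n is thus
    of order (r'^(1 + 2 alpha) / (r m^alpha))^n, and the gap hypothesis says that this base is below
    1. *)
Lemma weighted_poly_approx (alpha r r' : R) (q : {poly R[i]}) :
  0 < alpha -> 1 < r' -> r' < r -> s * r < 1 ->
  (1 + 2 * alpha) * ln r' < ln r + alpha * ln (arc_min s r) ->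
  forall e : R, 0 < e -> exists N, forall n, (N <= n)%N ->
    exists2 P : {poly R[i]}, (size P <= n.+1)%N &
      forall z, tube s r' z ->
        normc (cpow z (alpha * n%:R) * P.[z] - q.[z]) <= e.
Proof.
move=> a0 r'1 r'r sr gap e e0; have /andP[s0 s1] := s01.
have r1 : 1 < r by exact: lt_trans r'r.
have r0 : 0 < r by lra.
have r'0 : 0 < r' := lt_trans ltr01 r'1.
pose m := arc_min s r.
have m0 : 0 < m by apply: arc_min_gt0 => //; exact: ltW.
have bX := @tube_bounded R s r.
have [Q Q0 qQ] := horner_bounded q bX.
have rho01 : 0 <= r' / r < 1.
  by rewrite divr_ge0 ?ltr_pdivrMr ?mul1r ?r'r //; lra.
pose rho := r' / r; rewrite -/rho in rho01.
have rho1' : 0 < 1 - rho by case/andP: rho01 => _; rewrite subr_gt0.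
have rho0 : 0 < rho by rewrite divr_gt0 //; lra.
pose gam := expR ((1 + 2 * alpha) * ln r' - (ln r + alpha * ln m)).
have gam01 : 0 <= gam < 1.
  by rewrite expR_ge0 -expR0 ltr_expR subr_lt0.
pose C := 3 * (Q + 1) * (rho / (1 - rho)) + 1.
have C0 : 0 < C.
  have q0 : 0 <= rho / (1 - rho) by rewrite divr_ge0 ?ltW.
  by rewrite ltr_wpDl // mulr_ge0 // mulr_ge0 // addr_ge0.
have [N NP] := expr_small gam01 (divr_gt0 (divr_gt0 e0 (ltr0n R 2)) C0).
exists N => n Nn.
pose En := expR (alpha * n%:R * (2 * ln r')).
pose Dn := expR (- (alpha * n%:R) * ln m).
have En0 : 0 < En by exact: expR_gt0.
have Dn0 : 0 < Dn by exact: expR_gt0.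
have an0 : 0 <= alpha * n%:R by rewrite mulr_ge0 // ltW.
(* The first term keeps the error at most e / 2 after multiplication by the weight; the second
   bounds p by (Q + 1) Dn on the level curve. *)
pose e1 := Num.min (e / 2 / En) Dn.
have e10 : 0 < e1 by rewrite lt_min Dn0 !divr_gt0.
have e1E : e1 <= e / 2 / En by rewrite ge_min lexx.
have e1D : e1 <= Dn by rewrite ge_min lexx orbT.
have pf : poly_approx (tube s r) (fun z => q.[z] * cpow z (- (alpha * n%:R))).
  apply: poly_approxM bX (poly_approx_horner _ q) (cpow_approx _ bX _).
  exact: clog_approx.
have [p pP] := pf _ e10.
(* The degree of p depends on n without control, but the coefficient bound does not involve it.
   Taking the maximum makes the truncation at n a partial sum of the expansion. *)
pose d := maxn n (size p).
have pd : (size p <= d.+1)%N by rewrite ltnW // ltnS leq_maxr.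
have [c pE] := faber_expansion s01 pd.
have cb k : (k <= d)%N -> normc (c k) * r ^+ k <= (Q + 1) * Dn.
  apply: (faber_coef_bound s01 (ltW r1)) => w wr; rewrite -pE.
  have w1 : 1 <= normc w by rewrite wr ltW.
  have tw : tube s r (arc_map s w).
    exists w, (arc_conj s w); split; first exact: arc_map_fiber.
      by rewrite wr.
    by rewrite (le_trans (arc_conj_le1 s01 w1)) // ltW.
  have mw := arc_min_le (ltW r1) sr wr.
  set z := arc_map s w in tw mw *.
  have := pP z tw; have qz := qQ z tw.
  have cz : normc (cpow z (- (alpha * n%:R))) <= Dn.
    rewrite normc_cpow ler_expR !mulNr lerN2 ler_wpM2l //.
    by rewrite ler_ln // posrE (lt_le_trans m0 mw).
  have qc : normc (q.[z] * cpow z (- (alpha * n%:R))) <= Q * Dn.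
    by rewrite normcM ler_pM ?normc_ge0.
  have := normcB (q.[z] * cpow z (- (alpha * n%:R)))
                 (q.[z] * cpow z (- (alpha * n%:R)) - p.[z]).
  rewrite opprB addrCA subrr addr0 => h1 h2.
  rewrite (le_trans h1) // mulrDl mul1r lerD // (le_trans h2) //.
exists (\sum_(k < n.+1) c k *: faber s k).
  rewrite (leq_trans (size_sum _ _ _)) //; apply/bigmax_leqP => k _.
  rewrite (leq_trans (size_scale_leq _ _)) // (leq_trans (size_faber s _)) //.
move=> z tz.
have tz' : tube s r z by exact: (tubeS (ltW r'r)).
have zn : normc (cpow z (alpha * n%:R)) <= En.
  rewrite normc_cpow ler_expR ler_wpM2l //.
  have lr' : 0 < ln r' by rewrite ln_gt0.
  (* At z = 0 the default value ln 0 = 0 satisfies the bound. *)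
  have [->|z0] := eqVneq (normc z) 0; first by rewrite ln0 // mulr_ge0 // ltW.
  have zr : normc z <= r' ^+ 2.
    case: tz => x [y [[_ xy] xr yr]].
    by rewrite -[z]opprK -xy normcN normcM ler_pM ?normc_ge0.
  have -> : 2 * ln r' = ln (r' ^+ 2) by rewrite lnXn ?mulr_natl.
  have zp : 0 < normc z by rewrite lt_def z0 normc_ge0.
  by rewrite ler_ln // posrE; exact: lt_le_trans zr.
set P := \sum_(k < n.+1) _.
have tail : normc (p.[z] - P.[z]) <= 3 * ((Q + 1) * Dn) * (rho ^+ n.+1 / (1 - rho)).
  have -> : p.[z] - P.[z] = \sum_(n.+1 <= k < d.+1) c k * (faber s k).[z].
    rewrite pE /P !horner_sum.
    rewrite (eq_bigr (fun k : 'I_d.+1 => c k * (faber s k).[z])); last by move=> k _; rewrite hornerZ.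
    rewrite [X in _ - X](eq_bigr (fun k : 'I_n.+1 => c k * (faber s k).[z])); last by move=> k _; rewrite hornerZ.
    rewrite -(big_mkord xpredT (fun k => c k * (faber s k).[z])).
    rewrite -(big_mkord xpredT (fun k => c k * (faber s k).[z])).
    rewrite (@big_cat_nat _ _ _ n.+1 0 d.+1) //= ?ltnS ?leq_maxl //.
    by rewrite addrAC subrr add0r.
  rewrite (le_trans (normc_sum _ _ _)) //.
  apply: (@le_trans _ _ (\sum_(n.+1 <= k < d.+1) (3 * ((Q + 1) * Dn)) * rho ^+ k)).
    rewrite big_nat [leRHS]big_nat; apply: ler_sum => k /andP[_ kd].
    have ck := cb k kd; have fk := normc_faber k (ltW r'1) tz.
    have rk0 : 0 < r ^+ k by rewrite exprn_gt0.
    rewrite normcM.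
    have -> : 3 * ((Q + 1) * Dn) * rho ^+ k = ((Q + 1) * Dn / r ^+ k) * (3 * r' ^+ k).
      by rewrite /rho exprMn exprVn; ring.
    by rewrite ler_pM ?normc_ge0 // ler_pdivlMr.
  rewrite -mulr_sumr ler_wpM2l ?geometric_tail //.
  by rewrite !mulr_ge0 ?addr_ge0 // ltW.
have -> : cpow z (alpha * n%:R) * P.[z] - q.[z] =
   - (cpow z (alpha * n%:R) * ((q.[z] * cpow z (- (alpha * n%:R)) - p.[z]) + (p.[z] - P.[z]))).
  have := cpow_neq0 z (alpha * n%:R); rewrite cpowN => n0; field => //.
rewrite normcN normcM (le_trans (ler_pM (normc_ge0 _) (normc_ge0 _) zn (normcD _ _))) //.
rewrite mulrDr [e]splitr lerD //.
  rewrite (le_trans (ler_wpM2l (ltW En0) (le_trans (pP z tz') e1E))) //.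
  by rewrite mulrC divfK // gt_eqF.
rewrite (le_trans (ler_wpM2l (ltW En0) tail)) //.
have gE : En * Dn * rho ^+ n = gam ^+ n.
  have -> : rho = expR (ln r' - ln r).
    by rewrite expRD expRN !lnK ?posrE.
  rewrite /En /Dn /gam -!expRM_natl -!expRD; congr expR.
  by rewrite -/m; ring.
have -> : En * (3 * ((Q + 1) * Dn) * (rho ^+ n.+1 / (1 - rho))) = (C - 1) * gam ^+ n.
  by rewrite -gE /C exprS; field; rewrite gt_eqF.
have := NP n Nn; rewrite ler_pdivlMr // => H.
by rewrite (le_trans _ H) // mulrC ler_wpM2l ?exprn_ge0 ?expR_ge0 // lerBlDr lerDl.
Qed.

End WeightedApproximation.

(** * Neighbourhoods of the arc *)

Section LogRectangles.
Context {R : realType}.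
Implicit Types (z w u : R[i]) (a b : R).

Definition box a b : set R[i] := [set u | `|complex.Re u| < a /\ `|complex.Im u| < b].

(* Image of a box under the exponential, for [b <= pi]. *)
Definition sector a b : set R[i] := [set z | slit_plane z /\ box a b (clog z)].

Lemma slit_cexp u : `|complex.Im u| < pi -> slit_plane (cexp u).
Proof.
case: u => x y /=; rewrite ltr_norml => /andP[y1 y2] [/= im re].
have e0 : 0 < expR x by exact: expR_gt0.
move: im re => /eqP; rewrite mulf_eq0 gt_eqF //= pmulr_rle0 // => /eqP sy cy.
have [y0|y0|y0] := ltgtP y 0.
- have : 0 < sin (- y) by apply: sin_gt0_pi; lra.
  by rewrite sinN sy oppr0 ltxx.
- have : 0 < sin y by apply: sin_gt0_pi; lra.
  by rewrite sy ltxx.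
by move: cy; rewrite y0 cos0; lra.
Qed.

Lemma cexpK_box a b u : b <= pi -> box a b u -> clog (cexp u) = u.
Proof.
move=> bp [_]; rewrite ltr_norml => /andP[y1 y2]; apply: cexpK; lra.
Qed.

Lemma sector_cexp a b u : b <= pi -> box a b u -> sector a b (cexp u).
Proof.
move=> bp bu; split; last by rewrite (cexpK_box bp bu).
by apply: slit_cexp; exact: lt_le_trans bu.2 bp.
Qed.

Lemma box_nbhs a b u : box a b u -> exists2 d : R, 0 < d &
  forall v, normc (v - u) < d -> box a b v.
Proof.
move=> [ra ib]; exists (Num.min (a - `|complex.Re u|) (b - `|complex.Im u|)).
  by rewrite lt_min !subr_gt0 ra.
move=> v; rewrite lt_min => /andP[h1 h2].
have e1 := normc_ge_Re (v - u); have e2 := normc_ge_Im (v - u).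
have := ler_normD (complex.Re u) (complex.Re (v - u)).
have := ler_normD (complex.Im u) (complex.Im (v - u)).
case: u v ra ib h1 h2 e1 e2 => [p q] [p' q'] ra ib h1 h2 /= e1 e2.
rewrite ![_ + (_ - _)]addrC !subrK => t1 t2; split => /=; lra.
Qed.

Lemma slit_nbhs z : slit_plane z -> exists2 d : R, 0 < d &
  forall w, normc (w - z) < d -> slit_plane w.
Proof.
move=> /slit_normc pos; exists ((normc z + complex.Re z) / 2).
  by rewrite divr_gt0.
move=> w wz; apply/slit_normc.
have := normc_dist_le w z; rewrite ler_norml => /andP[h1 _].
have := normc_ge_Re (w - z); rewrite ler_norml => /andP[+ _].
case: w z pos wz h1 => [p q] [p' q'] pos wz h1 h2; rewrite /= in pos wz h2 h1 *; lra.
Qed.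

Lemma sector_nbhs a b z : sector a b z -> nbhs z (sector a b).
Proof.
move=> [sz bz]; apply/nbhs_normc.
have [d1 d10 P1] := slit_nbhs sz; have [d2 d20 P2] := box_nbhs bz.
have /continuous_normc /(_ _ d20) [d3 d30 P3] := continuous_clog sz.
exists (Num.min d1 d3); first by rewrite lt_min d10.
by move=> w; rewrite lt_min => /andP[/P1 ? /P3 /P2 ?].
Qed.

Lemma sector_open a b : open (sector a b).
Proof. by rewrite openE => z /sector_nbhs. Qed.

Lemma box_convex a b u v (t : R) : 0 <= t <= 1 -> box a b u -> box a b v ->
  box a b ((1 - t)%:C * u + t%:C * v).
Proof.
move=> /andP[t0 t1] [u1 u2] [v1 v2].
have conv (p q c : R) : `|p| < c -> `|q| < c -> `|(1 - t) * p + t * q| < c.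
  move=> pc qc; rewrite (le_lt_trans (ler_normD _ _)) // !normrM.
  rewrite (ger0_norm t0) ger0_norm; last by lra.
  have [->|tn] := eqVneq t 0; first by rewrite subr0 mul1r mul0r addr0.
  have tp : 0 < t by rewrite lt_def tn.
  have : t * `|q| < t * c by rewrite ltr_pM2l.
  have : (1 - t) * `|p| <= (1 - t) * c by rewrite ler_wpM2l ?subr_ge0 // (ltW pc).
  lra.
case: u v u1 u2 v1 v2 => [p q] [p' q'] /= u1 u2 v1 v2; split => /=.
  by rewrite !mul0r !subr0; exact: conv.
by rewrite !mul0r !addr0; exact: conv.
Qed.

(** Sectors are convex in the logarithmic coordinate; these arcs provide the paths, the
    connectedness and the contractions of loops. *)
Definition log_segment z w (t : R) : R[i] := cexp ((1 - t)%:C * clog z + t%:C * clog w).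

Lemma log_segment_sector a b z w t : b <= pi -> sector a b z -> sector a b w ->
  0 <= t <= 1 -> sector a b (log_segment z w t).
Proof.
move=> bp [_ bz] [_ bw] t01; apply: sector_cexp => //; exact: box_convex.
Qed.

Lemma log_segment0 z w : slit_plane z -> log_segment z w 0 = z.
Proof.
by move=> /slit_neq0 z0; rewrite /log_segment subr0 rmorph1 rmorph0 mul1r mul0r addr0 clogK.
Qed.

Lemma log_segment1 z w : slit_plane w -> log_segment z w 1 = w.
Proof.
by move=> /slit_neq0 z0; rewrite /log_segment subrr rmorph1 rmorph0 mul1r mul0r add0r clogK.
Qed.

Lemma cvg_real_complex (T : Type) (F : set_system T) {FF : Filter F} (f : T -> R) (x : R) :
  f @ F --> x -> (fun t => (f t)%:C) @ F --> x%:C.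
Proof. by move=> fx; apply: cvg_complex => //; exact: cvg_cst. Qed.

(** Joint continuity in the parameter and the starting point, over an arbitrary filter, so that it
    serves a single path as well as a homotopy on the closed square. *)
Lemma cvg_log_homotopy (T : Type) (F : set_system T) {FF : Filter F}
    (f : T -> R) (g : T -> R[i]) x z w :
  slit_plane z -> f @ F --> x -> g @ F --> z ->
  (fun t => log_segment (g t) w (f t)) @ F --> log_segment z w x.
Proof.
move=> sz fx gz.
have cx : {for (1 - x)%:C * clog z + x%:C * clog w, continuous cexp}.
  exact: (cdiff_cont (cdiff_cexp _)).
have c1 : (fun t => (1 - f t)%:C) @ F --> (1 - x)%:C.
  by apply: cvg_real_complex; apply: cvgB => //; exact: cvg_cst.
have c2 : (fun t => clog (g t)) @ F --> clog z.
  exact: (@continuous_cvg _ _ _ F FF g clog _ (continuous_clog sz) gz).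
have c3 := @cvgM _ _ F FF _ _ _ _ c1 c2.
have c4 : (fun t => (f t)%:C) @ F --> x%:C by exact: cvg_real_complex.
have c5 := @cvgM _ _ F FF _ _ _ _ c4 (@cvg_cst _ (clog w) _ F FF).
have c6 := @cvgD _ _ _ F FF _ _ _ _ c3 c5.
exact: (@continuous_cvg _ _ _ F FF _ cexp _ cx c6).
Qed.

Lemma continuous_log_segment z w : slit_plane z -> continuous (log_segment z w).
Proof.
move=> sz t; apply: (@cvg_log_homotopy _ (nbhs t) _ id (fun=> z)) => //.
exact: cvg_cst.
Qed.

Lemma sector_path_connected a b : b <= pi -> path_connected (sector a b).
Proof.
move=> bp z w Gz Gw; exists (log_segment z w); split.
- by apply: continuous_subspaceT; apply: continuous_log_segment; exact: Gz.1.
- by move=> _ [t /= t01 <-]; apply: log_segment_sector => //; move: t01; rewrite in_itv.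
- by apply: log_segment0; exact: Gz.1.
- by apply: log_segment1; exact: Gw.1.
Qed.

(** Each point of the loop moves to the base point along a logarithmic segment. The base point stays
    fixed, since the segment from a point to itself is constant. *)
Lemma sector_simply_connected a b : b <= pi -> simply_connected (sector a b).
Proof.
move=> bp; split; first exact: sector_path_connected.
move=> gamma gc gG g01.
have gs t : t \in `[0, 1] -> sector a b (gamma t) by move=> t01; apply: gG; exists t.
have g0 : sector a b (gamma 0) by apply: gs; rewrite in_itv /= lexx ler01.
exists (fun p => log_segment (gamma p.2) (gamma 0) p.1); split.
- apply/subspace_continuousP => -[x t] [/= x01 t01].
  have st : slit_plane (gamma t) by apply: (gs t _).1.
  apply: (@cvg_log_homotopy (R * R)%type _ _ fst (fun p => gamma p.2) x (gamma t) (gamma 0) st).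
    by apply: cvg_within_filter; exact: cvg_fst.
  move/subspace_continuousP : gc => /(_ t t01) gt.
  apply: cvg_trans gt => A /=; rewrite /within /= !nbhs_simpl /= => H.
  exists (setT, [set q | `[0, 1]%classic q -> A (gamma q)]).
    by split => //=; exact: filterT.
  by move=> [p q] /= [_ H'] [_ q01]; exact: H'.
- move=> _ [[x t] [/= x01 t01] <-]; apply: log_segment_sector => //; exact: gs.
- by move=> t t01; apply: log_segment0; exact: (gs t t01).1.
- by move=> t t01; apply: log_segment1; exact: g0.1.
move=> x x01 /=; rewrite -g01.
have -> : log_segment (gamma 0) (gamma 0) x = gamma 0; last by [].
rewrite /log_segment -mulrDl -rmorphD subrK rmorph1 mul1r clogK //.
exact: slit_neq0 g0.1.
Qed.

Lemma sector1 a b : 0 < a -> 0 < b -> b <= pi -> sector a b 1.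
Proof.
move=> a0 b0 bp; rewrite -(@cexp0 R); apply: sector_cexp => //.
by split; rewrite /= normr0.
Qed.

Lemma sector_domain a b : 0 < a -> 0 < b -> b <= pi -> domain (sector a b).
Proof.
move=> a0 b0 bp; have s1 := sector1 a0 b0 bp.
split; [exact: sector_open| |by exists 1].
have -> : sector a b = \bigcup_(w in sector a b) (log_segment 1 w @` `[0, 1]).
  apply/seteqP; split=> [w Gw|_ [w Gw [t /= t01 <-]]].
    exists w => //; exists 1; first by rewrite /= in_itv /= ler01 lexx.
    by apply: log_segment1; exact: Gw.1.
  by apply: log_segment_sector => //; move: t01; rewrite in_itv.
apply: bigcup_connected.
  exists 1 => w Gw; exists 0; first by rewrite /= in_itv /= ler01 lexx.
  by apply: log_segment0; exact: s1.1.
move=> w Gw; apply: connected_continuous_connected; first exact: segment_connected.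
by apply: continuous_subspaceT; apply: continuous_log_segment; exact: s1.1.
Qed.

Lemma sector_bounded a b : bounded_set (sector a b).
Proof.
exists (expR a)%:C; split; first by apply/complex_realP; exists (expR a).
move=> M aM z [sz [la _]] /=; apply: (le_trans _ (ltW aM)).
rewrite normr_complex lecR -[normc z]lnK ?posrE ?normc_gt0 ?slit_neq0 //.
rewrite ler_expR; apply: (le_trans (ler_norm _)); exact: ltW.
Qed.

End LogRectangles.

(** * Sectors around the arc lie in thin tubes *)

Section ArcNeighbourhood.
Context {R : realType} (theta0 : R) (htheta0 : 0 < theta0 < 2 * pi).
Implicit Types (z w u x y : R[i]).

Local Notation s := (sin (theta0 / 4)).

(** For z = exp (i t) and e = exp (i t / 2), z - 1 = 2 i e sin (t / 2). Dividing by s gives the sum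
    2 i e [sg] with |[sg]| <= 1 on the arc, so e ([ta] + i [sg]) and e (- [ta] + i [sg]) have this
    sum and product - e^2 = - z. *)
Lemma arc_fiber (t : R) : `|t| <= theta0 / 2 -> exists x y,
  [/\ fiber s (cexp (0 +i* t)) x y, normc x = 1 & normc y = 1].
Proof.
move=> tb; have [t1 t2] := andP htheta0; have p0 := pi_gt0 R.
have /andP[s0 s1] := sin_theta0 htheta0.
have sC0 : s%:C != 0 :> R[i] by rewrite -normc_eq0 normc_real normr_eq0 gt_eqF.
have {tb} [b1 b2] : - (theta0 / 2) <= t /\ t <= theta0 / 2.
  by move: tb; rewrite ler_norml => /andP[].
have st : `|sin (t / 2)| <= s.
  have i1 : t / 2 \in `[- (pi / 2), pi / 2] by rewrite in_itv /=; lra.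
  have i2 : theta0 / 4 \in `[- (pi / 2), pi / 2] by rewrite in_itv /=; lra.
  have i3 : - (theta0 / 4) \in `[- (pi / 2), pi / 2] by rewrite in_itv /=; lra.
  rewrite ler_norml !leNgt -sinN !ltr_sin // -!leNgt; lra.
pose sg := sin (t / 2) / s; pose ta := Num.sqrt (1 - sg ^+ 2).
have sg1 : sg ^+ 2 <= 1.
  rewrite -(real_normK (num_real sg)) expr_le1 // /sg normrM normfV (gtr0_norm s0).
  by rewrite ler_pdivrMr // mul1r.
have ta2 : ta ^+ 2 = 1 - sg ^+ 2 by rewrite sqr_sqrtr // subr_ge0.
pose e : R[i] := cexp (0 +i* (t / 2)).
have ne : normc e = 1 by rewrite normc_cexp expR0.
have zE : cexp (0 +i* t) = e * e.
  rewrite -cexpD; congr cexp; apply/eqP.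
  by rewrite eq_complex /= addr0 eqxx /=; apply/eqP; lra.
have n1 (p q : R) : p ^+ 2 + q ^+ 2 = 1 -> normc (p +i* q) = 1.
  move=> pq; apply/eqP; rewrite -(@eqrXn2 _ 2) ?normc_ge0 ?ler01 //.
  by rewrite normc_sqr expr1n /= pq.
exists (e * (ta +i* sg)), (e * ((- ta) +i* sg)); split; last 2 first.
- by rewrite normcM ne mul1r; apply: n1; rewrite ta2; ring.
- by rewrite normcM ne mul1r; apply: n1; rewrite sqrrN ta2; ring.
split.
  pose ei : R[i] := cexp (0 +i* - (t / 2)).
  have ee : e * ei = 1.
    rewrite -cexpD (_ : _ + _ = 0) ?cexp0 //.
    by apply/eqP; rewrite eq_complex /= addr0 subrr eqxx.
  rewrite zE -ee -mulrBr -mulrDr -mulrA; congr (_ * _).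
  apply: (mulIf sC0); rewrite divfK //.
  rewrite /e /ei /cexp /= expR0 cosN sinN; apply/eqP; rewrite eq_complex /=.
  apply/andP; split; apply/eqP; first by ring.
  by rewrite /sg; field; rewrite gt_eqF.
rewrite zE mulrACA -[in RHS](mulr1 (e * e)) -mulrN; congr (_ * _); apply/eqP; rewrite eq_complex /=.
apply/andP; split; apply/eqP; last by ring.
have -> : ta * - ta - sg * sg = - (ta ^+ 2) - sg ^+ 2 by ring.
by rewrite ta2; ring.
Qed.

Lemma fiber_exists z : exists x y, fiber s z x y.
Proof.
pose b := (z - 1) / s%:C; pose d := sqrtc (b ^+ 2 + 4 * z).
exists ((b + d) / 2), ((b - d) / 2); split; first by rewrite -/b; field.
have := sqr_sqrtc (b ^+ 2 + 4 * z); rewrite -/d => d2.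
have -> : (b + d) / 2 * ((b - d) / 2) = (b ^+ 2 - d ^+ 2) / 4 by field.
by rewrite d2; field.
Qed.

(** Rests on the identity s (x - x0) (x - y0) = (z - z0) (x + s). If |x| = 1 + t with t > k, the
    left side is at least s t^2 and the right side at most |z - z0| (t + 2); as t^2 / (t + 2)
    increases, this contradicts the bound on |z - z0|. *)
Lemma fiber_perturb (k : R) z0 x0 y0 z x y : 0 < k ->
  fiber s z0 x0 y0 -> normc x0 = 1 -> normc y0 = 1 -> fiber s z x y ->
  normc (z - z0) <= s * k ^+ 2 / (k + 2) -> normc x <= 1 + k.
Proof.
move=> k0 [a0 b0] nx0 ny0 [a b] zz; have /andP[s0 s1] := sin_theta0 htheta0.
have sC0 : s%:C != 0 :> R[i] by rewrite -normc_eq0 normc_real normr_eq0 gt_eqF.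
rewrite leNgt; apply/negP => xk.
have E : s%:C * ((x - x0) * (x - y0)) = (z - z0) * (x + s%:C).
  have -> : (x - x0) * (x - y0) = x * x - (x0 + y0) * x + x0 * y0 by ring.
  have x2 : x * x = (x + y) * x - x * y by ring.
  by rewrite x2 a b a0 b0; field.
have := congr1 (@normc R) E; rewrite !normcM normc_real (gtr0_norm s0) => {}E.
pose t := normc x - 1.
have tk : k < t by rewrite /t; lra.
have h1 : t <= normc (x - x0).
  by have := normcD (x - x0) x0; rewrite subrK nx0 /t; lra.
have h2 : t <= normc (x - y0).
  by have := normcD (x - y0) y0; rewrite subrK ny0 /t; lra.
have h3 : normc (x + s%:C) <= t + 2.
  by rewrite (le_trans (normcD _ _)) // normc_real (gtr0_norm s0) /t; lra.
have t0 : 0 <= t by lra.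
have l1 : s * (t * t) <= s * (normc (x - x0) * normc (x - y0)).
  by rewrite ler_pM2l // ler_pM.
have l2 : normc (z - z0) * normc (x + s%:C) <= s * k ^+ 2 / (k + 2) * (t + 2).
  by rewrite ler_pM ?normc_ge0.
have : s * (t * t) <= s * k ^+ 2 / (k + 2) * (t + 2).
  by rewrite (le_trans l1) // E.
have k2 : 0 < k + 2 by lra.
rewrite mulrAC ler_pdivlMr // -!mulrA ler_pM2l // leNgt => /negP; apply.
rewrite -subr_gt0 (_ : _ - _ = (t - k) * (t * k + 2 * (t + k))); last by ring.
by rewrite mulr_gt0 ?subr_gt0 // ltr_wpDl ?mulr_ge0 ?mulr_gt0 //; lra.
Qed.

Lemma fiber_sym z x y : fiber s z x y -> fiber s z y x.
Proof. by move=> [a b]; split; [rewrite addrC|rewrite mulrC]. Qed.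

(** Clamping Im (log z) to [- theta0 / 2, theta0 / 2] gives a point of the arc close to z, whose two
    solutions have modulus 1; [fiber_perturb] carries the bound over to z. *)
Lemma sector_in_tube (k : R) : 0 < k -> exists eta, [/\ 0 < eta,
  theta0 / 2 + eta <= pi & sector eta (theta0 / 2 + eta) `<=` tube s (1 + k)].
Proof.
move=> k0; have [t1 t2] := andP htheta0; have p0 := pi_gt0 R.
have ssin := sin_theta0 htheta0; have /andP[s0 s1] := ssin.
have d0 : 0 < s * k ^+ 2 / (k + 2) by rewrite divr_gt0 ?mulr_gt0 ?exprn_gt0 //; lra.
have /continuous_normc /(_ _ d0) [e e0 eP] := cdiff_cont (@cdiff_cexp R 0).
(* The first term keeps the opening of the sector at most pi; the second bounds the sum of the real
   and imaginary displacements by e. *)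
pose eta := Num.min (pi - theta0 / 2) (e / 2).
have eta0 : 0 < eta by rewrite lt_min divr_gt0 // andbT; lra.
have eta1 : eta <= pi - theta0 / 2 by rewrite ge_min lexx.
have eta2 : eta <= e / 2 by rewrite ge_min lexx orbT.
exists eta; split => //; first by lra.
clearbody eta.
move=> z [sz [br bi]].
pose u := clog z; rewrite -/u in br bi.
have zE : z = cexp u by rewrite /u clogK // slit_neq0.
have [t [tb ut]] : exists t, `|t| <= theta0 / 2 /\ `|complex.Im u - t| < eta.
  have [c1|c1] := leP (complex.Im u) (theta0 / 2).
    have [c2|c2] := leP (- (theta0 / 2)) (complex.Im u).
      by exists (complex.Im u); rewrite subrr normr0 ler_norml c1 c2.
    exists (- (theta0 / 2)); rewrite normrN ger0_norm; last by lra.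
    by split => //; move: bi; rewrite !ltr_norml; lra.
  exists (theta0 / 2); rewrite ger0_norm; last by lra.
  by split => //; move: bi; rewrite !ltr_norml; lra.
have [x0 [y0 [f0 nx0 ny0]]] := arc_fiber tb.
have zz : normc (z - cexp (0 +i* t)) <= s * k ^+ 2 / (k + 2).
  pose h := complex.Re u +i* (complex.Im u - t).
  have uE : u = (0 +i* t) + h.
    by apply/eqP; rewrite eq_complex /= add0r addrC subrK !eqxx.
  have -> : z - cexp (0 +i* t) = cexp (0 +i* t) * (cexp h - cexp 0).
    by rewrite zE uE cexpD cexp0 mulrBr mulr1.
  rewrite normcM normc_cexp expR0 mul1r ltW // eP // subr0.
  apply: (le_lt_trans (normc_le_ReIm _)) => /=.
  move: br bi ut; rewrite /h /=; lra.
have [x [y fxy]] := fiber_exists z.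
exists x, y; split => //; first exact: (fiber_perturb k0 f0 nx0 ny0 fxy zz).
exact: (fiber_perturb k0 f0 nx0 ny0 (fiber_sym fxy) zz).
Qed.

Lemma arc_in_sector (eta : R) : 0 < eta -> theta0 / 2 + eta <= pi ->
  circular_arc theta0 `<=` sector eta (theta0 / 2 + eta).
Proof.
move=> eta0 etap _ [t /= + <-]; rewrite in_itv /= => /andP[b1 b2].
apply: sector_cexp => //; split => /=; first by rewrite normr0.
by rewrite ltr_norml; lra.
Qed.

End ArcNeighbourhood.

(** For each n the choice is good for the largest j <= n that admits a good element, and is t0 if
    there is none. The first clause keeps what holds of t0 and of all good elements, such as a
    degree bound, for every n. *)
Lemma diagonal_choice (T : Type) (t0 : T) (good : nat -> nat -> T -> Prop) :
  (forall j, exists N, forall n, (N <= n)%N -> exists t, good j n t) ->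
  exists t : nat -> T, (forall n, t n = t0 \/ exists j, good j n (t n)) /\
    forall j, exists N, forall n, (N <= n)%N -> exists2 i, (j <= i)%N & good i n (t n).
Proof.
move=> H.
have step n : exists t, (t = t0 \/ exists j, good j n t) /\
    forall j, (j <= n)%N -> (exists t', good j n t') -> exists2 i, (j <= i)%N & good i n t.
  suff S b : exists t, (t = t0 \/ exists j, good j n t) /\
      forall j, (j < b)%N -> (exists t', good j n t') -> exists2 i, (j <= i)%N & good i n t.
    exact: (S n.+1).
  elim: b => [|b [t [tg tP]]]; first by exists t0; split => //; left.
  have [[t' gt']|no] := pselect (exists t', good b n t').
    exists t'; split; first by right; exists b.
    by move=> j; rewrite ltnS => jb _; exists b.
  exists t; split => // j; rewrite ltnS leq_eqVlt => /predU1P[->|/tP //].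
  by move=> ex; case: no.
have [t tP] := choice step; exists t; split=> [n|j]; first by case: (tP n).
have [N NP] := H j; exists (maxn N j) => n; rewrite geq_max => /andP[Nn jn].
by have [_] := tP n; apply => //; exact: NP.
Qed.

(** * Approximation of holomorphic functions on a sector *)

Section SectorApproximation.
Context {R : realType} (s : R) (s01 : 0 < s < 1).
Implicit Types (z w u : R[i]) (a b : R).

(** The margin l is spent twice: once to pass from the open box to a closed rectangle where f(exp u)
    is differentiable, once as the margin in [runge_rectangle]. *)
Lemma sector_runge (r a b l : R) f : 0 < r -> s * r < 1 -> b <= pi ->
  0 < l -> 2 * l < a -> 2 * l < b ->
  sector a b `<=` tube s r -> holomorphic_in (sector a b) f ->
  poly_approx [set z | slit_plane z /\
    rectangle (- a + l + l) (a - l - l) (- b + l + l) (b - l - l) (clog z)] f.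
Proof.
move=> r0 sr bp l0 la lb st hf.
set X := (X in poly_approx X f).
have sub u : rectangle (- a + l) (a - l) (- b + l) (b - l) u -> box a b u.
  move=> [/andP[p1 p2] /andP[q1 q2]]; split; rewrite ltr_norml; lra.
have XS : X `<=` sector a b.
  move=> z [sz [/andP[p1 p2] /andP[q1 q2]]]; split => //.
  by split; rewrite ltr_norml; lra.
have bX : normc_bounded X.
  by have [M MP] := @tube_bounded R s r; exists M => z /XS /st /MP.
have pF : poly_approx (rectangle (- a + l + l) (a - l - l) (- b + l + l) (b - l - l))
    (fun u => f (cexp u)).
  apply: runge_rectangle => //; [lra|lra|].
  move=> u /sub bu; apply: cdiff_comp; first exact: cdiff_cexp.
  by apply: derivable_cdiff; apply: hf; exact: sector_cexp.
have pl : poly_approx X clog.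
  by apply: poly_approx_sub (clog_approx s01 r0 sr) => z /XS /st.
have := poly_approx_comp bX pl (fun z (Xz : X z) => Xz.2) pF.
by apply: poly_approx_eq => z [sz _]; rewrite clogK // slit_neq0.
Qed.

(** An exhaustion of the sector by the sets of [sector_runge] with l = a / 2^(j+2); the exponent j +
    2 ensures 2 l < a already for j = 0. *)
Definition inner_sector a b j : set R[i] := [set z | slit_plane z /\
  rectangle (- a + a / 2 ^+ j.+2 + a / 2 ^+ j.+2) (a - a / 2 ^+ j.+2 - a / 2 ^+ j.+2)
    (- b + a / 2 ^+ j.+2 + a / 2 ^+ j.+2) (b - a / 2 ^+ j.+2 - a / 2 ^+ j.+2) (clog z)].

Lemma inner_sectorS a b j i : 0 < a -> (j <= i)%N ->
  inner_sector a b j `<=` inner_sector a b i.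
Proof.
move=> a0 ji z [sz [/andP[p1 p2] /andP[q1 q2]]]; split => //.
have : a / 2 ^+ i.+2 <= a / 2 ^+ j.+2.
  rewrite ler_pM2l // lef_pV2 ?posrE ?exprn_gt0 //.
  by rewrite ler_eXn2l ?ltr1n // !ltnS.
by split; lra.
Qed.

Lemma inner_sector_nbhs a b z : 0 < a -> sector a b z ->
  exists j, nbhs z (inner_sector a b j).
Proof.
move=> a0 [sz [b1 b2]].
pose m := Num.min (a - `|complex.Re (clog z)|) (b - `|complex.Im (clog z)|).
have m0 : 0 < m by rewrite lt_min !subr_gt0 b1.
have [N NP] := pow2_small (ltW a0) m0.
exists N.
have lN : a / 2 ^+ N.+2 + a / 2 ^+ N.+2 < m.
  have := NP N.+1 (leqnSn N).
  have -> : a / 2 ^+ N.+1 = a / 2 ^+ N.+2 + a / 2 ^+ N.+2; last by [].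
  by rewrite [in RHS]exprS; field; rewrite expf_neq0.
have [m1 m2] : m <= a - `|complex.Re (clog z)| /\ m <= b - `|complex.Im (clog z)|.
  by rewrite !ge_min !lexx orbT.
set l := a / _ in lN.
have : sector (a - l - l) (b - l - l) z by split => //; split; lra.
move=> /sector_nbhs; apply: filterS => w [sw [w1 w2]]; split => //.
by split; move: w1 w2; rewrite !ltr_norml -/l => /andP[? ?] /andP[? ?]; lra.
Qed.

(** At level j, f is replaced by a polynomial q on an inner sector, and q by weighted polynomials
    for all large n. How large depends on j, so [diagonal_choice] is needed to obtain one sequence
    that works on every inner sector. *)
Lemma sector_approximation_pair (alpha r r' a b : R) :
  0 < alpha -> 1 < r' -> r' < r -> s * r < 1 ->
  (1 + 2 * alpha) * ln r' < ln r + alpha * ln (arc_min s r) ->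
  0 < a -> a <= b -> b <= pi -> sector a b `<=` tube s r' ->
  approximation_pair (sector a b) alpha.
Proof.
move=> al0 r'1 r'r sr gap a0 ab bp st f hf.
have st' : sector a b `<=` tube s r.
  by move=> z /st; apply: tubeS; exact: ltW.
have r0 : 0 < r by lra.
pose e j : R := 1 / 2 ^+ j.
have e0 j : 0 < e j by rewrite divr_gt0 // exprn_gt0.
(* One [e j] accounts for the passage from f to q, the other for that from q to the weighted
   polynomial. *)
pose good j n (P : {poly R[i]}) := (size P <= n.+1)%N /\
  forall z, inner_sector a b j z ->
    normc (cpow z (alpha * n%:R) * P.[z] - f z) <= e j + e j.
have inner j : inner_sector a b j `<=` sector a b.
  have l0 : 0 < a / 2 ^+ j.+2 by rewrite divr_gt0 // exprn_gt0.
  move=> z [sz [/andP[p1 p2] /andP[q1 q2]]]; split => //.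
  by split; rewrite ltr_norml; lra.
have [|P [Pg PP]] := @diagonal_choice _ (0 : {poly R[i]}) good.
  move=> j.
  have l0 : 0 < a / 2 ^+ j.+2 by rewrite divr_gt0 // exprn_gt0.
  have la : 2 * (a / 2 ^+ j.+2) < a.
    rewrite mulrCA -[ltRHS]mulr1 ltr_pM2l // ltr_pdivrMr ?exprn_gt0 // mul1r.
    by rewrite exprS -[ltLHS]mulr1 ltr_pM2l // exprn_egt1 // ltr1n.
  have lb : 2 * (a / 2 ^+ j.+2) < b by exact: lt_le_trans la ab.
  have [q qP] := sector_runge r0 sr bp l0 la lb st' hf (e0 j).
  have [N NP] := weighted_poly_approx s01 q al0 r'1 r'r sr gap (e0 j).
  exists N => n /NP [Q sQ QP]; exists Q; split => // z Xz.
  rewrite (_ : _ - f z = (cpow z (alpha * n%:R) * Q.[z] - q.[z]) - (f z - q.[z])); last by ring.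
  rewrite (le_trans (normcB _ _)) // lerD //; first by apply: QP; exact/st/inner/Xz.
  exact: qP.
exists P.
  move=> n; case: (Pg n) => [->|[j [sP _]]] //.
  by rewrite size_poly0.
move=> z Gz; have [J JP] := inner_sector_nbhs a0 Gz.
exists (inner_sector a b J) => //.
apply/uniform_cvg_normc => eps eps0.
have [K KP] := pow2_small (ler01 : 0 <= 1 :> R) (divr_gt0 eps0 (ltr0n R 2)).
pose j := maxn J K.
have [N NP] := PP j; exists N => n w Nn [Xw _].
have [i ji [_ gP]] := NP n Nn.
have Ji : (J <= i)%N by rewrite (leq_trans _ ji) // leq_maxl.
have Ki : (K <= i)%N by rewrite (leq_trans _ ji) // leq_maxr.
apply: (le_lt_trans (gP w (inner_sectorS a0 Ji Xw))).
by have := KP i Ki; rewrite /e; lra.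
Qed.

End SectorApproximation.

Theorem proposition4p4 (R : realType) (theta0 : R)
    (htheta0 : 0 < theta0 < 2 * pi) :
  is_alpha (circular_arc theta0)
    ((1 - sin (theta0 / 4)) / (2 * sin (theta0 / 4)))%:E.
Proof.
have ssin := sin_theta0 htheta0; have /andP[s0 s1] := ssin.
split; first by rewrite lte_fin divr_gt0 ?mulr_gt0 ?subr_gt0.
move=> alpha alpha0; rewrite lte_fin lee_fin; split; last exact: not_approximable.
move=> al; have [r [r1 sr L0]] := threshold_above ssin alpha0 al.
set L := ln r + _ in L0.
have a2 : 0 < 1 + 2 * alpha by lra.
(* The tube has radius r' = 1 + k. The first term gives (1 + 2 alpha) ln (1 + k) <= L / 2 < L
   through ln (1 + k) <= k; the second keeps r' below r. *)
pose k := Num.min (L / (2 * (1 + 2 * alpha))) ((r - 1) / 2).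
have k0 : 0 < k by rewrite lt_min !divr_gt0 ?mulr_gt0 ?subr_gt0.
have kL : k <= L / (2 * (1 + 2 * alpha)) by rewrite ge_min lexx.
have kr : k <= (r - 1) / 2 by rewrite ge_min lexx orbT.
clearbody k.
have gap : (1 + 2 * alpha) * ln (1 + k) < L.
  have lk : ln (1 + k) <= k by apply: le_ln1Dx; lra.
  apply: (@le_lt_trans _ _ ((1 + 2 * alpha) * k)); first by rewrite ler_pM2l.
  by move: kL; rewrite ler_pdivlMr ?mulr_gt0 //; lra.
have [eta [eta0 etap st]] := sector_in_tube htheta0 k0.
have [t1 t2] := andP htheta0.
have b0 : 0 < theta0 / 2 + eta by lra.
exists (sector eta (theta0 / 2 + eta)); split.
- by split; [exact: sector_domain|exact: sector_bounded].
- exact: sector_simply_connected.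
- by move=> z [].
- exact: arc_in_sector.
have k1 : 1 < 1 + k by rewrite ltrDl.
have kr1 : 1 + k < r by lra.
apply: (sector_approximation_pair ssin alpha0 k1 kr1 sr gap eta0 _ etap st).
by lra.
Qed.
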